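(* Let $(x^*,y^*,u^*,v^* )$ be a local solution of the combined program (CP) described in the context. Suppose that either $Y(x)=Y$ is independent of $x$ with $Y$ compact, or the set-valued map $Y(\cdot)$ is uniformly bounded around $x^*$ (there is a neighbourhood $\mathbb{U}$ of $x^*$ with $\bigcup_{x\in\mathbb{U}}Y(x)$ bounded) and MFCQ holds for the lower level constraint system $g(x^*,\cdot)\le0$, $h(x^*,\cdot)=0$ at every $y\in S(x^* )$. For index sets $\mathcal{I}_3,\mathcal{I}_4\subseteq\mathcal{J}^*$, $\mathcal{I}_2\subseteq I_G^*$ and $\alpha\in\{0,1\}$ denote $$J'(x,y,u,v,\alpha,w)=\begin{bmatrix}\nabla(\nabla_yf+u\nabla_yg+v\nabla_yh)(x,y)&\nabla_yh(x,y)^T&\nabla_yg(x,y)^T\\ \nabla h(x,y)&0&0\\ \nabla H(x,y)&0&0\\ \nabla G_{\mathcal{I}_2}(x,y)&0&0\\ \nabla g_{\mathcal{I}^*\cup\mathcal{I}_3}(x,y)&0&0\\ 0&0&E_{\mathcal{K}^*\cup\mathcal{I}_4}\\ \alpha(\nabla f(x,y)-(w,0))&0&0\end{bmatrix},$$ where $E_{\mathcal{K}^*\cup\mathcal{I}_4}\in\mathbb{R}^{(|\mathcal{K}^*|+|\mathcal{I}_4|)\times m}$ is the matrix with rows $e_i^T$, $i\in\mathcal{K}^*\cup\mathcal{I}_4$, and $e_i\in\mathbb{R}^m$ is the $i$-th unit vector. Assume that for all such $\mathcal{I}_2,\mathcal{I}_3,\mathcal{I}_4,\alpha$, every $w^*\in\mathrm{co}\,W(x^*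 )$, and all sequences $x^k\to x^*$, $y^k\to y^*$, $u^k\to u^*$, $v^k\to v^*$, $w^k\to w^*$ with $w^k\in\mathrm{co}\,W(x^k)$, the matrices $J'(x^*,y^*,u^*,v^*,\alpha,w^* )$ and $J'(x^k,y^k,u^k,v^k,\alpha,w^k)$ have the same rank for all sufficiently large $k$. Then RCRCQ for (CP) holds at $(x^*,y^*,u^*,v^* )$, and $(x^*,y^*,u^*,v^* )$ is an M-stationary point of (CP).
   Context: Combined program. $F:\mathbb{R}^d\times\mathbb{R}^s\to\mathbb{R}$ is locally Lipschitz; $G:\mathbb{R}^d\times\mathbb{R}^s\to\mathbb{R}^p$, $H:\mathbb{R}^d\times\mathbb{R}^s\to\mathbb{R}^q$ are continuously differentiable; $f:\mathbb{R}^d\times\mathbb{R}^s\to\mathbb{R}$, $g:\mathbb{R}^d\times\mathbb{R}^s\to\mathbb{R}^m$, $h:\mathbb{R}^d\times\mathbb{R}^s\to\mathbb{R}^n$ are continuously differentiable and their partial derivatives in $y$ are continuously differentiable in $(x,y)$. $Y(x)=\{y:g(x,y)\le0,\ h(x,y)=0\}$, $V(x)=\inf_{y\in Y(x)}f(x,y)$, $S(x)=\{y\in Y(x):f(x,y)=V(x)\}$. With $\nabla_yL(x,y,u,v)=\nabla_yf(x,y)+\nabla_yg(x,y)^Tu+\nabla_yh(x,y)^Tv$ and $\Omega^m=\{(a,b)\in\mathbb{R}^m\times\mathbb{R}^m:0\le a\perp b\ge0\}$, (CP) is: minimize $F(x,y)$ over $(x,y,u,v)\in\mathbb{R}^d\times\mathbb{R}^s\times\mathbb{R}^m\times\mathbb{R}^n$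 subject to $f(x,y)-V(x)\le0$, $G(x,y)\le0$, $H(x,y)=0$, $h(x,y)=0$, $\nabla_yL(x,y,u,v)=0$, $(-g(x,y),u)\in\Omega^m$. Notation: $u\nabla_yg=\sum_iu_i\nabla_yg_i$, etc.; $\nabla(\cdot)$ without subscript is the derivative with respect to $(x,y)$; $g_{\mathcal{A}}$ is the subvector of components in $\mathcal{A}$; $\mathrm{co}$ is convex hull. MFCQ for the lower level at $y$ (with $x=x^*$): the vectors $\nabla_yh_j(x^*,y)$, $j=1,\dots,n$, are linearly independent and there is $\xi\in\mathbb{R}^s$ with $\nabla_yh(x^*,y)\xi=0$ and $\langle\nabla_yg_i(x^*,y),\xi\rangle<0$ whenever $g_i(x^*,y)=0$. The set $W(x)$: if $Y(x)=Y$ is independent of $x$ (first alternative), $W(x)=\{\nabla_xf(x,y):y\in S(x)\}$; in the second alternative, $W(x)=\bigcup_{y\in S(x)}\{\nabla_xf(x,y)+u\nabla_xg(x,y)+v\nabla_xh(x,y):(u,v)\in M(x,y)\}$, where $M(x,y)=\{(u,v):0=\nabla_yf(x,y)+u\nabla_yg(x,y)+v\nabla_yh(x,y),\ u\ge0,\ \langle g(x,y),u\rangle=0\}$. Index sets at $(x^*,y^*,u^*,v^* )$: $I_G^*=\{i:G_i(x^*,y^* )=0\}$, $\mathcal{I}^*=\{i:g_i(x^*,y^* )=0,u_i^*>0\}$, $\mathcal{J}^*=\{i:g_i(x^*,y^* )=0,u_i^*=0\}$, $\mathcal{K}^*=\{i:g_i(x^*,y^* )<0,u_i^*=0\}$.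 The limiting subdifferential of a locally Lipschitz $\varphi$ is $\partial\varphi(z)=\{\lim\xi_k:\xi_k\in\widehat\partial\varphi(z_k),\ z_k\to z\}$ with $\widehat\partial\varphi(z)=\{\zeta:\varphi(z')-\varphi(z)-\langle\zeta,z'-z\rangle\ge o(\|z'-z\|)\}$. RCRCQ for (CP). Write $z=(x,y,u,v)$, $z^*=(x^*,y^*,u^*,v^* )$ and regard all functions as functions of $z$: $\theta_0(z)=f(x,y)-V(x)$, $\theta_i(z)=G_i(x,y)$ ($i=1,\dots,p$), $I_\theta^*=\{0\}\cup I_G^*$; $e_j$, $j=1,\dots,M$, are all components of $H(x,y)$, $h(x,y)$, $\nabla_yL(z)$; $\mathcal{G}_i(z)=-g_i(x,y)$, $\mathcal{H}_i(z)=u_i$. RCRCQ holds at $z^*$ if for any $\mathcal{A}\subseteq I_\theta^*$, $\mathcal{B},\mathcal{D}\subseteq\mathcal{J}^*$, any $w_i^*\in\partial\theta_i(z^* )$ ($i\in\mathcal{A}$), and all sequences $z^k\to z^*$, $z^k\neq z^*$, $w_i^k\in\partial\theta_i(z^k)$ with $w_i^k\to w_i^*$ ($i\in\mathcal{A}$), for all sufficiently large $k$ the family $\{w_i^k\}_{i\in\mathcal{A}}\cup\{\nabla e_j(z^k)\}_{j=1}^M\cup\{\nabla\mathcal{G}_i(z^k)\}_{i\in\mathcal{I}^*\cup\mathcal{B}}\cup\{\nabla\mathcal{H}_i(z^k)\}_{i\in\mathcal{K}^*\cup\mathcal{D}}$ has the same rank as the corresponding family with $w_i^*$ and $z^*$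 in place of $w_i^k$ and $z^k$. M-stationarity of a feasible point $z^*$ for (CP): there exist $\lambda^V\ge0$, $\lambda_i^G\ge0$ ($i\in I_G^*$), $\lambda^H\in\mathbb{R}^q$, $\lambda^h\in\mathbb{R}^n$, $\lambda^L\in\mathbb{R}^s$, $a,b\in\mathbb{R}^m$ such that $$0\in\partial F(x^*,y^* )+\lambda^V\partial(f-V)(x^*,y^* )+\sum_{i\in I_G^*}\lambda_i^G\nabla G_i(x^*,y^* )+\nabla H(x^*,y^* )^T\lambda^H+\nabla h(x^*,y^* )^T\lambda^h+\nabla_{(x,y)}(\nabla_yL)(z^* )^T\lambda^L+\sum_{i\in\mathcal{I}^*\cup\mathcal{J}^*}a_i\nabla g_i(x^*,y^* ),$$ $\nabla_yg(x^*,y^* )\lambda^L-b=0$, $\nabla_yh(x^*,y^* )\lambda^L=0$, $b_i=0$ for $i\in\mathcal{I}^*$, $a_i=0$ for $i\in\mathcal{K}^*$, and for $i\in\mathcal{J}^*$ either $a_i>0,b_i>0$ or $a_ib_i=0$ (here $f-V$ is the function $(x,y)\mapsto f(x,y)-V(x)$). *)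

(* Defs.v *)
From HB Require Import structures.
From mathcomp Require Import all_boot all_order all_algebra.
From mathcomp Require Import all_classical all_reals all_analysis.

Set Implicit Arguments.
Unset Strict Implicit.
Unset Printing Implicit Defensive.

Import Order.TTheory GRing.Theory Num.Theory.
Import numFieldNormedType.Exports.

Local Open Scope classical_set_scope.
Local Open Scope ring_scope.

(* R^d x R^s is represented by 'rV[R]_(d + s): the pair (x, y) is row_mx x y,
   and the partial derivatives in x (resp. y) are the left (resp. right)
   blocks of the derivatives.  Vectors are row vectors, and the normed space
   'rV[R]_k carries the sup norm, which changes none of the notions below. *)

Definition dotp {R : realType} {k : nat} (a b : 'rV[R]_k) : R :=
  \sum_(i < k) a 0 i * b 0 i.

Definition grad {R : realType} {k : nat} (phi : 'rV[R]_k -> R) (z : 'rV[R]_k)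
  : 'rV[R]_k := \row_j 'D_(delta_mx 0 j) phi z.

(* Row i of jac phi z is the gradient of the i-th component; the jacobian of
   the library acts on row vectors from the right, hence the transpose. *)
Definition jac {R : realType} {k l : nat} (phi : 'rV[R]_k -> 'rV[R]_l)
  (z : 'rV[R]_k) : 'M[R]_(l, k) := (jacobian phi z)^T.

Definition C1_fun {R : realType} {k : nat} (phi : 'rV[R]_k -> R) : Prop :=
  (forall z, differentiable phi z) /\ continuous (grad phi).

Definition C1_map {R : realType} {k l : nat} (phi : 'rV[R]_k -> 'rV[R]_l)
  : Prop := (forall z, differentiable phi z) /\ continuous (jac phi).

Definition locally_lipschitz {R : realType} {k : nat} (phi : 'rV[R]_k -> R)
  : Prop := forall z : 'rV[R]_k, exists2 U : set 'rV[R]_k, nbhs z U &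
    [lipschitz phi z' | z' in U].

Definition frechet_subdiff {R : realType} {k : nat} (phi : 'rV[R]_k -> R)
  (z : 'rV[R]_k) : set 'rV[R]_k :=
  [set zeta | forall e : R, 0 < e ->
    \forall z' \near z,
      - (e * `|z' - z|) <= phi z' - phi z - dotp zeta (z' - z)].

Definition limiting_subdiff {R : realType} {k : nat} (phi : 'rV[R]_k -> R)
  (z : 'rV[R]_k) : set 'rV[R]_k :=
  [set xi | exists zk xik : nat -> 'rV[R]_k,
    [/\ zk @ \oo --> z, xik @ \oo --> xi &
        forall j, frechet_subdiff phi (zk j) (xik j)]].

Definition co {R : realType} {k : nat} (A : set 'rV[R]_k) : set 'rV[R]_k :=
  [set w | exists (l : nat) (t : 'I_l -> R) (a : 'I_l -> 'rV[R]_k),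
    [/\ forall i, 0 <= t i, \sum_(i < l) t i = 1, forall i, A (a i) &
        w = \sum_(i < l) t i *: a i]].

Definition Omega {R : realType} {m : nat} (a b : 'rV[R]_m) : Prop :=
  [/\ forall i, 0 <= a 0 i, forall i, 0 <= b 0 i & dotp a b = 0].

Definition subrows {R : realType} {k l : nat} (A : {set 'I_k})
  (M : 'M[R]_(k, l)) : 'M[R]_(#|A|, l) :=
  rowsub (fun i : 'I_#|A| => enum_val i) M.

Definition family_rank {R : realType} {k : nat} (s : seq 'rV[R]_k) : nat :=
  \dim (span s).

Section CombinedProgram.
Variables (R : realType) (d s p q m n : nat).
Variables (F : 'rV[R]_(d + s) -> R) (G : 'rV[R]_(d + s) -> 'rV[R]_p)
          (H : 'rV[R]_(d + s) -> 'rV[R]_q).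
Variables (f : 'rV[R]_(d + s) -> R) (g : 'rV[R]_(d + s) -> 'rV[R]_m)
          (h : 'rV[R]_(d + s) -> 'rV[R]_n).

Implicit Types (x : 'rV[R]_d) (y : 'rV[R]_s) (u : 'rV[R]_m) (v : 'rV[R]_n).

Definition Yset x : set 'rV[R]_s :=
  [set y | (forall i, g (row_mx x y) 0 i <= 0) /\ h (row_mx x y) = 0].

Definition Vfun x : \bar R := ereal_inf [set (f (row_mx x y))%:E | y in Yset x].

Definition Sset x : set 'rV[R]_s :=
  [set y | Yset x y /\ (f (row_mx x y))%:E = Vfun x].

Definition gradyL (xy : 'rV[R]_(d + s)) u v : 'rV[R]_s :=
  rsubmx (grad f xy) + u *m rsubmx (jac g xy) + v *m rsubmx (jac h xy).

Definition KKT_multipliers x y : set ('rV[R]_m * 'rV[R]_n) :=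
  [set uv | [/\ 0 = gradyL (row_mx x y) uv.1 uv.2,
                forall i, 0 <= uv.1 0 i &
                dotp (g (row_mx x y)) uv.1 = 0]].

Definition W_fixed x : set 'rV[R]_d :=
  [set lsubmx (grad f (row_mx x y)) | y in Sset x].

Definition W_moving x : set 'rV[R]_d :=
  \bigcup_(y in Sset x)
    [set lsubmx (grad f (row_mx x y)) + uv.1 *m lsubmx (jac g (row_mx x y))
         + uv.2 *m lsubmx (jac h (row_mx x y)) | uv in KKT_multipliers x y].

Definition Y_constant_compact : Prop :=
  exists Y0 : set 'rV[R]_s, compact Y0 /\ forall x, Yset x = Y0.

Definition Y_uniformly_bounded x : Prop :=
  exists U : set 'rV[R]_d, nbhs x U /\ bounded_set (\bigcup_(x' in U) Yset x').

Definition MFCQ x y : Prop :=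
  row_free (rsubmx (jac h (row_mx x y))) /\
  exists xi : 'rV[R]_s,
    rsubmx (jac h (row_mx x y)) *m xi^T = 0 /\
    forall i, g (row_mx x y) 0 i = 0 ->
      dotp (row i (rsubmx (jac g (row_mx x y)))) xi < 0.

Definition IG (xy : 'rV[R]_(d + s)) : {set 'I_p} := [set i | G xy 0 i == 0].
Definition Iset (xy : 'rV[R]_(d + s)) u : {set 'I_m} :=
  [set i | (g xy 0 i == 0) && (0 < u 0 i)].
Definition Jset (xy : 'rV[R]_(d + s)) u : {set 'I_m} :=
  [set i | (g xy 0 i == 0) && (u 0 i == 0)].
Definition Kset (xy : 'rV[R]_(d + s)) u : {set 'I_m} :=
  [set i | (g xy 0 i < 0) && (u 0 i == 0)].

(* z = (x, y, u, v) is row_mx (row_mx x y) (row_mx u v). *)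
Definition zpt x y u v : 'rV[R]_((d + s) + (m + n)) :=
  row_mx (row_mx x y) (row_mx u v).
Definition zxy (z : 'rV[R]_((d + s) + (m + n))) : 'rV[R]_(d + s) := lsubmx z.
Definition zx (z : 'rV[R]_((d + s) + (m + n))) : 'rV[R]_d := lsubmx (zxy z).
Definition zu (z : 'rV[R]_((d + s) + (m + n))) : 'rV[R]_m := lsubmx (rsubmx z).
Definition zv (z : 'rV[R]_((d + s) + (m + n))) : 'rV[R]_n := rsubmx (rsubmx z).

Implicit Type z : 'rV[R]_((d + s) + (m + n)).

Definition CP_feasible z : Prop :=
  [/\ ((f (zxy z))%:E - Vfun (zx z) <= 0)%E,
      (forall i, G (zxy z) 0 i <= 0) /\ H (zxy z) = 0,
      h (zxy z) = 0,
      gradyL (zxy z) (zu z) (zv z) = 0 &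
      Omega (- g (zxy z)) (zu z)].

Definition CP_local_solution z : Prop :=
  CP_feasible z /\
  \forall z' \near z, CP_feasible z' -> F (zxy z) <= F (zxy z').

(* The function f - V.  The truncation fine only alters V at the x where V x is
   infinite; there are none near a point at which the program is feasible and Y
   is either constant and compact or uniformly bounded with MFCQ on the lower
   level solutions, and subdifferentials are local. *)
Definition f_minus_V (xy : 'rV[R]_(d + s)) : R := f xy - fine (Vfun (lsubmx xy)).

(* The index None stands for 0, and Some i for the i-th component of G. *)
Definition theta (i : option 'I_p) z : R :=
  if i is Some i then G (zxy z) 0 i else f_minus_V (zxy z).

Definition Itheta z : {set option 'I_p} :=
  None |: [set Some i | i in IG (zxy z)].

Definition eqs z : 'rV[R]_(q + n + s) :=
  row_mx (row_mx (H (zxy z)) (h (zxy z))) (gradyL (zxy z) (zu z) (zv z)).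

Definition RCRCQ_family (A : {set option 'I_p}) (B D : {set 'I_m})
  (w : option 'I_p -> 'rV[R]_((d + s) + (m + n))) z :
  seq 'rV[R]_((d + s) + (m + n)) :=
  [seq w i | i in A]
  ++ [seq grad (fun z' => eqs z' 0 j) z | j : 'I_(q + n + s)]
  ++ [seq grad (fun z' => - g (zxy z') 0 i) z | i in B]
  ++ [seq grad (fun z' => zu z' 0 i) z | i in D].

Definition RCRCQ z : Prop :=
  let Is := Iset (zxy z) (zu z) in
  let Js := Jset (zxy z) (zu z) in
  let Ks := Kset (zxy z) (zu z) in
  forall (A : {set option 'I_p}) (B D : {set 'I_m}),
    A \subset Itheta z -> B \subset Js -> D \subset Js ->
  forall w : option 'I_p -> 'rV[R]_((d + s) + (m + n)),
    (forall i, i \in A -> limiting_subdiff (theta i) z (w i)) ->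
  forall (zk : nat -> 'rV[R]_((d + s) + (m + n)))
         (wk : nat -> option 'I_p -> 'rV[R]_((d + s) + (m + n))),
    zk @ \oo --> z -> (forall k, zk k <> z) ->
    (forall k i, i \in A -> limiting_subdiff (theta i) (zk k) (wk k i)) ->
    (forall i, i \in A -> wk k i @[k --> \oo] --> w i) ->
  \forall k \near \oo,
    family_rank (RCRCQ_family A (Is :|: B) (Ks :|: D) (wk k) (zk k))
    = family_rank (RCRCQ_family A (Is :|: B) (Ks :|: D) w z).

Definition M_stationary z : Prop :=
  let xy := zxy z in
  let Is := Iset xy (zu z) in
  let Js := Jset xy (zu z) in
  let Ks := Kset xy (zu z) in
  CP_feasible z /\
  exists (xi zeta : 'rV[R]_(d + s)) (lV : R) (lG : 'rV[R]_p) (lH : 'rV[R]_q)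
         (lh : 'rV[R]_n) (lL : 'rV[R]_s) (a b : 'rV[R]_m),
    [/\ limiting_subdiff F xy xi /\ limiting_subdiff f_minus_V xy zeta,
        0 <= lV /\ (forall i, i \in IG xy -> 0 <= lG 0 i),
        0 = xi + lV *: zeta
            + \sum_(i in IG xy) lG 0 i *: row i (jac G xy)
            + lH *m jac H xy + lh *m jac h xy
            + lL *m jac (fun xy' => gradyL xy' (zu z) (zv z)) xy
            + \sum_(i in Is :|: Js) a 0 i *: row i (jac g xy),
        rsubmx (jac g xy) *m lL^T - b^T = 0 /\ rsubmx (jac h xy) *m lL^T = 0 &
        [/\ forall i, i \in Is -> b 0 i = 0,
            forall i, i \in Ks -> a 0 i = 0 &
            forall i, i \in Js ->
              (0 < a 0 i /\ 0 < b 0 i) \/ a 0 i * b 0 i = 0]].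

(* Ig is the index set of the rows of nabla g, Iu that of the unit vectors;
   the columns are ordered as (x, y), v, u. *)
Definition Jprime (I2 : {set 'I_p}) (Ig Iu : {set 'I_m}) x y u v (alpha : R)
  (w : 'rV[R]_d) :=
  let xy := row_mx x y in
  col_mx (row_mx (jac (fun xy' => gradyL xy' u v) xy)
                 (row_mx (rsubmx (jac h xy))^T (rsubmx (jac g xy))^T))
  (col_mx (row_mx (jac h xy) (row_mx 0 0))
  (col_mx (row_mx (jac H xy) (row_mx 0 0))
  (col_mx (row_mx (subrows I2 (jac G xy)) (row_mx 0 0))
  (col_mx (row_mx (subrows Ig (jac g xy)) (row_mx 0 0))
  (col_mx (row_mx 0 (row_mx 0 (subrows Iu 1%:M)))
          (row_mx (alpha *: (grad f xy - row_mx w 0)) (row_mx 0 0))))))).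

Definition Jprime_constant_rank (W : 'rV[R]_d -> set 'rV[R]_d) x y u v
  : Prop :=
  let xy := row_mx x y in
  forall (I2 : {set 'I_p}) (I3 I4 : {set 'I_m}) (alpha : R),
    I2 \subset IG xy -> I3 \subset Jset xy u -> I4 \subset Jset xy u ->
    alpha = 0 \/ alpha = 1 ->
  let J := Jprime I2 (Iset xy u :|: I3) (Kset xy u :|: I4) in
  forall w : 'rV[R]_d, co (W x) w ->
  forall (xk : nat -> 'rV[R]_d) (yk : nat -> 'rV[R]_s) (uk : nat -> 'rV[R]_m)
         (vk : nat -> 'rV[R]_n) (wk : nat -> 'rV[R]_d),
    xk @ \oo --> x -> yk @ \oo --> y -> uk @ \oo --> u -> vk @ \oo --> v ->
    wk @ \oo --> w -> (forall k, co (W (xk k)) (wk k)) ->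
  \forall k \near \oo,
    \rank (J (xk k) (yk k) (uk k) (vk k) alpha (wk k))
    = \rank (J x y u v alpha w).

End CombinedProgram.

(* Main.v *)
Require Import Defs.
From mathcomp Require Import all_boot all_order all_algebra.
From mathcomp Require Import all_classical all_reals all_analysis.
From mathcomp Require Import ring lra.

Set Implicit Arguments.
Unset Strict Implicit.
Unset Printing Implicit Defensive.

Import Order.TTheory GRing.Theory Num.Theory.
Import numFieldNormedType.Exports.

Local Open Scope classical_set_scope.
Local Open Scope ring_scope.

(* RCRCQ only involves the limiting subgradients of f - V, which have the form
   nabla f - (w, 0) with w in co W(x): W is locally bounded with closed graph and
   contains the Frechet subgradients of V, so the limiting subgradients of - V lie
   in - co W by a separation argument based on an approximate mean value
   inequality.  The rank of J' is then the rank of the corresponding RCRCQ family,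
   up to the sign of the rows nabla g and a permutation of columns.

   For M-stationarity, minimise F(w) + |z - z*|^2 plus a quadratic penalty of the
   constraints, of w = z and of the distance to complementarity.  This gives
   multipliers at points tending to z*, with signs as in the M-conditions.  Along
   an ultrafilter, a Caratheodory reduction of the support and the constant rank
   property keep the multipliers bounded while preserving their signs, so they
   converge to multipliers at z*.

   The Frechet subgradients of V are computed at the lower level: directly if Y is
   constant, and under MFCQ by a penalty argument using a metric regularity
   estimate, which also gives the continuity of V. *)

(** * Ultrafilter limits and row vectors *)

(** The lower level controls the Frechet subgradients of V, whereas stationarity asks for limiting
    subgradients of f - V, hence of - V. A subgradient of - V need not be the opposite of one of V;
    the inclusion is obtained only after convexification, which explains co W in the rank condition.
    F and f - V are both nonsmooth and Frechet subgradients obey no exact sum rule: the two copies w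
    and z of the variable let each nonsmooth function meet smooth terms only. The multipliers
    produced by the penalty may be unbounded. The rows whose coefficients have free sign (equations,
    rows of g on [Is], rows of u on [Ks]) belong to every family whose rank is assumed constant, so
    the reduction works modulo these rows and preserves signs only on the others. M-stationarity is
    drawn from the rank condition on J' itself, not from RCRCQ. Ultrafilters replace repeated
    extraction of subsequences: along one of them bounded vectors converge, finite-valued data
    become constant and every property is decided. *)

(** If [A] were not in [F], the trace of [F] on the complement of [A] would be proper, and an
    ultrafilter above it would contain both [A] and its complement. *)
Lemma ultra_near (T : Type) (F : set_system T) {FF : Filter F} (A : set T) :
  (forall G, UltraFilter G -> F `<=` G -> G A) -> F A.
Proof.
move=> FA; apply: contrapT => nFA.
have WP : ProperFilter (within (~` A) F).
  refine (@Build_ProperFilter_ex _ _ _ (@within_filter _ (~` A) _ FF)) => P.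
  rewrite /within /= => WP.
  apply: contrapT => nex; apply: nFA; apply: filterS WP => t Pt.
  by apply: contrapT => nAt; apply: nex; exists t; exact: Pt.
have [G [GU FG]] := ultraFilterLemma WP.
have GA : G A by apply: FA => B FB; apply: FG; apply: filterS FB => t Bt _.
have GnA : G (~` A) by apply: FG; exact: withinT.
by have /filter_ex[t []] : G (A `&` ~` A) by exact: filterI.
Qed.

Lemma near_ex2 (T : Type) (F : set_system T) {FF : ProperFilter F}
    (P Q : T -> Prop) :
  (\forall t \near F, P t) -> (\forall t \near F, Q t) -> exists t, P t /\ Q t.
Proof. by move=> FP FQ; apply: (@filter_ex _ F); exact: filterI. Qed.

Lemma near_ex3 (T : Type) (F : set_system T) {FF : ProperFilter F}
    (P Q S : T -> Prop) :
  (\forall t \near F, P t) -> (\forall t \near F, Q t) ->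
  (\forall t \near F, S t) -> exists t, [/\ P t, Q t & S t].
Proof.
move=> FP FQ FS; apply: (@filter_ex _ F).
by apply: filterS3 FP FQ FS => t; split.
Qed.

Lemma ultra_not (T : Type) (G : set_system T) (A : set T) :
  UltraFilter G -> ~ G A -> G (~` A).
Proof. by move=> GU nGA; case: (in_ultra_setVsetC A GU). Qed.

Lemma ultra_fmap (T U : Type) (u : T -> U) (G : set_system T) :
  UltraFilter G -> UltraFilter (u @ G).
Proof.
move=> GU; split => [|H HH uGH]; first exact: fmap_proper_filter.
rewrite eqEsubset; split => // B HB.
have [//|GnB] := in_ultra_setVsetC (u @^-1` B) GU.
have HnB : H (~` B) by apply: uGH.
by have /filter_ex[t []] : H (B `&` ~` B) by exact: filterI.
Qed.

(** Plays the role of the pigeonhole extraction: if every value were eventually avoided, finitely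
    many such events would hold at once. It freezes the support of the multipliers later. *)
Lemma ultra_finite (T : Type) (I : finType) (G : set_system T) (c : T -> I) :
  UltraFilter G -> exists i, \forall t \near G, c t = i.
Proof.
move=> GU; apply: contrapT => nex.
have H : \forall t \near G, forall i, c t <> i.
  apply: filter_forall => i; apply: ultra_not => Gi; apply: nex; exists i.
  exact: Gi.
by have /filter_ex[t] := H; move/(_ (c t)).
Qed.

Section UltraLimits.
Variables (R : realType) (T : Type) (G : set_system T).
Hypothesis GU : UltraFilter G.

Lemma ultra_cvg_compact (X : topologicalType) (K : set X) (u : T -> X) :
  compact K -> (\forall t \near G, K (u t)) -> exists2 l, K l & u @ G --> l.
Proof.
rewrite compact_ultra => Kc uK.
have [l [Kl ul]] := Kc _ (ultra_fmap u GU) uK.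
by exists l.
Qed.

Lemma ultra_cvg_rV k (u : T -> 'rV[R]_k) (M : R) :
  (\forall t \near G, `|u t| <= M) -> exists l : 'rV[R]_k, u @ G --> l.
Proof.
move=> uM.
have Kc : compact [set v : 'rV[R]_k | `|v| <= M].
  apply: bounded_closed_compact.
    by exists M; split => [|N MN v /= vM]; [exact: num_real|apply: le_trans vM (ltW MN)].
  have -> : [set v : 'rV[R]_k | `|v| <= M] = (fun v => `|v|) @^-1` [set x | x <= M] by [].
  by apply: preimage_closed => // v _; exact: norm_continuous.
by have [l _ ul] := ultra_cvg_compact Kc uM; exists l.
Qed.

Lemma ultra_cvg_real (u : T -> R) (M : R) :
  (\forall t \near G, `|u t| <= M) -> exists l : R, u @ G --> l.
Proof.
move=> uM.
have [|l _ ul] := @ultra_cvg_compact _ _ u (@segment_compact R (- M) M); last by exists l.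
by apply: filterS uM => t; rewrite /= in_itv /= ler_norml.
Qed.

End UltraLimits.

Lemma cvg_subr (R : realType) k (c z : 'rV[R]_k) : (fun w => w - c) @ z --> z - c.
Proof.
apply: (@cvgB _ _ _ (nbhs z) (nbhs_filter z) (fun w => w) (fun=> c)); last exact: cvg_cst.
by move=> A.
Qed.

Lemma compact_ball_rV (R : realType) k (z : 'rV[R]_k) (r : R) :
  compact [set v : 'rV[R]_k | `|v - z| <= r].
Proof.
apply: bounded_closed_compact.
  exists (r + `|z|); split => [|N MN v /= vM]; first exact: num_real.
  apply: le_trans (ltW MN); rewrite -[v](subrK z).
  by apply: le_trans (ler_normD _ _) _; rewrite lerD2r.
have -> : [set v : 'rV[R]_k | `|v - z| <= r] =
  (fun v => `|v - z|) @^-1` [set x | x <= r] by [].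
apply: preimage_closed => // v _.
have cB := @cvg_subr _ _ z v.
exact: (cvg_norm cB).
Qed.

(** * Row vectors: sup norm, blocks and dot product *)

Section RowVectors.
Variable R : realType.
Implicit Types k l : nat.

Lemma norm_coord k (z : 'rV[R]_k) i : `|z 0 i| <= `|z|.
Proof.
rewrite [leRHS]/Num.norm /= mx_normrE; apply/bigmax_geP; right => /=.
by exists (0, i).
Qed.

Lemma norm_le_coord k (z : 'rV[R]_k) (e : R) :
  0 <= e -> (forall i, `|z 0 i| <= e) -> `|z| <= e.
Proof.
move=> e0 H; rewrite [leLHS]/Num.norm /= mx_normrE; apply/bigmax_leP; split => //=.
by move=> [a i] _; rewrite (ord1 a); exact: H.
Qed.

Lemma cvg_rVP k (T : Type) (G : set_system T) {FG : Filter G}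
    (u : T -> 'rV[R]_k) (z : 'rV[R]_k) :
  (u @ G --> z) <-> (forall i, u t 0 i @[t --> G] --> z 0 i).
Proof.
split => [uz i|uz].
  apply/cvgrPdist_le => e e0; move/cvgrPdist_le: uz => /(_ e e0); apply: filterS => t.
  by apply: le_trans; have := norm_coord (z - u t) i; rewrite !mxE.
apply/cvgrPdist_le => e e0.
have : \forall t \near G, forall i, `|z 0 i - u t 0 i| <= e.
  by apply: filter_forall => i; move: (uz i) => /cvgrPdist_le /(_ e e0).
by apply: filterS => t H; apply: norm_le_coord (ltW e0) _ => i; rewrite !mxE.
Qed.

Lemma cvg_row_mx k l (T : Type) (G : set_system T) {FG : Filter G}
    (u : T -> 'rV[R]_k) (v : T -> 'rV[R]_l) (a : 'rV[R]_k) (b : 'rV[R]_l) :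
  u @ G --> a -> v @ G --> b -> row_mx (u t) (v t) @[t --> G] --> row_mx a b.
Proof.
move=> /cvg_rVP ua /cvg_rVP vb; apply/cvg_rVP => i.
rewrite !mxE; under eq_fun do rewrite mxE.
by case: (fintype.split i) => j; [exact: ua|exact: vb].
Qed.

Lemma cvg_lsubmx k l (T : Type) (G : set_system T) {FG : Filter G}
    (u : T -> 'rV[R]_(k + l)) (a : 'rV[R]_(k + l)) :
  u @ G --> a -> lsubmx (u t) @[t --> G] --> lsubmx a.
Proof.
move=> /cvg_rVP ua; apply/cvg_rVP => i.
by rewrite !mxE; under eq_fun do rewrite mxE; exact: ua.
Qed.

Lemma cvg_rsubmx k l (T : Type) (G : set_system T) {FG : Filter G}
    (u : T -> 'rV[R]_(k + l)) (a : 'rV[R]_(k + l)) :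
  u @ G --> a -> rsubmx (u t) @[t --> G] --> rsubmx a.
Proof.
move=> /cvg_rVP ua; apply/cvg_rVP => i.
by rewrite !mxE; under eq_fun do rewrite mxE; exact: ua.
Qed.

Lemma norm_row_mx k l (a : 'rV[R]_k) (b : 'rV[R]_l) (e : R) :
  (`|row_mx a b| <= e) = (`|a| <= e) && (`|b| <= e).
Proof.
apply/idP/andP => [H|[Ha Hb]].
  have e0 : 0 <= e by apply: le_trans H.
  split; apply: norm_le_coord => // i; apply: le_trans _ H.
    by have := norm_coord (row_mx a b) (lshift l i); rewrite row_mxEl.
  by have := norm_coord (row_mx a b) (rshift k i); rewrite row_mxEr.
have e0 : 0 <= e by apply: le_trans Ha.
apply: norm_le_coord => // i; rewrite mxE; case: (fintype.split i) => j.
  by apply: le_trans Ha; exact: norm_coord.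
by apply: le_trans Hb; exact: norm_coord.
Qed.

Lemma norm_row_mx0 k l (a : 'rV[R]_k) : `|row_mx a (0 : 'rV[R]_l)| = `|a|.
Proof.
apply/eqP; rewrite eq_le norm_row_mx lexx normr0 normr_ge0 /=.
by have := lexx `|row_mx a (0 : 'rV[R]_l)|; rewrite norm_row_mx => /andP[].
Qed.

Lemma norm_row_0mx k l (b : 'rV[R]_l) : `|row_mx (0 : 'rV[R]_k) b| = `|b|.
Proof.
apply/eqP; rewrite eq_le norm_row_mx lexx normr0 normr_ge0 /=.
by have := lexx `|row_mx (0 : 'rV[R]_k) b|; rewrite norm_row_mx => /andP[].
Qed.

Lemma norm_lsubmx k l (a : 'rV[R]_(k + l)) : `|lsubmx a| <= `|a|.
Proof.
by have := lexx `|a|; rewrite -{1}[a]hsubmxK norm_row_mx => /andP[].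
Qed.

Lemma norm_rsubmx k l (a : 'rV[R]_(k + l)) : `|rsubmx a| <= `|a|.
Proof.
by have := lexx `|a|; rewrite -{1}[a]hsubmxK norm_row_mx => /andP[].
Qed.

Lemma dotpE k (a b : 'rV[R]_k) : dotp a b = (a *m b^T) 0 0.
Proof. by rewrite mxE; apply: eq_bigr => i _; rewrite mxE. Qed.

Lemma dotpC k (a b : 'rV[R]_k) : dotp a b = dotp b a.
Proof. by apply: eq_bigr => i _; rewrite mulrC. Qed.

Lemma dotpDl k (a b c : 'rV[R]_k) : dotp (a + b) c = dotp a c + dotp b c.
Proof. by rewrite !dotpE mulmxDl mxE. Qed.

Lemma dotpNl k (a c : 'rV[R]_k) : dotp (- a) c = - dotp a c.
Proof. by rewrite !dotpE mulNmx mxE. Qed.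

Lemma dotpBl k (a b c : 'rV[R]_k) : dotp (a - b) c = dotp a c - dotp b c.
Proof. by rewrite dotpDl dotpNl. Qed.

Lemma dotpZl k (t : R) (a c : 'rV[R]_k) : dotp (t *: a) c = t * dotp a c.
Proof. by rewrite !dotpE -scalemxAl mxE. Qed.

Lemma dotpDr k (a b c : 'rV[R]_k) : dotp c (a + b) = dotp c a + dotp c b.
Proof. by rewrite !(dotpC c) dotpDl. Qed.

Lemma dotpBr k (a b c : 'rV[R]_k) : dotp c (a - b) = dotp c a - dotp c b.
Proof. by rewrite !(dotpC c) dotpBl. Qed.

Lemma dotpZr k (t : R) (a c : 'rV[R]_k) : dotp c (t *: a) = t * dotp c a.
Proof. by rewrite !(dotpC c) dotpZl. Qed.

Lemma dot0p k (a : 'rV[R]_k) : dotp 0 a = 0.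
Proof. by rewrite dotpE mul0mx mxE. Qed.

Lemma dotp0 k (a : 'rV[R]_k) : dotp a 0 = 0.
Proof. by rewrite dotpC dot0p. Qed.

Lemma dotp_row_mx k l (a c : 'rV[R]_k) (b e : 'rV[R]_l) :
  dotp (row_mx a b) (row_mx c e) = dotp a c + dotp b e.
Proof. by rewrite !dotpE tr_row_mx mul_row_col mxE. Qed.

Lemma dotp_lsubmx k l (a : 'rV[R]_k) (z : 'rV[R]_(k + l)) :
  dotp a (lsubmx z) = dotp (row_mx a 0) z.
Proof. by rewrite -{2}[z]hsubmxK dotp_row_mx dot0p addr0. Qed.

Lemma dotp_rsubmx k l (a : 'rV[R]_l) (z : 'rV[R]_(k + l)) :
  dotp a (rsubmx z) = dotp (row_mx 0 a) z.
Proof. by rewrite -{2}[z]hsubmxK dotp_row_mx dot0p add0r. Qed.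

Lemma dotp_delta k (a : 'rV[R]_k) i : dotp a (delta_mx 0 i) = a 0 i.
Proof.
rewrite /dotp (bigD1 i) //= big1 ?addr0 => [|j /negbTE ji]; rewrite !mxE eqxx /=.
  by rewrite eqxx mulr1.
by rewrite ji mulr0.
Qed.

(** The factor [k] is the price of pairing the sup norm with itself instead of with its dual
    norm. *)
Lemma dotp_norm k (a b : 'rV[R]_k) : `|dotp a b| <= k%:R * `|a| * `|b|.
Proof.
apply: le_trans (ler_norm_sum _ _ _) _.
apply: (@le_trans _ _ (\sum_(i < k) `|a| * `|b|)).
  by apply: ler_sum => i _; rewrite normrM ler_pM // norm_coord.
by rewrite sumr_const card_ord -mulrA mulr_natl.
Qed.

Lemma dotp_ge0 k (a : 'rV[R]_k) : 0 <= dotp a a.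
Proof. by apply: sumr_ge0 => i _; rewrite -expr2 sqr_ge0. Qed.

Lemma sqr_norm_dotp k (a : 'rV[R]_k) : `|a| ^+ 2 <= dotp a a.
Proof.
rewrite -[leRHS]sqr_sqrtr ?dotp_ge0 // ler_sqr ?nnegrE ?sqrtr_ge0 //.
apply: norm_le_coord => [|i]; first exact: sqrtr_ge0.
rewrite -sqrtr_sqr ler_wsqrtr // /dotp (bigD1 i) //= -expr2 lerDl.
by apply: sumr_ge0 => j _; rewrite -expr2 sqr_ge0.
Qed.

Lemma dotp_eq0 k (a : 'rV[R]_k) : (dotp a a == 0) = (a == 0).
Proof.
apply/eqP/eqP => [H|->]; last exact: dotp0.
apply/eqP; rewrite -normr_eq0 -sqrf_eq0 eq_le sqr_ge0 andbT -H.
exact: sqr_norm_dotp.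
Qed.

Lemma cvg_dotp k (T : Type) (G : set_system T) {FG : Filter G}
    (u v : T -> 'rV[R]_k) (a b : 'rV[R]_k) :
  u @ G --> a -> v @ G --> b ->
  dotp (u t) (v t) @[t --> G] --> dotp a b.
Proof.
move=> /cvg_rVP ua /cvg_rVP vb.
by apply: cvg_big => [|i _]; [exact: add_continuous|apply: cvgM; [exact: ua|exact: vb]].
Qed.

Lemma norm_delta k (i : 'I_k) : `|delta_mx 0 i : 'rV[R]_k| = 1.
Proof.
apply/eqP; rewrite eq_le; apply/andP; split.
  by apply: norm_le_coord => // j; rewrite !mxE /=; case: eqP; rewrite ?normr1 ?normr0.
by have := norm_coord (delta_mx 0 i : 'rV[R]_k) i; rewrite !mxE !eqxx normr1.
Qed.

Lemma mulmx_dotp k l (a : 'rV[R]_k) (M : 'M[R]_(k, l)) (b : 'rV[R]_l) :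
  dotp (a *m M) b = dotp a (b *m M^T).
Proof. by rewrite !dotpE trmx_mul trmxK mulmxA. Qed.

End RowVectors.

(** * Gradients and subdifferentials *)

Lemma near_normP (R : realType) (V : normedModType R) (z : V) (P : V -> Prop) :
  (\forall w \near z, P w) <->
  exists2 e : R, 0 < e & forall w, `|w - z| < e -> P w.
Proof.
rewrite (nbhs_normP z P); split => -[e e0 H]; exists e => // w; move: (H w).
  by rewrite /= -normrN opprB.
by move=> K /= zw; apply: K; rewrite -normrN opprB.
Qed.

Lemma near_dist (R : realType) (V : normedModType R) (z : V) (e : R) :
  0 < e -> \forall w \near z, `|w - z| < e.
Proof. by move=> e0; apply/near_normP; exists e. Qed.

Lemma near_ray (R : realType) k (z v : 'rV[R]_k) (P : 'rV[R]_k -> Prop) :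
  (\forall w \near z, P w) ->
  exists2 t0 : R, 0 < t0 & forall t, `|t| <= t0 -> P (z + t *: v).
Proof.
move=> /near_normP[e e0 H]; exists (e / (`|v| + 1)).
  by rewrite divr_gt0 // ltr_wpDl.
move=> t tt0; apply: H; rewrite addrC addKr normrZ.
have v1 : 0 < `|v| + 1 by rewrite ltr_wpDl.
move: tt0; rewrite ler_pdivlMr // => tt0.
have [->|t0] := eqVneq t 0; first by rewrite normr0 mul0r.
by apply: lt_le_trans tt0; rewrite ltr_pM2l ?normr_gt0 // ltrDl.
Qed.

(** Frechet differentiability with the gradient as a datum. It is the two-sided version of the
    inequality in [frechet_subdiff], so both calculi combine by linear arithmetic, and it applies
    directly to squared positive parts. *)
Definition hasgrad (R : realType) k (phi : 'rV[R]_k -> R) (z zeta : 'rV[R]_k) :=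
  forall e : R, 0 < e -> \forall w \near z,
    `|phi w - phi z - dotp zeta (w - z)| <= e * `|w - z|.

Section Gradients.
Variable R : realType.
Implicit Types k l : nat.

(** A one-sided bound is enough because each coordinate direction is tested with both signs, and
    coordinates determine the sup norm. *)
Lemma grad_le k (zeta z : 'rV[R]_k) (c : R) : 0 <= c ->
  (\forall w \near z, - (c * `|w - z|) <= dotp zeta (w - z)) -> `|zeta| <= c.
Proof.
move=> c0 H; apply: norm_le_coord => // i.
have [t0 t0_gt0 Ht] := near_ray (delta_mx 0 i) H.
have := Ht t0; have := Ht (- t0).
rewrite !(addrC z) !addrK !dotpZr !dotp_delta !normrZ !norm_delta !mulr1 normrN.
rewrite gtr0_norm // => /(_ (lexx _)) H1 /(_ (lexx _)) H2.
rewrite ler_norml; apply/andP; split.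
  by rewrite -(ler_pM2l t0_gt0); nra.
by rewrite -(ler_pM2l t0_gt0); nra.
Qed.

Lemma norm_le0_eps (V : normedModType R) (z : V) :
  (forall e : R, 0 < e -> `|z| <= e) -> z = 0.
Proof.
move=> H; apply/eqP; rewrite -normr_le0; apply/ler_addgt0Pr => e e0.
by rewrite add0r; exact: H.
Qed.

Lemma frechet_hasgrad k (phi : 'rV[R]_k -> R) z zeta :
  hasgrad phi z zeta -> frechet_subdiff phi z zeta.
Proof.
move=> H e e0; apply: filterS (H e e0) => w.
by rewrite ler_norml => /andP[].
Qed.

Lemma frechet_hasgrad_eq k (phi : 'rV[R]_k -> R) z zeta eta :
  frechet_subdiff phi z zeta -> hasgrad phi z eta -> zeta = eta.
Proof.
move=> Hz He; apply/esym/eqP; rewrite -subr_eq0; apply/eqP/norm_le0_eps => e e0.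
have e20 : 0 < e / 2 by rewrite divr_gt0.
apply: (@grad_le _ _ z); first exact: ltW.
apply: filterS2 (Hz _ e20) (He _ e20) => w H1 H2.
move: H1 H2; rewrite dotpBl ler_norml => H1 /andP[H2 H3].
by rewrite {1}[e]splitr mulrDl; lra.
Qed.

Lemma hasgrad_uniq k (phi : 'rV[R]_k -> R) z zeta eta :
  hasgrad phi z zeta -> hasgrad phi z eta -> zeta = eta.
Proof. by move=> /frechet_hasgrad; exact: frechet_hasgrad_eq. Qed.

Lemma diff_expansion (V W : normedModType R) (phi : V -> W) (z : V) (e : R) :
  differentiable phi z -> 0 < e ->
  \forall w \near z, `|phi w - phi z - 'd phi z (w - z)| <= e * `|w - z|.
Proof.
move=> /diff_locally /eqaddoP H e0; have := H e e0.
move=> /near_normP[r r0 Hr]; apply/near_normP; exists r => // w wz.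
have := Hr (w - z); rewrite subr0 => /(_ wz).
by rewrite !fctE /= subrK opprD addrA.
Qed.

Lemma hasgrad_diff k (phi : 'rV[R]_k -> R) z :
  differentiable phi z -> hasgrad phi z (grad phi z).
Proof.
move=> df e e0; apply: filterS (diff_expansion df e0) => w.
suff -> : dotp (grad phi z) (w - z) = 'd phi z (w - z) by [].
rewrite {2}[w - z]row_sum_delta linear_sum; apply: eq_bigr => i _.
by rewrite mxE deriveE // linearZ mulrC.
Qed.

Lemma hasgrad_jac k l (phi : 'rV[R]_k -> 'rV[R]_l) z i :
  differentiable phi z ->
  hasgrad (fun w => phi w 0 i) z (row i (jac phi z)).
Proof.
move=> df e e0; apply: filterS (diff_expansion df e0) => w.
apply: le_trans; rewrite (_ : dotp _ _ = ('d phi z (w - z)) 0 i).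
  by have := norm_coord (phi w - phi z - 'd phi z (w - z)) i; rewrite !mxE.
have -> : 'd phi z (w - z) = (w - z) *m jacobian phi z.
  by rewrite /jacobian mul_rV_lin1.
by rewrite dotpC mxE; apply: eq_bigr => j _; rewrite !mxE.
Qed.

Lemma hasgrad_ext k (phi psi : 'rV[R]_k -> R) z zeta :
  phi =1 psi -> hasgrad phi z zeta -> hasgrad psi z zeta.
Proof. by move=> /funext ->. Qed.

Lemma hasgradD k (phi psi : 'rV[R]_k -> R) z zeta eta :
  hasgrad phi z zeta -> hasgrad psi z eta ->
  hasgrad (fun w => phi w + psi w) z (zeta + eta).
Proof.
move=> H1 H2 e e0; have e20 : 0 < e / 2 by rewrite divr_gt0.
apply: filterS2 (H1 _ e20) (H2 _ e20) => w; rewrite !ler_norml dotpDl.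
move=> /andP[A B] /andP[C D]; apply/andP.
by split; rewrite [e]splitr mulrDl; lra.
Qed.

Lemma hasgrad_cst k (c : R) (z : 'rV[R]_k) : hasgrad (fun=> c) z 0.
Proof.
move=> e e0; apply/near_normP; exists 1 => // w _.
by rewrite subrr dot0p subr0 normr0 mulr_ge0 // ltW.
Qed.

Lemma hasgrad_dotp k (a c z : 'rV[R]_k) : hasgrad (fun w => dotp a (w - c)) z a.
Proof.
move=> e e0; apply/near_normP; exists 1 => // w _.
by rewrite -dotpBr opprB addrA subrK subrr normr0 mulr_ge0 // ltW.
Qed.

Lemma hasgrad_coord k (z : 'rV[R]_k) i : hasgrad (fun w => w 0 i) z (delta_mx 0 i).
Proof.
have := @hasgrad_dotp k (delta_mx 0 i) 0 z; apply: hasgrad_ext => w.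
by rewrite subr0 dotpC dotp_delta.
Qed.

Lemma hasgradZ k (c : R) (phi : 'rV[R]_k -> R) z zeta :
  hasgrad phi z zeta -> hasgrad (fun w => c * phi w) z (c *: zeta).
Proof.
move=> H e e0; have c1 : 0 < `|c| + 1 by rewrite ltr_wpDl.
have e20 : 0 < e / (`|c| + 1) by rewrite divr_gt0.
apply: filterS (H _ e20) => w Hw.
rewrite dotpZl -!mulrBr normrM.
apply: le_trans (ler_wpM2l (normr_ge0 c) Hw) _.
rewrite mulrA ler_wpM2r // mulrCA ger_pMr // ler_pdivrMr // mul1r lerDl.
exact: ler01.
Qed.

Lemma hasgradN k (phi : 'rV[R]_k -> R) z zeta :
  hasgrad phi z zeta -> hasgrad (fun w => - phi w) z (- zeta).
Proof.
move=> /(hasgradZ (-1)); rewrite scaleN1r; apply: hasgrad_ext => w.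
by rewrite mulN1r.
Qed.

Lemma hasgradB k (phi psi : 'rV[R]_k -> R) z zeta eta :
  hasgrad phi z zeta -> hasgrad psi z eta ->
  hasgrad (fun w => phi w - psi w) z (zeta - eta).
Proof. by move=> H1 /hasgradN H2; exact: hasgradD. Qed.

Lemma hasgrad_sum k (I : Type) (r : seq I) (P : pred I)
    (phi : I -> 'rV[R]_k -> R) z zeta :
  (forall i, P i -> hasgrad (phi i) z (zeta i)) ->
  hasgrad (fun w => \sum_(i <- r | P i) phi i w) z (\sum_(i <- r | P i) zeta i).
Proof.
move=> H; elim: r => [|i r IH].
  by rewrite big_nil; apply: hasgrad_ext (hasgrad_cst 0 z) => w; rewrite big_nil.
rewrite big_cons; case: ifPn => Pi.
  by apply: hasgrad_ext (hasgradD (H i Pi) IH) => w; rewrite big_cons Pi.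
by apply: hasgrad_ext IH => w; rewrite big_cons (negbTE Pi).
Qed.

Lemma hasgrad_calm k (phi : 'rV[R]_k -> R) z zeta : hasgrad phi z zeta ->
  exists2 C : R, 0 <= C & \forall w \near z, `|phi w - phi z| <= C * `|w - z|.
Proof.
move=> H; exists (k%:R * `|zeta| + 1); first by rewrite addr_ge0 // mulr_ge0.
apply: filterS (H 1 ltr01) => w Hw.
rewrite -[phi w - _](subrK (dotp zeta (w - z))) mulrDl addrC.
by apply: le_trans (ler_normD _ _) _; apply: lerD => //; exact: dotp_norm.
Qed.

Lemma calm_cvg k (phi : 'rV[R]_k -> R) z C :
  (\forall w \near z, `|phi w - phi z| <= C * `|w - z|) -> phi @ z --> phi z.
Proof.
move=> H; apply/(cvgrPdist_le (FF := nbhs_filter z)) => e e0.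
have C1 : 0 < `|C| + 1 by rewrite ltr_wpDl.
have := near_dist z (divr_gt0 e0 C1); apply: filterS2 H => w Hw wz.
rewrite distrC; apply: le_trans Hw _.
move: (ltW wz); rewrite ler_pdivlMr // => /(le_trans _); apply.
rewrite mulrC ler_wpM2l // (le_trans (ler_norm _)) // lerDl; exact: ler01.
Qed.

Lemma hasgrad_cvg k (phi : 'rV[R]_k -> R) z zeta :
  hasgrad phi z zeta -> phi @ z --> phi z.
Proof. by move=> /hasgrad_calm[C _]; exact: calm_cvg. Qed.

(** A function with a gradient is calm, so a remainder quadratic in [phi w - phi z] is quadratic in
    [w - z]. The outer functions needed, [t ^+ 2] and [Num.max t 0 ^+ 2], both have remainder at
    most the square of the increment. *)
Lemma hasgrad_comp_quad k (psi : R -> R) (c : R) (phi : 'rV[R]_k -> R) z zeta :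
  hasgrad phi z zeta ->
  (forall t, `|psi t - psi (phi z) - c * (t - phi z)| <= (t - phi z) ^+ 2) ->
  hasgrad (fun w => psi (phi w)) z (c *: zeta).
Proof.
move=> H Hpsi e e0; have e20 : 0 < e / 2 by rewrite divr_gt0.
have [C C0 HC] := hasgrad_calm H.
have d0 : 0 < e / 2 / (C ^+ 2 + 1) by rewrite divr_gt0 // ltr_wpDl // sqr_ge0.
have HZ := hasgradZ c H.
near=> w.
have K1 := Hpsi (phi w).
have K2 : `|c * phi w - c * phi z - dotp (c *: zeta) (w - z)| <= e / 2 * `|w - z|.
  by near: w; exact: HZ.
have K3 : (phi w - phi z) ^+ 2 <= e / 2 * `|w - z|.
  have A : `|phi w - phi z| <= C * `|w - z| by near: w.
  have B : `|w - z| < e / 2 / (C ^+ 2 + 1) by near: w; exact: (near_dist z d0).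
  rewrite -real_normK ?num_real //.
  apply: (@le_trans _ _ ((C * `|w - z|) ^+ 2)).
    by rewrite ler_sqr ?nnegrE // mulr_ge0.
  rewrite exprMn expr2 [`|w - z| ^+ 2]expr2 mulrA ler_wpM2r //.
  move: (ltW B); rewrite ler_pdivlMr ?ltr_wpDl ?sqr_ge0 // => /(le_trans _).
  by apply; rewrite mulrC -expr2 ler_wpM2l // lerDl ler01.
rewrite (_ : _ - _ = (psi (phi w) - psi (phi z) - c * (phi w - phi z)) +
   (c * phi w - c * phi z - dotp (c *: zeta) (w - z))); last by ring.
apply: le_trans (ler_normD _ _) _; rewrite [e]splitr mulrDl.
by apply: lerD => //; exact: le_trans K1 K3.
Unshelve. all: by end_near. Qed.

Lemma hasgrad_sqr k (phi : 'rV[R]_k -> R) z zeta : hasgrad phi z zeta ->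
  hasgrad (fun w => phi w ^+ 2) z ((2 * phi z) *: zeta).
Proof.
move=> H; apply: (hasgrad_comp_quad (psi := fun t => t ^+ 2)) H _ => t.
rewrite (_ : _ - _ = (t - phi z) ^+ 2); last by ring.
by rewrite ger0_norm // sqr_ge0.
Qed.

(** The lower bound is the convexity of the squared positive part, the upper bound the 2-Lipschitz
    continuity of its derivative. The upper bound alone also serves when the inner function is
    nonsmooth. *)
Lemma sqr_max0_bounds (a t : R) :
  0 <= Num.max t 0 ^+ 2 - Num.max a 0 ^+ 2 - 2 * Num.max a 0 * (t - a)
    <= (t - a) ^+ 2.
Proof.
have [t0|t0] := leP t 0; have [a0|a0] := leP a 0; apply/andP; split;
  have := sqr_ge0 t; have := sqr_ge0 a; have := sqr_ge0 (t - a);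
  have := @mulr_ge0 R; rewrite !expr2 => M.
- lra.
- lra.
- by have := M a (- t) (ltW a0); lra.
- by have := M a (- t) (ltW a0); lra.
- lra.
- by have := M t (- a) (ltW t0); lra.
- lra.
- lra.
Qed.

Lemma hasgrad_sqr_max0 k (phi : 'rV[R]_k -> R) z zeta : hasgrad phi z zeta ->
  hasgrad (fun w => Num.max (phi w) 0 ^+ 2) z ((2 * Num.max (phi z) 0) *: zeta).
Proof.
move=> H; apply: (hasgrad_comp_quad (psi := fun t => Num.max t 0 ^+ 2)) H _ => t.
by have /andP[A B] := sqr_max0_bounds (phi z) t; rewrite ger0_norm.
Qed.

Lemma hasgrad_dist2 k (c z : 'rV[R]_k) :
  hasgrad (fun w => dotp (w - c) (w - c)) z (2 *: (z - c)).
Proof.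
have -> : 2 *: (z - c) = \sum_i (2 * (z - c) 0 i) *: delta_mx 0 i.
  rewrite {1}[z - c]row_sum_delta scaler_sumr.
  by apply: eq_bigr => i _; rewrite scalerA.
have H : forall i, hasgrad (fun w => (w - c) 0 i ^+ 2) z
    ((2 * (z - c) 0 i) *: delta_mx 0 i).
  move=> i; apply: hasgrad_sqr.
  have := hasgradB (hasgrad_coord z i) (hasgrad_cst (c 0 i) z); rewrite subr0.
  by apply: hasgrad_ext => w; rewrite !mxE.
by apply: hasgrad_ext (hasgrad_sum _ (fun i _ => H i)) => w;
  apply: eq_bigr => i _; rewrite expr2.
Qed.

Lemma hasgrad_lsubmx k l (phi : 'rV[R]_k -> R) (z : 'rV[R]_(k + l)) zeta :
  hasgrad phi (lsubmx z) zeta ->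
  hasgrad (fun w => phi (lsubmx w)) z (row_mx zeta 0).
Proof.
move=> H e e0; have [r r0 Hr] := (near_normP _ _).1 (H e e0).
apply/near_normP; exists r => // w wz; rewrite -dotp_lsubmx linearB /=.
have le : `|lsubmx w - lsubmx z| <= `|w - z| by rewrite -linearB norm_lsubmx.
by apply: le_trans (Hr _ (le_lt_trans le wz)) _; rewrite ler_wpM2l // ltW.
Qed.

Lemma hasgrad_rsubmx k l (phi : 'rV[R]_l -> R) (z : 'rV[R]_(k + l)) zeta :
  hasgrad phi (rsubmx z) zeta ->
  hasgrad (fun w => phi (rsubmx w)) z (row_mx 0 zeta).
Proof.
move=> H e e0; have [r r0 Hr] := (near_normP _ _).1 (H e e0).
apply/near_normP; exists r => // w wz; rewrite -dotp_rsubmx linearB /=.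
have le : `|rsubmx w - rsubmx z| <= `|w - z| by rewrite -linearB norm_rsubmx.
by apply: le_trans (Hr _ (le_lt_trans le wz)) _; rewrite ler_wpM2l // ltW.
Qed.

(** Ties the calculus of [hasgrad] to the directional derivatives in [grad], with which the families
    of RCRCQ are written. *)
Lemma hasgrad_grad k (phi : 'rV[R]_k -> R) z zeta :
  hasgrad phi z zeta -> grad phi z = zeta.
Proof.
move=> H; apply/rowP => i; rewrite mxE /derive; apply: cvg_lim => //.
apply/cvgrPdist_le => e e0.
have [t0 t00 Ht] := near_ray (delta_mx 0 i) (H e e0).
rewrite /dnbhs near_withinE; near=> t => tn0.
have := Ht t; rewrite (addrC z) addrK dotpZr dotp_delta normrZ norm_delta mulr1.
have tt : `|t| <= t0.
  by rewrite ltW //; have := near_dist (0 : R) t00; near: t; apply: filterS => t; rewrite subr0.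
move=> /(_ tt) K; have t_gt0 : 0 < `|t| by rewrite normr_gt0.
rewrite distrC -(ler_pM2l t_gt0) -normrM mulrBr mulrA divff // mul1r [leRHS]mulrC.
exact: K.
Unshelve. all: by end_near. Qed.

End Gradients.

(** * Frechet and limiting subdifferentials *)

Section Subdifferentials.
Variable R : realType.
Implicit Types k l : nat.

Lemma frechet_ext k (phi psi : 'rV[R]_k -> R) z zeta :
  phi =1 psi -> frechet_subdiff phi z zeta -> frechet_subdiff psi z zeta.
Proof. by move=> /funext ->. Qed.

Lemma frechetD k (phi psi : 'rV[R]_k -> R) z zeta eta :
  frechet_subdiff phi z zeta -> hasgrad psi z eta ->
  frechet_subdiff (fun w => phi w + psi w) z (zeta + eta).
Proof.
move=> H1 H2 e e0; have e20 : 0 < e / 2 by rewrite divr_gt0.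
apply: filterS2 (H1 _ e20) (H2 _ e20) => w; rewrite !ler_norml dotpDl.
by move=> A /andP[C D]; rewrite [e]splitr mulrDl; lra.
Qed.

Lemma frechet_lsubmx k l (phi : 'rV[R]_k -> R) (z eta : 'rV[R]_(k + l)) :
  frechet_subdiff (fun w => phi (lsubmx w)) z eta ->
  eta = row_mx (lsubmx eta) 0 /\ frechet_subdiff phi (lsubmx z) (lsubmx eta).
Proof.
move=> H; split; last first.
  move=> e e0; have [r r0 Hr] := (near_normP _ _).1 (H e e0).
  apply/near_normP; exists r => // w wz.
  have E : row_mx w (rsubmx z) - z = row_mx (w - lsubmx z) 0.
    by rewrite -{2}[z]hsubmxK opp_row_mx add_row_mx subrr.
  have := Hr (row_mx w (rsubmx z)); rewrite E row_mxKl.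
  have -> : dotp eta (row_mx (w - lsubmx z) 0) = dotp (lsubmx eta) (w - lsubmx z).
    by rewrite -{1}[eta]hsubmxK dotp_row_mx dotp0 addr0.
  by rewrite norm_row_mx0; apply.
(* Along the second block the function is constant, so the subgradient inequality bounds that block
   of [eta] by every positive [e]. *)
rewrite -{1}[eta]hsubmxK; congr row_mx; apply: norm_le0_eps => e e0.
rewrite -normrN; apply: (@grad_le _ _ _ (rsubmx z)); first exact: ltW.
have [r r0 Hr] := (near_normP _ _).1 (H e e0).
apply/near_normP; exists r => // w wz.
have E : row_mx (lsubmx z) w - z = row_mx 0 (w - rsubmx z).
  by rewrite -{2}[z]hsubmxK opp_row_mx add_row_mx subrr.
have := Hr (row_mx (lsubmx z) w); rewrite E row_mxKl subrr -{1}[eta]hsubmxK.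
rewrite dotp_row_mx dotp0 !add0r.
by rewrite norm_row_0mx dotpNl => /(_ wz).
Qed.

Lemma frechet_bound k (phi : 'rV[R]_k -> R) z zeta (C : R) : 0 <= C ->
  (\forall w \near z, `|phi w - phi z| <= C * `|w - z|) ->
  frechet_subdiff phi z zeta -> `|zeta| <= C + 1.
Proof.
move=> C0 HC H; rewrite -normrN; apply: (@grad_le _ _ _ z).
  by rewrite addr_ge0.
apply: filterS2 HC (H 1 ltr01) => w; rewrite ler_norml => /andP[A B].
by rewrite dotpNl lerN2 mulrDl; lra.
Qed.

Lemma lim_near_cst (V : normedModType R) (T : Type) (G : set_system T)
    {GP : ProperFilter G} (u : T -> V) (l a : V) :
  u @ G --> l -> (\forall t \near G, u t = a) -> l = a.
Proof.
move=> ul ua; have ca : u @ G --> a.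
  apply: (@cvg_trans _ ((fun=> a) @ G)); last exact: cvg_cst.
  by apply: near_eq_cvg; apply: filterS ua => t ->.
exact: (@cvg_unique _ _ (u @ G)).
Qed.

Lemma lim_near_cst_real (T : Type) (G : set_system T)
    {GP : ProperFilter G} (u : T -> R) (l a : R) :
  u @ G --> l -> (\forall t \near G, u t = a) -> l = a.
Proof. exact: (@lim_near_cst R^o). Qed.

Lemma harmonic_cvg0 : (fun k : nat => k.+1%:R^-1 : R) @ \oo --> 0.
Proof. exact: cvg_harmonic. Qed.

Lemma cvg_squeeze_harmonic (V : normedModType R) (u : nat -> V) (l : V) :
  (forall k, `|u k - l| <= k.+1%:R^-1) -> u @ \oo --> l.
Proof.
move=> H; apply/cvgrPdist_le => e e0.
have /cvgrPdist_le/(_ e e0) := harmonic_cvg0; apply: filterS => j.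
rewrite sub0r normrN distrC => K; apply: le_trans (H j) _.
exact: le_trans (ler_norm _) K.
Qed.

(** This form without sequences is the one that passes to arbitrary filters and makes diagonal
    arguments a matter of halving [e]. *)
Lemma limiting_subdiffP k (phi : 'rV[R]_k -> R) z xi :
  limiting_subdiff phi z xi <->
  forall e : R, 0 < e -> exists w eta,
    [/\ `|w - z| <= e, `|eta - xi| <= e & frechet_subdiff phi w eta].
Proof.
split=> [[zk [xik [zz xx H]]] e e0|H].
  have [j [A B]] : exists j, `|z - zk j| <= e /\ `|xi - xik j| <= e.
    apply: (@filter_ex _ \oo).
    by apply: filterI; [move/cvgrPdist_le: zz; apply|move/cvgrPdist_le: xx; apply].
  by exists (zk j), (xik j); split; rewrite // distrC.
have H' (j : nat) : exists we : 'rV[R]_k * 'rV[R]_k,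
    [/\ `|we.1 - z| <= j.+1%:R^-1, `|we.2 - xi| <= j.+1%:R^-1 &
      frechet_subdiff phi we.1 we.2].
  by have [|w [eta ?]] := H j.+1%:R^-1; [rewrite invr_gt0|exists (w, eta)].
have [we Hwe] := choice H'; exists (fun j => (we j).1), (fun j => (we j).2); split.
- by apply: cvg_squeeze_harmonic => j; case: (Hwe j).
- by apply: cvg_squeeze_harmonic => j; case: (Hwe j).
- by move=> j; case: (Hwe j).
Qed.

Lemma frechet_limiting k (phi : 'rV[R]_k -> R) z xi :
  frechet_subdiff phi z xi -> limiting_subdiff phi z xi.
Proof.
move=> H; apply/limiting_subdiffP => e e0; exists z, xi.
by rewrite !subrr normr0 ltW.
Qed.

Lemma limiting_closed k (phi : 'rV[R]_k -> R) (T : Type) (G : set_system T)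
    (u v : T -> 'rV[R]_k) (z xi : 'rV[R]_k) : ProperFilter G ->
  u @ G --> z -> v @ G --> xi ->
  (\forall t \near G, limiting_subdiff phi (u t) (v t)) ->
  limiting_subdiff phi z xi.
Proof.
move=> GP uz vx H; apply/limiting_subdiffP => e e0.
have e20 : 0 < e / 2 by rewrite divr_gt0.
move/cvgrPdist_le: uz => /(_ _ e20) uz; move/cvgrPdist_le: vx => /(_ _ e20) vx.
have [t [A B /limiting_subdiffP/(_ _ e20)[w [eta [D E Fr]]]]] := near_ex3 uz vx H.
exists w, eta; split => //.
  rewrite -(subrKA (u t)) [e]splitr; apply: le_trans (ler_normD _ _) _.
  by apply: lerD => //; rewrite distrC.
rewrite -(subrKA (v t)) [e]splitr; apply: le_trans (ler_normD _ _) _.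
by apply: lerD => //; rewrite distrC.
Qed.

Lemma limiting_hasgrad k (phi : 'rV[R]_k -> R) (D : 'rV[R]_k -> 'rV[R]_k) z xi :
  (forall w, hasgrad phi w (D w)) -> D @ z --> D z ->
  limiting_subdiff phi z xi <-> xi = D z.
Proof.
move=> H cD; split => [[zk [xik [zz xx F]]]|->]; last first.
  exact/frechet_limiting/frechet_hasgrad.
have E : xik = D \o zk by apply/funext => j; exact: frechet_hasgrad_eq (F j) (H _).
have xD : xik @ \oo --> D z by rewrite E; exact: cvg_comp zz cD.
exact: cvg_unique xx xD.
Qed.

Lemma limitingD k (phi psi : 'rV[R]_k -> R) (D : 'rV[R]_k -> 'rV[R]_k) z xi :
  (forall w, hasgrad psi w (D w)) -> D @ z --> D z ->
  limiting_subdiff phi z xi ->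
  limiting_subdiff (fun w => phi w + psi w) z (xi + D z).
Proof.
move=> H cD [zk [xik [zz xx F]]].
exists zk, (fun j => xik j + D (zk j)); split => //.
  by apply: cvgD => //; exact: cvg_comp zz cD.
by move=> j; exact: frechetD.
Qed.

Lemma limiting_lsubmx k l (phi : 'rV[R]_k -> R) (z eta : 'rV[R]_(k + l)) :
  limiting_subdiff (fun w => phi (lsubmx w)) z eta ->
  eta = row_mx (lsubmx eta) 0 /\ limiting_subdiff phi (lsubmx z) (lsubmx eta).
Proof.
move=> [zk [xik [zz xx F]]]; split; last first.
  exists (fun j => lsubmx (zk j)), (fun j => lsubmx (xik j)); split.
  - exact: cvg_lsubmx.
  - exact: cvg_lsubmx.
  - by move=> j; have [] := frechet_lsubmx (F j).
rewrite -{1}[eta]hsubmxK; congr row_mx.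
have H : rsubmx (xik j) @[j --> \oo] --> rsubmx eta by exact: cvg_rsubmx.
move: H; have -> : (fun j => rsubmx (xik j)) = (fun=> 0).
  by apply/funext => j; have [-> _] := frechet_lsubmx (F j); rewrite row_mxKr.
have C0 : (fun _ : nat => 0 : 'rV[R]_l) @ \oo --> (0 : 'rV[R]_l) by exact: cvg_cst.
by move=> H; exact: cvg_unique H C0.
Qed.

Lemma frechet_lsubmx_lift k l (phi : 'rV[R]_k -> R) (z : 'rV[R]_(k + l)) xi :
  frechet_subdiff phi (lsubmx z) xi ->
  frechet_subdiff (fun w => phi (lsubmx w)) z (row_mx xi 0).
Proof.
move=> H e e0; have [r r0 Hr] := (near_normP _ _).1 (H e e0).
apply/near_normP; exists r => // w wz; rewrite -dotp_lsubmx linearB /=.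
have le : `|lsubmx w - lsubmx z| <= `|w - z| by rewrite -linearB norm_lsubmx.
apply: le_trans (Hr _ (le_lt_trans le wz)).
by rewrite lerN2 ler_wpM2l // ltW.
Qed.

Lemma limiting_lsubmx_lift k l (phi : 'rV[R]_k -> R) (z : 'rV[R]_(k + l)) xi :
  limiting_subdiff phi (lsubmx z) xi ->
  limiting_subdiff (fun w => phi (lsubmx w)) z (row_mx xi 0).
Proof.
move=> /limiting_subdiffP H; apply/limiting_subdiffP => e e0.
have [w [eta [A B C]]] := H e e0.
exists (row_mx w (rsubmx z)), (row_mx eta 0); split.
- rewrite -{2}[z]hsubmxK opp_row_mx add_row_mx subrr norm_row_mx A normr0.
  exact: ltW.
- by rewrite opp_row_mx add_row_mx subrr norm_row_mx B normr0 ltW.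
- by apply: frechet_lsubmx_lift; rewrite row_mxKl.
Qed.

End Subdifferentials.

(** * Limits of multipliers under constant rank *)

Section Families.
Variables (R : realType) (D : nat) (I : finType).
Implicit Types (rho : I -> 'rV[R]_D) (S E : {set I}) (c : I -> R).

Definition fam S rho : seq 'rV[R]_D := [seq rho i | i in S].

Lemma fam_size S rho : size (fam S rho) = #|S|.
Proof. by rewrite size_map -cardE. Qed.

Lemma fam_mem S rho i : i \in S -> rho i \in <<fam S rho>>%VS.
Proof. by move=> iS; apply: memv_span; apply: map_f; rewrite mem_enum. Qed.

Lemma fam_subvP S rho (U : {vspace 'rV[R]_D}) :
  (forall i, i \in S -> rho i \in U) -> (<<fam S rho>> <= U)%VS.
Proof.
move=> H; apply/span_subvP => v /mapP[i]; rewrite mem_enum => iS ->; exact: H.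
Qed.

Lemma fam_span_sum S rho c : \sum_(i in S) c i *: rho i \in <<fam S rho>>%VS.
Proof.
by apply: memv_suml => i iS; apply: memvZ; exact: fam_mem.
Qed.

Lemma fam_sum S rho v : v \in <<fam S rho>>%VS ->
  exists2 c, (forall i, i \notin S -> c i = 0) & v = \sum_i c i *: rho i.
Proof.
rewrite /fam /image_mem.
(* The induction runs over duplicate-free lists: the coefficient of the new head can be set freely
   because the one given by the induction hypothesis is zero there. *)
suff H : forall s : seq I, {subset s <= S} -> uniq s ->
    v \in <<[seq rho i | i <- s]>>%VS ->
    exists2 c, (forall i, i \notin s -> c i = 0) & v = \sum_i c i *: rho i.
  move=> /(H (enum S)) [] => [i||c C ->]; first by rewrite mem_enum.
    exact: enum_uniq.
  by exists c => // i iS; apply: C; rewrite mem_enum.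
move=> s; elim: s v => [|i s IH] v sS /=.
  rewrite span_nil memv0 => _ /eqP ->; exists (fun=> 0) => //.
  by rewrite big1 // => i _; rewrite scale0r.
move=> /andP[is_ us]; rewrite span_cons => /memv_addP[x /vlineP[k ->] [y ys ->]].
have [|c C ->] := IH y _ us ys.
  by move=> j js; apply: sS; rewrite inE js orbT.
exists (fun j => if j == i then k else c j) => [j|].
  by rewrite inE negb_or => /andP[/negbTE -> js]; exact: C.
rewrite [RHS](bigD1 i) //= eqxx; congr (_ + _).
rewrite (bigD1 i) //= C // scale0r add0r.
by apply: eq_bigr => j /negbTE ->.
Qed.

Lemma fam_freeP S rho :
  reflect (forall c, (forall i, i \notin S -> c i = 0) ->
     \sum_i c i *: rho i = 0 -> forall i, c i = 0) (free (fam S rho)).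
Proof.
have nthE (i : 'I_#|S|) : (fam S rho)`_i = rho (enum_val i).
  by rewrite (nth_map (enum_default i)) -?cardE.
have sumE c : (forall i, i \notin S -> c i = 0) ->
    \sum_i c i *: rho i = \sum_(i < #|S|) c (enum_val i) *: (fam S rho)`_i.
  move=> C; rewrite (bigID (mem S)) /= [X in _ + X]big1 ?addr0 => [|i iS].
    by rewrite big_enum_val; apply: eq_bigr => i _; rewrite nthE.
  by rewrite C // scale0r.
have P := @freeP R 'rV[R]_D _ (image_tuple rho (mem S)).
apply: (iffP P) => H.
  move=> c C; rewrite sumE // => /(H (fun i => c (enum_val i))) K i.
  have [iS|/C //] := boolP (i \in S).
  by have := K (enum_rank_in iS i); rewrite enum_rankK_in.
move=> k Hk i.
pose c j := if [pick x : 'I_#|S| | enum_val x == j] is Some x then k x else 0.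
have cS j : j \notin S -> c j = 0.
  by move=> jS; rewrite /c; case: pickP => // x /eqP xj; move: jS; rewrite -xj enum_valP.
have cE (j : 'I_#|S|) : c (enum_val j) = k j.
  rewrite /c; case: pickP => [x /eqP /enum_val_inj -> //|/(_ j)].
  by rewrite eqxx.
rewrite -cE; apply: H => //; rewrite sumE // -[RHS]Hk.
by apply: eq_bigr => j _; rewrite cE.
Qed.

Lemma fam_freeE S rho : free (fam S rho) = (\dim <<fam S rho>> == #|S|).
Proof. by rewrite /free fam_size. Qed.

Lemma fam_spanS S E rho : S \subset E -> (<<fam S rho>> <= <<fam E rho>>)%VS.
Proof.
by move=> SE; apply: fam_subvP => i iS; apply: fam_mem; exact: (fintype.subsetP SE).
Qed.

Lemma fam_spanU S E rho : <<fam (S :|: E) rho>>%VS = (<<fam S rho>> + <<fam E rho>>)%VS.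
Proof.
apply/eqP; rewrite eqEsubv subv_add; apply/andP; split; last first.
  by apply/andP; split; apply: fam_spanS; [exact: finset.subsetUl|exact: finset.subsetUr].
apply: fam_subvP => i; rewrite !inE => /orP[] iS.
  by apply: (subvP (addvSl _ _)); exact: fam_mem.
by apply: (subvP (addvSr _ _)); exact: fam_mem.
Qed.

Lemma fam_basis E rho : exists2 S : {set I}, S \subset E &
  free (fam S rho) /\ <<fam S rho>>%VS = <<fam E rho>>%VS.
Proof.
have [|S] := @ex_maxset I (fun S => (S \subset E) && free (fam S rho)).
  exists finset.set0; rewrite finset.sub0set /=; apply/fam_freeP => c C _ i.
  by apply: C; rewrite inE.
move=> /maxsetP[/andP[SE Sf] Smax]; exists S => //; split => //.
apply/eqP; rewrite eqEsubv fam_spanS //=.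
apply: fam_subvP => i iE.
have [iS|iS] := boolP (i \in S); first exact: fam_mem.
apply: contrapT => nv.
have : i |: S = S.
  apply: Smax; last exact: finset.subsetUr.
  rewrite finset.subUset finset.sub1set iE SE /=; apply/fam_freeP => c C sc.
  have ci : c i = 0.
    apply: contrapT => /eqP ci; apply: nv.
    have -> : rho i = \sum_(j in S) (- (c j / c i)) *: rho j.
      have : rho i + \sum_(j in S) (c j / c i) *: rho j = 0.
        transitivity ((c i)^-1 *: \sum_j c j *: rho j); last by rewrite sc scaler0.
        rewrite [in RHS](bigD1 i) //= scalerDr scalerA mulVf // scale1r; congr (_ + _).
        rewrite [in RHS](bigID (mem S)) /= [X in _ *: (_ + X)]big1 ?addr0 => [|j /andP[ji jS]].
          rewrite scaler_sumr; apply: eq_big => [j|j _]; last by rewrite scalerA mulrC.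
          by case: eqP => [->|//]; rewrite (negbTE iS).
        by rewrite C ?scale0r // !inE negb_or ji.
      move/eqP; rewrite addr_eq0 => /eqP ->.
      by rewrite -sumrN; apply: eq_bigr => j _; rewrite scaleNr.
    exact: fam_span_sum.
  move/fam_freeP: Sf; apply => // j jS.
  by have [->//|ji] := eqVneq j i; apply: C; rewrite !inE negb_or ji.
by move/setP/(_ i); rewrite !inE eqxx (negbTE iS).
Qed.

(* Caratheodory's reduction modulo the unrestricted family E. *)
Lemma support_reduction rho E c : exists c' : I -> R,
  [/\ \sum_i c' i *: rho i = \sum_i c i *: rho i,
      forall i, i \notin E -> exists2 t, 0 <= t & c' i = t * c i &
      forall g, (forall i, i \notin E -> c' i = 0 -> g i = 0) ->
        \sum_i g i *: rho i = 0 -> forall i, i \notin E -> g i = 0].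
Proof.
have [k] := ubnP #|[set i | (i \notin E) && (c i != 0)]%SET|.
elim: k c => // k IH c; rewrite ltnS => ck.
have [indep|] := pselect (forall g, (forall i, i \notin E -> c i = 0 -> g i = 0) ->
  \sum_i g i *: rho i = 0 -> forall i, i \notin E -> g i = 0).
  by exists c; split => // i _; exists 1; rewrite ?mul1r.
move=> /existsNP[g] /not_implyP[gE] /not_implyP[g0] /existsNP[i1].
move=> /not_implyP[i1E /eqP gi1].
have ci1 : c i1 != 0 by apply: contra_neq gi1; exact: gE.
pose P i := (i \notin E) && (c i != 0).
have Pi1 : P i1 by rewrite /P i1E.
(* Subtracting the multiple of the relation [g] that cancels [c i0] changes no sign, because the
   index maximising [|g i / c i|] is the first coefficient to reach zero. *)
case: (@arg_maxP _ _ I i1 P (fun i => `|g i / c i|) Pi1) => i0 /andP[i0E ci0] imax0.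
have imax i : P i -> `|g i / c i| <= `|g i0 / c i0| := imax0 i.
have gi0 : g i0 != 0.
  apply: contra_neq gi1 => gi0; have := imax i1 Pi1.
  rewrite gi0 mul0r normr0 normr_le0 mulf_eq0 invr_eq0 (negbTE ci1) orbF.
  by move/eqP.
pose c1 i := c i - c i0 / g i0 * g i.
have c1t i : i \notin E -> exists2 t, 0 <= t & c1 i = t * c i.
  move=> iE; have [ci|ci] := eqVneq (c i) 0.
    by exists 0 => //; rewrite /c1 (gE i iE ci) ci !mulr0 subrr.
  exists (1 - c i0 / g i0 * (g i / c i)); last first.
    by rewrite /c1; field; rewrite ci gi0.
  rewrite subr_ge0; apply: le_trans (ler_norm _) _.
  have Pi : P i by rewrite /P iE.
  have /= := imax i Pi; rewrite -(ler_pM2l (x := `|c i0 / g i0|)).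
    rewrite -!normrM => /le_trans; apply.
    by rewrite mulrA mulfVK // divff // normr1.
  by rewrite normr_gt0 mulf_neq0 // invr_eq0.
have [|c' [s' t' ind']] := IH c1.
  apply: leq_trans ck; apply: proper_card; apply/fintype.properP; split.
    apply/fintype.subsetP => i; rewrite !inE => /andP[iE]; rewrite iE /=.
    by apply: contra_neq => ci; have [t _ ->] := c1t i iE; rewrite ci mulr0.
  by exists i0; rewrite !inE i0E //= /c1 mulfVK // subrr eqxx.
exists c'; split => //.
  rewrite s' /c1; under eq_bigr do rewrite scalerBl -scalerA.
  by rewrite sumrB -scaler_sumr g0 scaler0 subr0.
move=> i iE; have [t t0 ->] := t' i iE; have [t1 t10 ->] := c1t i iE.
by exists (t * t1); rewrite ?mulr_ge0 // mulrA.
Qed.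

End Families.

Section LimitOfMultipliers.
Variables (R : realType) (D : nat) (I : finType) (T : Type) (G : set_system T).
Hypothesis GU : UltraFilter G.
Variables (rho : T -> I -> 'rV[R]_D) (rho0 : I -> 'rV[R]_D).
Hypothesis rho_cvg : forall i, rho t i @[t --> G] --> rho0 i.

Lemma cvg_fam_sum (c : T -> I -> R) (c0 : I -> R) :
  (forall i, c t i @[t --> G] --> c0 i) ->
  \sum_i c t i *: rho t i @[t --> G] --> \sum_i c0 i *: rho0 i.
Proof.
move=> H; apply: cvg_big => [|i _]; first exact: add_continuous.
exact: cvgZ.
Qed.

(** Coefficients of l1 norm 1 have a limit along [G]. A vanishing limit combination would make it a
    relation between the free rows of [rho0], hence zero, although its l1 norm is still 1.
    Persistence of freeness and boundedness of coefficients both follow by normalisation. *)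
Lemma free_fam_normalized (S : {set I}) (c : T -> I -> R) : free (fam S rho0) ->
  (\forall t \near G, forall i, i \notin S -> c t i = 0) ->
  (\forall t \near G, \sum_i `|c t i| = 1) ->
  ~ (\sum_i c t i *: rho t i @[t --> G] --> (0 : 'rV[R]_D)).
Proof.
move=> /fam_freeP fS cS c1 sc.
have H i : exists l : R, c t i @[t --> G] --> l.
  apply: (@ultra_cvg_real _ _ _ _ _ 1); apply: filterS c1 => t <-.
  by rewrite (bigD1 i) //= lerDl sumr_ge0.
have [c0 Hc0] := choice H.
have s0 : \sum_i c0 i *: rho0 i = 0.
  exact: cvg_unique (cvg_fam_sum Hc0) sc.
have cS0 i : i \notin S -> c0 i = 0.
  by move=> iS; apply: (lim_near_cst_real (Hc0 i)); apply: filterS cS => t ->.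
have : \sum_i `|c t i| @[t --> G] --> \sum_i `|c0 i|.
  apply: cvg_big => [|i _]; first exact: add_continuous.
  by apply: cvg_norm; exact: Hc0.
rewrite big1 => [K|i _]; last by rewrite fS // normr0.
have : (1 : R) = 0.
  by symmetry; exact: lim_near_cst_real K c1.
by move/eqP; rewrite oner_eq0.
Qed.

Lemma near_free_fam (S : {set I}) : free (fam S rho0) ->
  \forall t \near G, free (fam S (rho t)).
Proof.
move=> fS; apply: contrapT => /(ultra_not GU) nf.
have H t : exists c : I -> R, ~ free (fam S (rho t)) ->
    [/\ forall i, i \notin S -> c i = 0, \sum_i `|c i| = 1 &
        \sum_i c i *: rho t i = 0].
  have [f|f] := pselect (free (fam S (rho t))); first by exists (fun=> 0).
  have : ~ (forall c, (forall i, i \notin S -> c i = 0) ->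
     \sum_i c i *: rho t i = 0 -> forall i, c i = 0) by move/fam_freeP.
  move=> /existsNP[c] /not_implyP[cS] /not_implyP[c0] /existsNP[i /eqP ci].
  pose s := \sum_i `|c i|.
  have s0 : s != 0.
    by rewrite gt_eqF // /s (bigD1 i) //= ltr_wpDr ?sumr_ge0 ?normr_gt0.
  exists (fun i => s^-1 * c i); split.
  - by move=> j jS; rewrite cS ?mulr0.
  - under eq_bigr do rewrite normrM.
    by rewrite -mulr_sumr ger0_norm ?invr_ge0 ?sumr_ge0 // mulVf.
  - under eq_bigr do rewrite -scalerA.
    by rewrite -scaler_sumr c0 scaler0.
have [c Hc] := choice H.
apply: (@free_fam_normalized S c fS).
- by apply: filterS nf => t /Hc[].
- by apply: filterS nf => t /Hc[].
- apply: (@cvg_trans _ ((fun=> 0 : 'rV[R]_D) @ G)); last exact: cvg_cst.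
  by apply: near_eq_cvg; apply: filterS nf => t /Hc[_ _ ->].
Qed.

Lemma free_fam_bounded (S : {set I}) (c : T -> I -> R) (r : 'rV[R]_D) : free (fam S rho0) ->
  (\forall t \near G, forall i, i \notin S -> c t i = 0) ->
  \sum_i c t i *: rho t i @[t --> G] --> r ->
  exists M, \forall t \near G, \sum_i `|c t i| <= M.
Proof.
move=> fS cS sc; apply: contrapT => /forallNP unb.
pose s t := \sum_i `|c t i|.
have big M : \forall t \near G, M < s t.
  by apply: filterS (ultra_not GU (unb M)) => t /negP; rewrite -ltNge.
apply: (@free_fam_normalized S (fun t i => (s t)^-1 * c t i) fS).
- by apply: filterS cS => t cS i iS; rewrite cS ?mulr0.
- apply: filterS (big 0) => t s0.
  under eq_bigr do rewrite normrM.
  by rewrite -mulr_sumr ger0_norm ?invr_ge0 ?ltW // mulVf // gt_eqF.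
- have E t : \sum_i ((s t)^-1 * c t i) *: rho t i = (s t)^-1 *: \sum_i c t i *: rho t i.
    by rewrite scaler_sumr; apply: eq_bigr => i _; rewrite scalerA.
  under eq_fun do rewrite E.
  suff : (s t)^-1 *: (\sum_i c t i *: rho t i) @[t --> G] --> 0 *: r by rewrite scale0r.
  apply: cvgZ => //; apply/cvgrPdist_le => e e0.
  apply: filterS (big (e^-1)) => t st.
  have s0 : 0 < s t by apply: lt_trans st; rewrite invr_gt0.
  rewrite sub0r normrN ger0_norm ?invr_ge0 ?(ltW s0) //.
  by rewrite ltW // invf_plt ?posrE.
Qed.

(* Along a family of constant rank, sign-preserving support reduction keeps the
   multipliers bounded, so they have limits with the same signs. *)
Lemma multipliers_limit (E A : {set I}) (c : T -> I -> R) (r : 'rV[R]_D) :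
  E \subset A ->
  (\forall t \near G, forall i, i \notin A -> c t i = 0) ->
  \sum_i c t i *: rho t i @[t --> G] --> r ->
  (forall S : {set I}, E \subset S -> S \subset A ->
     \forall t \near G, \dim <<fam S (rho t)>> = \dim <<fam S rho0>>) ->
  exists c0 : I -> R, [/\ \sum_i c0 i *: rho0 i = r,
    forall i, i \notin A -> c0 i = 0 &
    \forall t \near G, forall i, i \notin E ->
      [/\ c t i = 0 -> c0 i = 0, 0 <= c t i -> 0 <= c0 i &
          c t i <= 0 -> c0 i <= 0]].
Proof.
move=> EA cA sc crank.
have [E0 E0E [E0f E0s]] := fam_basis E rho0.
have [c1 Hc1] := choice (fun t => support_reduction (rho t) E (c t)).
pose N t : {set I} := [set i | (i \notin E) && (c1 t i != 0)]%SET.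
(* The support outside [E] of the reduced multipliers varies with t; along the ultrafilter it is one
   fixed set. *)
have [N0 HN] := ultra_finite N GU.
have N0A : N0 \subset A.
  have [t [cAt Nt]] := near_ex2 cA HN.
  apply/fintype.subsetP => i; rewrite -Nt inE => /andP[iE]; apply: contraNT => iA.
  have [_ + _] := Hc1 t; move=> /(_ i iE)[a _ ->]; rewrite cAt ?mulr0 //.
(* Freeness at the limit persists nearby, and constant rank of the rows of [E] prevents their span
   from growing: a basis chosen at the limit is a basis along [G]. *)
have spanE : \forall t \near G, <<fam E0 (rho t)>>%VS = <<fam E (rho t)>>%VS /\
    free (fam E0 (rho t)).
  have := crank E (subxx _) EA.
  apply: filterS2 (near_free_fam E0f) => t ft dE; split => //.
  apply/eqP; rewrite eqEdim fam_spanS //= dE -E0s.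
  by move: ft E0f; rewrite !fam_freeE => /eqP -> /eqP ->.
pose S := E0 :|: N0.
have NE i : i \in N0 -> i \notin E.
  have [t Nt] := @filter_ex _ G _ _ HN.
  by rewrite -Nt inE => /andP[].
(* The decisive use of constant rank. The reduction makes the rows of [S] free at t, so their number
   is the rank of [E :|: N0] there; this rank is the same at the limit, where the rows of [S] span
   the same space as those of [E :|: N0]. *)
have Sf : free (fam S rho0).
  have Sft : \forall t \near G, free (fam S (rho t)).
    apply: filterS2 spanE HN => t [_ ft] Nt; apply/fam_freeP => g gS g0.
    have gE : forall i, i \notin E -> g i = 0.
      have [_ _ ind] := Hc1 t; apply: ind => // i iE c1i; apply: gS; rewrite !inE negb_or; apply/andP; split.
        by apply: contra iE; exact: (fintype.subsetP E0E).
      by rewrite -Nt inE c1i eqxx andbF.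
    move/fam_freeP: ft; apply => // i iE0.
    have [iE|iE] := boolP (i \in E); last exact: gE.
    by apply: gS; rewrite !inE negb_or iE0 /=; apply: contraL iE; exact: NE.
  have sE0 : <<fam S rho0>>%VS = <<fam (E :|: N0) rho0>>%VS.
    by rewrite !fam_spanU E0s.
  have EN : E :|: N0 \subset A by rewrite finset.subUset EA.
  have [t [ft [st _] dt]] := near_ex3 Sft spanE (crank _ (finset.subsetUl E N0) EN).
  rewrite fam_freeE sE0 -dt; move: ft; rewrite fam_freeE => /eqP <-.
  by rewrite !fam_spanU st.
(* On [E] signs are irrelevant, so that part of the combination may be rewritten in the basis [E0];
   the coefficients outside [E] are left alone. *)
have H2 t : exists c2 : I -> R, <<fam E0 (rho t)>>%VS = <<fam E (rho t)>>%VS ->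
    N t = N0 ->
    [/\ forall i, i \notin S -> c2 i = 0,
        forall i, i \notin E -> c2 i = c1 t i &
        \sum_i c2 i *: rho t i = \sum_i c t i *: rho t i].
  have [st|] := pselect (<<fam E0 (rho t)>>%VS = <<fam E (rho t)>>%VS); last by exists (fun=> 0).
  have := fam_span_sum E (rho t) (c1 t); rewrite -st => /fam_sum[b bE0 bs].
  exists (fun i => if i \in E then b i else c1 t i) => _ Nt; split.
  - move=> i; rewrite !inE negb_or => /andP[iE0 iN]; case: ifPn => iE; first exact: bE0.
    by move: iN; rewrite -Nt inE iE /= negbK => /eqP.
  - by move=> i /negbTE ->.
  - have [<- _ _] := Hc1 t.
    rewrite [RHS](bigID (mem E)) /= bs (bigID (mem E)) /=; congr (_ + _).
      rewrite [RHS](bigID (mem E)) /= [X in _ = _ + X]big1 ?addr0 => [|i iE].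
        by apply: eq_bigr => i ->.
      by rewrite bE0 ?scale0r //; apply: contra iE; exact: (fintype.subsetP E0E).
    by apply: eq_bigr => i /negbTE ->.
have [c2 Hc2] := choice H2.
have good : \forall t \near G,
    [/\ forall i, i \notin S -> c2 t i = 0,
        forall i, i \notin E -> c2 t i = c1 t i &
        \sum_i c2 t i *: rho t i = \sum_i c t i *: rho t i].
  by apply: filterS2 spanE HN => t [st _] Nt; exact: Hc2.
have sc2 : \sum_i c2 t i *: rho t i @[t --> G] --> r.
  apply: cvg_trans sc; apply: near_eq_cvg.
  by apply: filterS good => t [_ _ ->].
have cS2 : \forall t \near G, forall i, i \notin S -> c2 t i = 0.
  by apply: filterS good => t [].
have [M HM] := free_fam_bounded Sf cS2 sc2.
have L i : exists l : R, c2 t i @[t --> G] --> l.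
  apply: (@ultra_cvg_real _ _ _ _ _ M); apply: filterS HM => t; apply: le_trans.
  by rewrite (bigD1 i) //= lerDl sumr_ge0.
have [c0 Hc0] := choice L.
have zero i : (\forall t \near G, c2 t i = 0) -> c0 i = 0.
  exact: lim_near_cst_real (Hc0 i).
exists c0; split.
- exact: cvg_unique (cvg_fam_sum Hc0) sc2.
- move=> i iA; apply: zero; apply: filterS cS2 => t; apply.
  rewrite inE negb_or; apply/andP; split; apply: contra iA; last exact: (fintype.subsetP N0A).
  by move=> /(fintype.subsetP E0E); exact: (fintype.subsetP EA).
- apply: filter_forall => i.
  have [iE|iE] := boolP (i \in E); first exact: nearW.
  have sgn : \forall t \near G, exists2 a, 0 <= a & c2 t i = a * c t i.
    apply: filterS good => t [_ /(_ i iE) -> _].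
    by have [_ /(_ i iE) ? _] := Hc1 t.
  have K0 : (\forall t \near G, c t i = 0) -> c0 i = 0.
    move=> H; apply: zero; apply: filterS2 sgn H => t [a _ ->] ->.
    by rewrite mulr0.
  have Kp : (\forall t \near G, 0 <= c t i) -> 0 <= c0 i.
    move=> H; apply: (cvgr_to_ge (Hc0 i)).
    by apply: filterS2 sgn H => t [a a0 ->] ?; rewrite mulr_ge0.
  have Kn : (\forall t \near G, c t i <= 0) -> c0 i <= 0.
    move=> H; apply: (cvgr_to_le (Hc0 i)).
    by apply: filterS2 sgn H => t [a a0 ->] ?; rewrite mulr_ge0_le0.
  (* An ultrafilter decides [P]: either it holds eventually and [Q] follows, or its negation does
     and the implication is void. *)
  have X (P : T -> Prop) (Q : Prop) : ((\forall t \near G, P t) -> Q) ->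
      \forall t \near G, P t -> Q.
    move=> PQ; have [/PQ q|nP] := in_ultra_setVsetC [set t | P t] GU.
      exact: nearW.
    by apply: filterS nP => t /= nPt Pt.
  by apply: filterS3 (X _ _ K0) (X _ _ Kp) (X _ _ Kn) => t A1 A2 A3 _; split.
Qed.

End LimitOfMultipliers.

(** * Convex hulls and the subgradients of - V *)

Lemma sub_filter_cvg (T : Type) (X : topologicalType) (F G : set_system T)
    (u : T -> X) (l : X) : F `<=` G -> u @ F --> l -> u @ G --> l.
Proof. by move=> FG ul A /ul; exact: FG. Qed.

Lemma ultra_eventually : exists2 G : set_system nat, UltraFilter G & \oo `<=` G.
Proof. by have [G [GU FG]] := ultraFilterLemma eventually_filter; exists G. Qed.

Lemma cvg_dist_harmonic (R : realType) (V : normedModType R) (G : set_system nat)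
    (u : nat -> V) (l : V) : \oo `<=` G ->
  (forall j, `|u j - l| <= j.+1%:R^-1) -> u @ G --> l.
Proof.
by move=> FG H; apply: sub_filter_cvg FG _; exact: cvg_squeeze_harmonic.
Qed.

(** * Convex hulls: Caratheodory, compactness and separation *)

Section ConvexHull.
Variables (R : realType) (k : nat).
Implicit Types (A : set 'rV[R]_k) (p w v : 'rV[R]_k).

Lemma dotp_shift (x y : 'rV[R]_k) (t : R) :
  dotp (x + t *: y) (x + t *: y) = dotp x x + 2 * t * dotp y x + t * (t * dotp y y).
Proof. by rewrite dotpDl !dotpDr !dotpZl !dotpZr (dotpC x y); ring. Qed.

Lemma sub_co A : A `<=` co A.
Proof.
move=> a Aa; exists 1, (fun=> 1), (fun=> a); split => //.
  by rewrite big_ord1.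
by rewrite big_ord1 scale1r.
Qed.

Lemma norm_co A (C : R) : (forall w, A w -> `|w| <= C) ->
  forall p, co A p -> `|p| <= C.
Proof.
move=> AC p [l [t [a [t0 t1 Aa ->]]]].
apply: le_trans (ler_norm_sum _ _ _) _.
apply: (@le_trans _ _ (\sum_(i < l) t i * C)).
  by apply: ler_sum => i _; rewrite normrZ ger0_norm // ler_wpM2l // AC.
by rewrite -mulr_suml t1 mul1r.
Qed.

Lemma co_segment A p w (t : R) : co A p -> A w -> 0 <= t <= 1 ->
  co A (p + t *: (w - p)).
Proof.
move=> [l [c [a [c0 c1 Aa ->]]]] Aw /andP[t0 t1].
exists l.+1, (fun i => oapp (fun j => (1 - t) * c j) t (unlift ord0 i)),
  (fun i => oapp a w (unlift ord0 i)); split.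
- by move=> i; case: unliftP => [j|] _ //=; rewrite mulr_ge0 // subr_ge0.
- rewrite big_ord_recl unlift_none /=.
  under eq_bigr do rewrite liftK /=.
  by rewrite -mulr_sumr c1 mulr1 addrC subrK.
- by move=> i; case: unliftP => [j|] _ //=.
- rewrite big_ord_recl unlift_none /=.
  under [in RHS]eq_bigr do rewrite liftK /= -scalerA.
  by rewrite -scaler_sumr scalerBr scalerBl scale1r addrCA.
Qed.

(** Affine independence of the points is linear independence of the lifted rows [(a i, 1)], which
    live in dimension [k + 1]. [support_reduction] with an empty free part keeps the weights
    nonnegative, and the last coordinate keeps their sum. *)
Lemma co_caratheodory A p : co A p ->
  exists (t : 'I_k.+1 -> R) (a : 'I_k.+1 -> 'rV[R]_k),
    [/\ forall i, 0 <= t i, \sum_i t i = 1, forall i, A (a i) &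
        p = \sum_i t i *: a i].
Proof.
move=> [l [t [a [t0 t1 Aa ->]]]].
(* Weights of sum 1 force a nonempty index set. Its element [i0l] is the default that pads the list
   to exactly [k.+1] points, with weight zero. *)
have i0l : 'I_l.
  case: l t a t0 t1 Aa => [t a _|l ? ? ? ? ?]; last exact: ord0.
  by rewrite big_ord0 => /eqP; rewrite eq_sym oner_eq0.
pose rho i : 'rV[R]_(k + 1) := row_mx (a i) 1%:M.
have [c [cs ct ci]] := support_reduction rho finset.set0 t.
have sumE (b : 'I_l -> R) :
    \sum_i b i *: rho i = row_mx (\sum_i b i *: a i) (\sum_i b i)%:M.
  rewrite -[LHS]hsubmxK !linear_sum /=; congr row_mx.
    by apply: eq_bigr => i _; rewrite linearZ /= row_mxKl.
  rewrite -scalemx1 scaler_suml; apply: eq_bigr => i _.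
  by rewrite linearZ /= row_mxKr.
move: cs; rewrite !sumE t1 => /eq_row_mx[cp c1].
have {}c1 : \sum_i c i = 1.
  by move/matrixP: c1 => /(_ 0 0); rewrite !mxE eqxx !mulr1n.
have c0 i : 0 <= c i.
  by have [|u u0 ->] := ct i; rewrite ?inE // mulr_ge0.
pose S : {set 'I_l} := [set i | c i != 0]%SET.
have Sk : (#|S| <= k.+1)%N.
  have : free (fam S rho).
    apply/fam_freeP => g gS g0 i; apply: (ci g) => //; last by rewrite inE.
    by move=> j _ cj; apply: gS; rewrite inE cj eqxx.
  rewrite fam_freeE => /eqP <-; apply: leq_trans (dimvS (subvf _)) _.
  by rewrite dimvf /dim /= mul1n addn1.
have padE (V : nmodType) (g : 'I_l -> V) : (forall i, i \notin S -> g i = 0) ->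
    \sum_(j < k.+1) (if (j < size (enum S))%N then g (nth i0l (enum S) j) else 0)
    = \sum_i g i.
  move=> gS; rewrite -big_mkcond /=.
  rewrite -(big_ord_widen _ (fun j => g (nth i0l (enum S) j))) -?cardE //.
  rewrite -(big_mkord xpredT (fun j => g (nth i0l (enum S) j))) cardE.
  rewrite -(big_nth i0l xpredT g) big_enum /= [RHS](bigID (mem S)) /=.
  by rewrite [X in _ = _ + X]big1 ?addr0.
exists (fun j => if (j < size (enum S))%N then c (nth i0l (enum S) j) else 0).
exists (fun j => a (nth i0l (enum S) j)); split => //.
- by move=> j; case: ifP.
- rewrite (padE _ c) ?c1 // => i; rewrite inE negbK => /eqP //.
- rewrite -cp -(padE _ (fun i => c i *: a i)).
    by apply: eq_bigr => j _; case: ifP => //; rewrite scale0r.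
  by move=> i; rewrite inE negbK => /eqP ->; rewrite scale0r.
Qed.

(** With the number of points fixed at [k.+1], weights and points converge separately along an
    ultrafilter. *)
Lemma compact_co A : compact A -> compact (co A).
Proof.
move=> Ac; rewrite compact_ultra => F FU FA.
have H p : exists ta : ('I_k.+1 -> R) * ('I_k.+1 -> 'rV[R]_k), co A p ->
    [/\ forall i, 0 <= ta.1 i, \sum_i ta.1 i = 1, forall i, A (ta.2 i) &
        p = \sum_i ta.1 i *: ta.2 i].
  have [/co_caratheodory[t [a ?]]|nA] := pselect (co A p); first by exists (t, a).
  by exists (fun=> 0, fun=> 0).
have [ta Hta] := choice H.
have Ht i : exists l : R, (ta p).1 i @[p --> F] --> l.
  apply: (@ultra_cvg_real _ _ _ _ _ 1); apply: filterS FA => p /Hta[t0 t1 _ _].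
  by rewrite ger0_norm // -t1 (bigD1 i) //= lerDl sumr_ge0.
have Ha i : exists l : 'rV[R]_k, A l /\ (ta p).2 i @[p --> F] --> l.
  have [|l Al al] := @ultra_cvg_compact _ _ FU _ A (fun p => (ta p).2 i) Ac; last by exists l.
  by apply: filterS FA => p /Hta[].
have [t Htl] := choice Ht; have [a Hal] := choice Ha.
exists (\sum_i t i *: a i); split.
  exists k.+1, t, a; split => //.
  - move=> i; apply: (cvgr_to_ge (Htl i)); by apply: filterS FA => p /Hta[].
  - apply: (@lim_near_cst_real _ _ F _ (fun p => \sum_i (ta p).1 i)).
      by apply: cvg_big => // ; exact: add_continuous.
    by apply: filterS FA => p /Hta[].
  - by move=> i; case: (Hal i).
have K : (\sum_i (ta p).1 i *: (ta p).2 i) @[p --> F] --> \sum_i t i *: a i.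
  apply: cvg_big => [|i _]; first exact: add_continuous.
  by apply: cvgZ; [exact: Htl|case: (Hal i)].
apply: cvg_trans K; apply: near_eq_cvg.
by apply: filterS FA => p /Hta[].
Qed.

(** Let [p] be a Euclidean projection of [z] on the hull. If [p - z] were nonzero, the hypothesis in
    this direction would give a point of [A] towards which one can move from [p] while approaching
    [z]. *)
Lemma co_separation A (z : 'rV[R]_k) : compact A ->
  (forall v, exists2 w, A w & dotp w v <= dotp z v) -> co A z.
Proof.
move=> Ac H.
have [w0 Aw0 _] := H 0.
have [//||p pA pmin] := @compact_EVT_min _ R (fun p => dotp (p - z) (p - z)) (co A) _ (compact_co Ac).
- by exists w0; exact: sub_co.
- apply: continuous_in_subspaceT => p _.
  exact: hasgrad_cvg (hasgrad_dist2 z p).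
move: pA; rewrite inE => pA.
have [/eqP|vn0] := eqVneq (p - z) 0; first by rewrite subr_eq0 => /eqP <-.
pose v := p - z; pose q := dotp v v.
have q0 : 0 < q by rewrite lt_neqAle dotp_ge0 eq_sym dotp_eq0 andbT.
have [w Aw wv] := H v.
pose d := dotp (w - p) (w - p).
have d0 : 0 <= d by exact: dotp_ge0.
have dv : dotp (w - p) v <= - q.
  have -> : w - p = w - z - v by rewrite /v opprB addrA subrK.
  by rewrite dotpBl dotpBl -/q; lra.
(* With this step [t <= 1] and [t * d <= q], so the quadratic term is at most [t * q], less than the
   linear gain of at least [2 * t * q]. *)
pose t := q / (d + q).
have t01 : 0 <= t <= 1.
  apply/andP; split; first by rewrite divr_ge0 ?addr_ge0 // ltW.
  by rewrite /t ler_pdivrMr ?ltr_wpDl // mul1r lerDr.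
have t_gt0 : 0 < t by rewrite divr_gt0 // ltr_wpDl.
have td : t * d <= q.
  rewrite /t mulrAC ler_pdivrMr ?ltr_wpDl // ler_wpM2l ?lerDl ?ltW //.
have := pmin (p + t *: (w - p)); rewrite inE => /(_ (co_segment pA Aw t01)).
have E : dotp (p + t *: (w - p) - z) (p + t *: (w - p) - z) =
    q + 2 * t * dotp (w - p) v + t * (t * d).
  by rewrite addrAC dotp_shift.
rewrite E -/v -/q => K; exfalso.
have : t * (t * d) <= t * q by rewrite ler_pM2l.
have : t * dotp (w - p) v <= t * - q by rewrite ler_pM2l.
have := mulr_gt0 t_gt0 q0; lra.
Qed.

End ConvexHull.

Lemma frechet_min (R : realType) k (phi psi : 'rV[R]_k -> R) z sigma :
  hasgrad psi z sigma ->
  (\forall w \near z, phi z + psi z <= phi w + psi w) ->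
  frechet_subdiff phi z (- sigma).
Proof.
move=> H m e e0; apply: filterS2 (H e e0) m => w.
by rewrite ler_norml dotpNl => /andP[A B] C; lra.
Qed.

(* Zagrodny's approximate mean value inequality: minimise
   V (a + t (b - a) + e) - t r + M |e|^2 over t in [0, 1], |e| <= delta, with M large. *)
Lemma approximate_mean_value (R : realType) k (V : 'rV[R]_k -> R)
    (a b : 'rV[R]_k) (r delta : R) : 0 < delta ->
  (forall t e, 0 <= t <= 1 -> `|e| <= delta ->
     {for a + t *: (b - a) + e, continuous V}) ->
  V b - V a < r ->
  exists x w t, [/\ 0 <= t <= 1, `|x - (a + t *: (b - a))| <= delta,
    frechet_subdiff V x w & dotp w (b - a) <= r].
Proof.
move=> delta0 Vc Vab.
pose K := `[0 : R, 1 : R]%classic `*` [set e : 'rV[R]_k | `|e - 0| <= delta].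
have Kc : compact K by apply: compact_setX; [exact: segment_compact|exact: compact_ball_rV].
pose Phi (M : R) (te : R * 'rV[R]_k) :=
  V (a + te.1 *: (b - a) + te.2) - te.1 * r + M * dotp te.2 te.2.
have K10 : K (1, 0) by split; rewrite /= ?in_itv /= ?ler01 ?lexx ?subrr ?normr0 ?ltW.
have Phic M : {within K, continuous (Phi M)}.
  apply: continuous_in_subspaceT => -[t e]; rewrite inE => -[/=].
  rewrite in_itv /= subr0 => t01 ed.
  have c1 : (fun te : R * 'rV[R]_k => te.1) @ (t, e) --> t by exact: cvg_fst.
  have c2 : (fun te : R * 'rV[R]_k => te.2) @ (t, e) --> e by exact: cvg_snd.
  apply: cvgD; last by apply: cvgM; [exact: cvg_cst|exact: cvg_dotp].
  apply: cvgB; last by apply: cvgM => //; exact: cvg_cst.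
  apply: (@cvg_comp _ _ _ (fun te : R * 'rV[R]_k => a + te.1 *: (b - a) + te.2) V _ (nbhs (a + t *: (b - a) + e))); last exact: Vc.
  apply: cvgD => //; apply: cvgD; first exact: cvg_cst.
  by apply: cvgZ => //; exact: cvg_cst.
have [||m0 _ mmin] := @compact_EVT_min _ R (Phi 0) K _ Kc; [by exists (1, 0)|exact: Phic|].
pose m := Phi 0 m0.
(* Near [a] the values of [V] exceed [V b - r], the value of [Phi] at [(1, 0)]. A minimiser with
   [|e| < eta] therefore cannot have t = 0. *)
have [eta [eta0 etad etaV]] : exists eta, [/\ 0 < eta, eta <= delta &
    forall x, `|x - a| < eta -> V b - r < V x].
  have Va : V @ a --> V a.
    have := Vc 0 0; rewrite scale0r !addr0 normr0 ler01 lexx; apply => //; exact: ltW.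
  have e0 : 0 < V a - (V b - r) by lra.
  move/cvgrPdist_lt: Va => /(_ _ e0) /near_normP[e1 e10 He1].
  exists (Num.min e1 delta); split.
  - by rewrite lt_min e10.
  - by rewrite ge_min lexx orbT.
  - by move=> x; rewrite lt_min => /andP[/He1 + _]; rewrite ltr_norml => /andP[_]; lra.
pose C := V b - r - m.
(* [C] is the gap between the value at [(1, 0)] and the unpenalised minimum; this [M] makes a
   deviation of size [eta] cost more than the gap. *)
pose M := (`|C| + 1) / eta ^+ 2.
have M0 : 0 < M by rewrite divr_gt0 ?exprn_gt0 // ltr_wpDl.
have [||[t e] teK temin] := @compact_EVT_min _ R (Phi M) K _ Kc; [by exists (1, 0)|exact: Phic|].
move: teK; rewrite inE => -[/=]; rewrite in_itv /= subr0 => t01 ed.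
have min10 : Phi M (t, e) <= V b - r.
  have := temin (1, 0); rewrite inE => /(_ K10); rewrite /Phi /=.
  have -> : a + 1 *: (b - a) + 0 = b by rewrite scale1r addr0 addrC subrK.
  by rewrite dotp0 mulr0 addr0 mul1r.
have Kte : K (t, e) by split; rewrite /= ?in_itv ?subr0.
have elt : `|e| < eta.
  have h1 : M * dotp e e <= C.
    have := mmin (t, e); rewrite inE => /(_ Kte); rewrite -/m /Phi /= mul0r addr0.
    move: min10; rewrite /Phi /= /C => A B.
    by move: A B; move: (V _) (M * _) (t * r) => X Y Z A B; lra.
  have h2 : `|e| ^+ 2 < eta ^+ 2.
    apply: le_lt_trans (sqr_norm_dotp e) _.
    rewrite -(ltr_pM2l M0); apply: le_lt_trans h1 _.
    rewrite /M divfK ?gt_eqF ?exprn_gt0 //.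
    by apply: le_lt_trans (ler_norm _) _; rewrite ltrDl.
  by move: h2; rewrite ltr_sqr ?nnegrE // ltW.
have t_gt0 : 0 < t.
  case/andP: t01 => t0 t1; rewrite lt_neqAle t0 andbT eq_sym; apply/eqP => tz.
  have := etaV (a + e); rewrite addrC addKr => /(_ elt).
  move: min10; rewrite /Phi /= tz scale0r addr0 mul0r subr0 (addrC a).
  by have := mulr_ge0 (ltW M0) (dotp_ge0 e); lra.
pose c := a + t *: (b - a); pose x := c + e.
have elt' : `|e| < delta by exact: lt_le_trans elt etad.
exists x, (- (M *: (2 *: e))), t; split => //.
- by rewrite /x addrC addKr.
- apply: (@frechet_min _ _ _ (fun w => M * dotp (w - c) (w - c))).
    by apply: hasgradZ; have := hasgrad_dist2 c x; rewrite {2}/x addrC addKr.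
  have gap : 0 < delta - `|e| by rewrite subr_gt0.
  apply: filterS (near_dist x gap) => w wx.
  have wd : `|w - c| <= delta.
    have -> : w - c = w - x + e by have E (u v : 'rV[R]_k) : w - u = w - (u + v) + v; [rewrite opprD addrA subrK|exact: E].
    by apply: le_trans (ler_normD _ _) _; lra.
  have := temin (t, w - c); rewrite inE.
  have Kw : K (t, w - c) by split; rewrite /= ?in_itv ?subr0.
  move=> /(_ Kw); rewrite /Phi /= -/c (addrC c (w - c)) subrK.
  by rewrite -/x /x [c + e - c]addrC addKr; lra.
- apply/ler_addgt0Pr => eps eps0.
  pose q := dotp (b - a) (b - a).
  have q0 : 0 <= q by exact: dotp_ge0.
  have Mq : 0 < M * q + 1 by rewrite ltr_wpDl // mulr_ge0 // ltW.
  (* Going back by [h] in t and adding [h *: (b - a)] to [e] leaves the point [x] unchanged, so [V]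
     cancels in the comparison. The three bounds keep t nonnegative, keep [e] in its ball, and make
     the second order term at most [eps]. Only t > 0 is required, so t = 1 is allowed. *)
  pose h := Num.min t (Num.min ((delta - `|e|) / (`|b - a| + 1)) (eps / (M * q + 1))).
  have h0 : 0 < h.
    by rewrite !lt_min t_gt0 /= !divr_gt0 // ?subr_gt0 // ltr_wpDl.
  have ht : h <= t by rewrite ge_min lexx.
  have hd : h * `|b - a| <= delta - `|e|.
    have : h <= (delta - `|e|) / (`|b - a| + 1) by rewrite !ge_min lexx /= orbT.
    rewrite ler_pdivlMr ?ltr_wpDl // => /(le_trans _); apply.
    by rewrite ler_wpM2l ?lerDl // ltW.
  have he : h * (M * q) <= eps.
    have : h <= eps / (M * q + 1) by rewrite !ge_min lexx /= !orbT.
    rewrite ler_pdivlMr // => /(le_trans _); apply.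
    by rewrite ler_wpM2l ?lerDl // ltW.
  have Kh : K (t - h, e + h *: (b - a)).
    split; rewrite /= ?in_itv /= ?subr0.
      by case/andP: t01 => t0 t1; apply/andP; split; lra.
    apply: le_trans (ler_normD _ _) _; rewrite normrZ gtr0_norm //; lra.
  have := temin (t - h, e + h *: (b - a)); rewrite inE => /(_ Kh); rewrite /Phi /=.
  have -> : a + (t - h) *: (b - a) + (e + h *: (b - a)) = x.
    by apply/rowP => i; rewrite !mxE; ring.
  rewrite -/c -/x dotp_shift -/q (dotpC (b - a) e) => J.
  rewrite dotpNl !dotpZl -(ler_pM2l h0).
  have he2 : h * (h * (M * q)) <= h * eps by rewrite ler_wpM2l // ltW.
  move: J he2; move: (V x) (dotp e e) (dotp e (b - a)) => X Y Z J he2.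
  clear -J he2; lra.
Qed.

(* W is locally bounded with closed graph over N, phrased with ultrafilters. *)
Definition ultra_closed (R : realType) k l (N : set 'rV[R]_k)
    (W : 'rV[R]_k -> set 'rV[R]_l) : Prop :=
  forall (T : Type) (G : set_system T) (x : 'rV[R]_k) (xt : T -> 'rV[R]_k)
    (wt : T -> 'rV[R]_l),
  UltraFilter G -> N x -> xt @ G --> x ->
  (\forall t \near G, W (xt t) (wt t)) -> exists2 w, W x w & wt @ G --> w.

Lemma not_near_seq (R : realType) (V : normedModType R) (x : V) (P : V -> Prop) :
  ~ (\forall y \near x, P y) ->
  forall e : R, 0 < e -> exists2 y, `|y - x| < e & ~ P y.
Proof.
move=> nP e e0; apply: contrapT => H; apply: nP; apply/near_normP; exists e => // y ye.
by apply: contrapT => nPy; apply: H; exists y.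
Qed.

Lemma near_cvg (T : Type) (G : set_system T) (X : topologicalType) (u : T -> X)
    (l : X) (P : X -> Prop) : u @ G --> l -> (\forall x \near l, P x) ->
  \forall t \near G, P (u t).
Proof. by move=> ul H; exact: ul. Qed.

(** * From Frechet subgradients of V to limiting subgradients of - V *)

Section UltraClosedMaps.
Variables (R : realType) (k : nat).
Variables (V : 'rV[R]_k -> R) (W : 'rV[R]_k -> set 'rV[R]_k) (N : set 'rV[R]_k).
Hypothesis N_open : forall x, N x -> \forall y \near x, N y.
Hypothesis V_cont : forall x, N x -> {for x, continuous V}.
Hypothesis V_sub : forall x w, N x -> frechet_subdiff V x w -> W x w.
Hypothesis W_closed : ultra_closed N W.

Lemma tube_in_N x : N x -> exists2 e : R, 0 < e & forall y, `|y - x| < e -> N y.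
Proof. by move=> /N_open /near_normP. Qed.

Lemma compact_W x : N x -> compact (W x).
Proof.
move=> Nx; rewrite compact_ultra => F FU FW.
have [w Ww Fw] := @W_closed _ F x (fun=> x) id FU Nx (cvg_cst _) FW.
by exists w.
Qed.

Lemma W_bounded x : N x ->
  exists2 C : R, 0 <= C & \forall y \near x, forall w, W y w -> `|w| <= C.
Proof.
move=> Nx; apply: contrapT => nex.
have H (j : nat) : exists yw : 'rV[R]_k * 'rV[R]_k,
    [/\ `|yw.1 - x| <= j.+1%:R^-1, W yw.1 yw.2 & j%:R < `|yw.2|].
  have nC : ~ (\forall y \near x, forall w, W y w -> `|w| <= j%:R).
    by move=> nr; apply: nex; exists j%:R.
  have j0 : 0 < j.+1%:R^-1 :> R by rewrite invr_gt0.
  have [y yx /existsNP[w /not_implyP[Ww /negP]]] := not_near_seq nC j0.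
  by rewrite -ltNge => jw; exists (y, w); rewrite ltW.
have [yw Hyw] := choice H.
have [G GU FG] := ultra_eventually.
have [w Ww wG] : exists2 w, W x w & (yw j).2 @[j --> G] --> w.
  apply: (@W_closed _ G x (fun j => (yw j).1)) => //.
    by apply: cvg_dist_harmonic => // j; case: (Hyw j).
  by apply: nearW => j; case: (Hyw j).
have bd : \forall j \near G, `|(yw j).2| <= `|w| + 1.
  move/cvgrPdist_le: wG => /(_ 1 ltr01); apply: filterS => j.
  rewrite distrC => h; rewrite -[X in `|X|](subrK w) addrC.
  by apply: le_trans (ler_normD _ _) _; rewrite lerD2l.
have [j0 Hj0] : exists j0 : nat, `|w| + 1 <= j0%:R.
  exists (Num.bound (`|w| + 1)); apply/ltW/archi_boundP.
  by rewrite addr_ge0.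
have big : \forall j \near G, (j0 <= j)%N by apply: FG; exists j0.
have [j [A B]] := near_ex2 bd big.
have [_ _ C] := Hyw j.
have : j0%:R <= j%:R :> R by rewrite ler_nat.
by move: A C Hj0; lra.
Qed.

Lemma approximate_subgradient (f : 'rV[R]_k -> R) (a b : 'rV[R]_k) (r delta : R) :
  (forall x, N x -> {for x, continuous f}) -> 0 < delta ->
  (forall y, `|y - a| <= `|b - a| + delta -> N y) -> f b - f a < r ->
  exists x w, [/\ `|x - a| <= `|b - a| + delta, frechet_subdiff f x w &
    dotp w (b - a) <= r].
Proof.
move=> fc d0 HN fab.
have bnd t e : 0 <= t <= 1 -> `|e| <= delta -> `|t *: (b - a) + e| <= `|b - a| + delta.
  move=> /andP[t0 t1] ed; apply: le_trans (ler_normD _ _) _; apply: lerD => //.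
  by rewrite normrZ ger0_norm // ler_piMl.
have [t e t01 ed|x [w [t [t01 xt Fw wr]]]] := @approximate_mean_value R k f a b r delta d0 _ fab.
  have E : a + t *: (b - a) + e - a = t *: (b - a) + e.
    by rewrite addrAC [a + _]addrC addrK.
  by apply: fc; apply: HN; rewrite E bnd.
exists x, w; split => //.
have := bnd t (x - (a + t *: (b - a))) t01 xt.
have -> : t *: (b - a) + (x - (a + t *: (b - a))) = x - a.
  by apply/rowP => i; rewrite !mxE; ring.
by [].
Qed.

(** The mean value inequality on the degenerate segment [a = b = x] with [r = 1] already produces a
    nearby point with a subgradient. *)
Lemma frechet_dense (f : 'rV[R]_k -> R) x (e : R) :
  (forall y, N y -> {for y, continuous f}) -> N x -> 0 < e ->
  exists y w, [/\ `|y - x| <= e, N y & frechet_subdiff f y w].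
Proof.
move=> fc Nx e0; have [r r0 Hr] := tube_in_N Nx.
pose d := Num.min (r / 2) e.
have d0 : 0 < d by rewrite lt_min e0 divr_gt0.
have inN y : `|y - x| <= `|x - x| + d -> N y.
  by rewrite subrr normr0 add0r le_min => /andP[ye _]; apply: Hr; lra.
have f1 : f x - f x < 1 by rewrite subrr.
have [y [w [yx Fw _]]] := approximate_subgradient fc d0 inN f1.
exists y, w; split => //; last exact: inN.
by move: yx; rewrite subrr normr0 add0r le_min => /andP[].
Qed.

Lemma W_nonempty x : N x -> W x !=set0.
Proof.
move=> Nx.
have H (j : nat) : exists yw : 'rV[R]_k * 'rV[R]_k,
    `|yw.1 - x| <= j.+1%:R^-1 /\ W yw.1 yw.2.
  have j0 : 0 < j.+1%:R^-1 :> R by rewrite invr_gt0.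
  by have [y [w [yx Ny Fw]]] := frechet_dense V_cont Nx j0; exists (y, w); split => //; exact: V_sub.
have [yw Hyw] := choice H.
have [G GU FG] := ultra_eventually.
have [w Ww wG] : exists2 w, W x w & (yw j).2 @[j --> G] --> w.
  apply: (@W_closed _ G x (fun j => (yw j).1)) => //.
    by apply: cvg_dist_harmonic => // j; case: (Hyw j).
  by apply: nearW => j; case: (Hyw j).
by exists w.
Qed.

(** A steeper decrease between two nearby points would give, by the mean value inequality, a
    subgradient lying in [W] and longer than the local bound [C]. The factor [k] is that of
    [dotp_norm]. *)
Lemma V_calm x : N x ->
  exists2 C : R, 0 <= C & \forall y \near x, `|V y - V x| <= C * `|y - x|.
Proof.
move=> Nx; have [C C0 HC] := W_bounded Nx; have [e1 e10 He1] := tube_in_N Nx.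
move/near_normP: HC => [e2 e20 He2].
pose e := Num.min e1 e2.
have e0 : 0 < e by rewrite lt_min e10.
have key a b : `|a - x| < e / 4 -> `|b - x| < e / 4 ->
    V b - V a >= - (k%:R * C * `|b - a|).
  move=> ax bx; rewrite leNgt; apply/negP => h.
  have ba : `|b - a| < e / 2.
    rewrite -(subrKA x); apply: le_lt_trans (ler_normD _ _) _.
    by rewrite (distrC x); lra.
  have d0 : 0 < e / 4 by rewrite divr_gt0.
  have ball_e y : `|y - a| <= `|b - a| + e / 4 -> `|y - x| < e.
    move=> ya; rewrite -(subrKA a); apply: le_lt_trans (ler_normD _ _) _; lra.
  have inN y : `|y - a| <= `|b - a| + e / 4 -> N y.
    by move=> /ball_e; rewrite lt_min => /andP[ye _]; exact: He1.
  pose r := (V b - V a - k%:R * C * `|b - a|) / 2.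
  have rlt : V b - V a < r by rewrite /r; lra.
  have [y [w [ya Fw wr]]] := approximate_subgradient V_cont d0 inN rlt.
  have wC : `|w| <= C.
    by apply: (He2 y); [move: (ball_e y ya); rewrite lt_min => /andP[]|apply: V_sub => //; exact: inN].
  have := dotp_norm w (b - a); rewrite ler_norml => /andP[low _].
  have : k%:R * `|w| * `|b - a| <= k%:R * C * `|b - a|.
    by rewrite ler_wpM2r // ler_wpM2l.
  by move: wr; rewrite /r; lra.
exists (k%:R * C); first by rewrite mulr_ge0.
have e40 : 0 < e / 4 by rewrite divr_gt0.
apply: filterS (near_dist x e40) => y yx.
have xx : `|x - x| < e / 4 by rewrite subrr normr0.
have := key _ _ xx yx; have := key _ _ yx xx.
by rewrite (distrC x) ler_norml => h1 h2; apply/andP; split; lra.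
Qed.

(** A Frechet subgradient [eta] of [- V] at [y] bounds the increment of [V] along [v] from above by
    about [- dotp eta v]. The mean value inequality converts this into a subgradient of [V] nearby,
    hence an element of [W], with the same bound in direction [v]; its limit is the witness required
    by [co_separation]. *)
Lemma limiting_opp_co x zeta : N x ->
  limiting_subdiff (fun y => - V y) x zeta -> co (W x) (- zeta).
Proof.
move=> Nx /limiting_subdiffP H; have [e e0 He] := tube_in_N Nx.
apply: co_separation (compact_W Nx) _ => v.
have key (j : nat) : exists yw : 'rV[R]_k * 'rV[R]_k,
    [/\ `|yw.1 - x| <= j.+1%:R^-1, W yw.1 yw.2 &
        dotp yw.2 v <= dotp (- zeta) v + j.+1%:R^-1].
  pose h : R := Num.min (e / 2) (j.+1%:R^-1).
  have h0 : 0 < h by rewrite lt_min divr_gt0 //= invr_gt0.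
  have kv0 : 0 <= k%:R * `|v| by rewrite mulr_ge0.
  have v0 : 0 <= `|v| by [].
  (* The denominator adds up all the errors: [k%:R * |v|] for replacing [eta] by [zeta], [|v|] for
     the subgradient inequality or the length of the segment, and up to three times [d] for the
     shifts. *)
  pose d := h / (k%:R * `|v| + `|v| + 3).
  have den : 0 < k%:R * `|v| + `|v| + 3 by lra.
  have d0 : 0 < d by rewrite divr_gt0.
  have dh : d * (k%:R * `|v| + `|v| + 3) = h by rewrite /d divfK // gt_eqF.
  have dk : 0 <= d * (k%:R * `|v|) by rewrite mulr_ge0 // ltW.
  have dv : 0 <= d * `|v| by rewrite mulr_ge0 // ltW.
  have [y [eta [yx ez Fe]]] := H d d0.
  have [t0 t00 Ht0] := near_ray v (Fe d d0).
  pose t := Num.min t0 d.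
  have t_gt0 : 0 < t by rewrite lt_min t00.
  have td : t <= d by rewrite ge_min lexx orbT.
  have := Ht0 t; rewrite gtr0_norm // ge_min lexx => /(_ isT).
  have E : y + t *: v - y = t *: v by rewrite addrAC subrr add0r.
  rewrite E normrZ gtr0_norm // dotpZr => Vt.
  have inN z : `|z - y| <= `|y + t *: v - y| + d -> `|z - x| <= h.
    rewrite E normrZ gtr0_norm // => zy.
    rewrite -(subrKA y); apply: le_trans (ler_normD _ _) _.
    have : t * `|v| <= d * `|v| by rewrite ler_wpM2r.
    by rewrite !mulrDr in dh; lra.
  have inN' z : `|z - y| <= `|y + t *: v - y| + d -> N z.
    by move=> /inN; rewrite le_min => /andP[zx _]; apply: He; lra.
  have rlt : V (y + t *: v) - V y < t * (- dotp eta v + d * `|v| + d).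
    have : 0 < t * d by rewrite mulr_gt0.
    by rewrite !mulrDr; nra.
  have [z [w [zy Fw wr]]] := approximate_subgradient V_cont d0 inN' rlt.
  exists (z, w); split => /=.
  - by have := inN z zy; rewrite le_min => /andP[].
  - by apply: V_sub => //; exact: inN'.
  - move: wr; rewrite E dotpZr ler_pM2l // => wr.
    have : `|dotp (eta - zeta) v| <= d * (k%:R * `|v|).
      apply: le_trans (dotp_norm _ _) _.
      rewrite mulrAC mulrC; apply: ler_wpM2r => //.
    rewrite dotpBl ler_norml => /andP[l1 l2].
    have hj : h <= j.+1%:R^-1 by rewrite ge_min lexx orbT.
    have fin : dotp w v <= - dotp zeta v + h by rewrite !mulrDr in dh; lra.
    by rewrite dotpNl; apply: le_trans fin _; rewrite lerD2l.
have [yw Hyw] := choice key.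
have [G GU FG] := ultra_eventually.
have [w Ww wG] : exists2 w, W x w & (yw j).2 @[j --> G] --> w.
  apply: (@W_closed _ G x (fun j => (yw j).1)) => //.
    by apply: cvg_dist_harmonic => // j; case: (Hyw j).
  by apply: nearW => j; case: (Hyw j).
exists w => //.
have c1 : dotp (yw j).2 v @[j --> G] --> dotp w v by apply: cvg_dotp => //; exact: cvg_cst.
have c2 : (dotp (- zeta) v + j.+1%:R^-1) @[j --> G] --> dotp (- zeta) v + 0.
  apply: cvgD; first exact: cvg_cst.
  exact: sub_filter_cvg FG (@harmonic_cvg0 R).
rewrite addr0 in c2.
have c3 : (dotp (- zeta) v + j.+1%:R^-1 - dotp (yw j).2 v) @[j --> G] -->
    dotp (- zeta) v - dotp w v by exact: cvgB.
rewrite -subr_ge0; apply: (cvgr_to_ge c3); apply: nearW => j.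
by rewrite subr_ge0; case: (Hyw j).
Qed.

(** Frechet subgradients of [- V] exist at points arbitrarily close to [x] and are bounded, being
    opposites of elements of [co (W y)]. It supplies the subgradient of f - V that M-stationarity
    names even when its coefficient is zero. *)
Lemma limiting_opp_nonempty x : N x ->
  exists zeta, limiting_subdiff (fun y => - V y) x zeta.
Proof.
move=> Nx; have [C C0 /near_normP[e e0 He]] := W_bounded Nx.
have nVc y : N y -> {for y, continuous (fun z => - V z)}.
  by move=> Ny; apply: (cvgN (V_cont Ny)).
have H (j : nat) : exists yw : 'rV[R]_k * 'rV[R]_k,
    [/\ `|yw.1 - x| <= j.+1%:R^-1, `|yw.2| <= C & frechet_subdiff (fun z => - V z) yw.1 yw.2].
  have d0 : 0 < Num.min (e / 2) (j.+1%:R^-1) by rewrite lt_min divr_gt0 //= invr_gt0.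
  have [y [w [+ Ny Fw]]] := frechet_dense nVc Nx d0.
  rewrite le_min => /andP[ye yj]; exists (y, w); split => //=.
  rewrite -normrN; apply: norm_co (limiting_opp_co Ny (frechet_limiting Fw)).
  by apply: He; lra.
have [yw Hyw] := choice H.
have [G GU FG] := ultra_eventually.
have [|zeta Hz] := @ultra_cvg_rV R _ G GU k (fun j => (yw j).2) C.
  by apply: nearW => j; case: (Hyw j).
exists zeta; apply: (@limiting_closed _ _ _ _ G (fun j => (yw j).1) _ _ _ _ _ Hz).
  by apply: cvg_dist_harmonic => // j; case: (Hyw j).
by apply: nearW => j; apply: frechet_limiting; case: (Hyw j).
Qed.

End UltraClosedMaps.

(** * The lower level value function *)

Lemma near_nbhs_nbhs (X : topologicalType) (x : X) (P : X -> Prop) :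
  (\forall y \near x, P y) -> \forall y \near x, \forall z \near y, P z.
Proof. by move=> /nbhs_interior. Qed.

(** The penalised minimisers for M = j + 1 have a limit along an ultrafilter. It satisfies [P = 0]
    and is no worse than [z0], so it is [z0] by the uniqueness hypothesis, and some minimiser
    already lies in [A]. *)
Lemma penalty_minimizer (R : realType) (X : topologicalType) (K : set X)
    (Phi P : X -> R) (z0 : X) (A : set X) :
  compact K -> K z0 -> (forall z, K z -> {for z, continuous Phi}) ->
  (forall z, K z -> {for z, continuous P}) -> (forall z, 0 <= P z) -> P z0 = 0 ->
  (forall z, K z -> P z = 0 -> Phi z <= Phi z0 -> z = z0) -> nbhs z0 A ->
  exists2 M : R, 0 < M & exists z, [/\ K z, A z &
    forall z', K z' -> Phi z + M * P z <= Phi z' + M * P z'].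
Proof.
move=> Kc Kz0 cPhi cP P0 Pz0 uniq nA.
have minM (M : R) : exists z, K z /\ forall z', K z' -> Phi z + M * P z <= Phi z' + M * P z'.
  have [||z Kz zmin] := @compact_EVT_min _ R (fun z => Phi z + M * P z) K _ Kc.
  - by exists z0.
  - apply: continuous_in_subspaceT => z; rewrite inE => Kz.
    by apply: cvgD; [exact: cPhi|apply: cvgM; [exact: cvg_cst|exact: cP]].
  exists z; split; first by move: Kz; rewrite inE.
  by move=> z' Kz'; apply: zmin; rewrite inE.
have [zz Hzz] := choice (fun j : nat => minM j.+1%:R).
(* The unpenalised minimum bounds [P (zz j)] by [(Phi z0 - Phi m) / (j + 1)]. *)
have [m [_ mmin]] := minM 0.
have [G GU FG] := ultra_eventually.
have [|z Kz zG] := @ultra_cvg_compact nat G GU X K zz Kc.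
  by apply: nearW => j; case: (Hzz j).
have up j : Phi (zz j) + j.+1%:R * P (zz j) <= Phi z0.
  by have [_ /(_ _ Kz0)] := Hzz j; rewrite Pz0 mulr0 addr0.
have Phiz : Phi z <= Phi z0.
  apply: (cvgr_to_le (cvg_comp _ _ zG (cPhi _ Kz))); apply: nearW => j /=.
  by apply: le_trans (up j); rewrite lerDl mulr_ge0.
have Pz : P z = 0.
  apply/eqP; rewrite eq_le P0 andbT.
  have c1 : (Phi z0 - Phi m) * j.+1%:R^-1 @[j --> G] --> (Phi z0 - Phi m) * 0.
    by apply: cvgM; [exact: cvg_cst|exact: sub_filter_cvg FG (@harmonic_cvg0 R)].
  have c2 : P (zz j) @[j --> G] --> P z by exact: cvg_comp zG (cP _ Kz).
  rewrite mulr0 in c1.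
  have c3 : ((Phi z0 - Phi m) * j.+1%:R^-1 - P (zz j)) @[j --> G] --> 0 - P z by exact: cvgB.
  rewrite -oppr_ge0 -sub0r; apply: (cvgr_to_ge c3); apply: nearW => j.
  rewrite subr_ge0 ler_pdivlMr //.
  have [Kj _] := Hzz j; have := mmin _ Kj; have := up j.
  by rewrite !mul0r !addr0 mulrC; lra.
have zE := uniq _ Kz Pz Phiz; rewrite zE in zG.
have [j Aj] : exists j, A (zz j) by apply: (@filter_ex _ G); exact: zG.
by exists j.+1%:R => //; exists (zz j); have [? ?] := Hzz j; split.
Qed.

Section RowLimits.
Variable R : realType.

Lemma cvg_mx_coord k l (T : Type) (G : set_system T) {FG : Filter G}
    (M : T -> 'M[R]_(k, l)) (M0 : 'M[R]_(k, l)) i j :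
  M @ G --> M0 -> M t i j @[t --> G] --> M0 i j.
Proof. by move=> MM; exact: (cvg_comp _ _ MM (@coord_continuous R k l i j M0)). Qed.

Lemma cvg_mulmx_row k l (T : Type) (G : set_system T) {FG : Filter G}
    (u : T -> 'rV[R]_k) (M : T -> 'M[R]_(k, l)) (u0 : 'rV[R]_k) (M0 : 'M[R]_(k, l)) :
  u @ G --> u0 -> (forall i j, M t i j @[t --> G] --> M0 i j) ->
  u t *m M t @[t --> G] --> u0 *m M0.
Proof.
move=> /cvg_rVP uu MM; apply/cvg_rVP => j.
under eq_fun do rewrite mxE; rewrite mxE.
apply: cvg_big => [|i _]; first exact: add_continuous.
by apply: cvgM; [exact: uu|exact: MM].
Qed.

Lemma hasgrad_partial_l k l (phi : 'rV[R]_(k + l) -> R) x y zeta :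
  hasgrad phi (row_mx x y) zeta ->
  hasgrad (fun w => phi (row_mx w y)) x (lsubmx zeta).
Proof.
move=> H e e0; have [r r0 Hr] := (near_normP _ _).1 (H e e0).
apply/near_normP; exists r => // w wx.
have E : row_mx w y - row_mx x y = row_mx (w - x) 0.
  by rewrite opp_row_mx add_row_mx subrr.
have := Hr (row_mx w y); rewrite E norm_row_mx0 => /(_ wx).
rewrite -{1}[zeta]hsubmxK dotp_row_mx dotp0 addr0 => /le_trans; apply.
by rewrite ler_wpM2l // ltW.
Qed.

Lemma hasgrad_partial_r k l (phi : 'rV[R]_(k + l) -> R) x y zeta :
  hasgrad phi (row_mx x y) zeta ->
  hasgrad (fun w => phi (row_mx x w)) y (rsubmx zeta).
Proof.
move=> H e e0; have [r r0 Hr] := (near_normP _ _).1 (H e e0).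
apply/near_normP; exists r => // w wx.
have E : row_mx x w - row_mx x y = row_mx 0 (w - y).
  by rewrite opp_row_mx add_row_mx subrr.
have := Hr (row_mx x w); rewrite E norm_row_0mx => /(_ wx).
rewrite -{1}[zeta]hsubmxK dotp_row_mx dotp0 add0r => /le_trans; apply.
by rewrite ler_wpM2l // ltW.
Qed.

End RowLimits.

Lemma rsubmx_coord (R : Type) k l1 l2 (M : 'M[R]_(k, l1 + l2)) i j :
  rsubmx M i j = M i (rshift l1 j).
Proof. by rewrite mxE. Qed.

Lemma lsubmx_coord (R : Type) k l1 l2 (M : 'M[R]_(k, l1 + l2)) i j :
  lsubmx M i j = M i (lshift l2 j).
Proof. by rewrite mxE. Qed.

Lemma C1_map_jac (R : realType) d s k (phi : 'rV[R]_(d + s) -> 'rV[R]_k) (T : Type) (G : set_system T)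
    {FG : Filter G} (zt : T -> 'rV[R]_(d + s)) z i j : C1_map phi -> zt @ G --> z ->
  jac phi (zt t) i j @[t --> G] --> jac phi z i j.
Proof.
move=> [_ c] zz; apply: cvg_mx_coord; exact: (cvg_comp _ _ zz (c z)).
Qed.

Lemma C1_map_rjac (R : realType) d s k (phi : 'rV[R]_(d + s) -> 'rV[R]_k)
    (T : Type) (G : set_system T) {FG : Filter G} (zt : T -> 'rV[R]_(d + s)) z i j :
  C1_map phi -> zt @ G --> z ->
  rsubmx (jac phi (zt t)) i j @[t --> G] --> rsubmx (jac phi z) i j.
Proof.
move=> C zz; have H := @C1_map_jac R d s k phi T G FG zt z i (rshift d j) C zz.
have E w : rsubmx (jac phi w) i j = jac phi w i (rshift d j) by exact: rsubmx_coord.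
by rewrite (funext (fun t => E (zt t))) (E z).
Qed.

Lemma C1_map_ljac (R : realType) d s k (phi : 'rV[R]_(d + s) -> 'rV[R]_k)
    (T : Type) (G : set_system T) {FG : Filter G} (zt : T -> 'rV[R]_(d + s)) z i j :
  C1_map phi -> zt @ G --> z ->
  lsubmx (jac phi (zt t)) i j @[t --> G] --> lsubmx (jac phi z) i j.
Proof.
move=> C zz; have H := @C1_map_jac R d s k phi T G FG zt z i (lshift s j) C zz.
have E w : lsubmx (jac phi w) i j = jac phi w i (lshift s j) by exact: lsubmx_coord.
by rewrite (funext (fun t => E (zt t))) (E z).
Qed.

Section LowerLevel.
Variables (R : realType) (d s m n : nat).
Variables (f : 'rV[R]_(d + s) -> R) (g : 'rV[R]_(d + s) -> 'rV[R]_m)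
          (h : 'rV[R]_(d + s) -> 'rV[R]_n).
Hypotheses (f_C1 : C1_fun f) (g_C1 : C1_map g) (h_C1 : C1_map h).
Implicit Types (x : 'rV[R]_d) (y : 'rV[R]_s) (z : 'rV[R]_(d + s)).
Implicit Types (u : 'rV[R]_m) (v : 'rV[R]_n).

Lemma C1_hasgrad z : hasgrad f z (grad f z).
Proof. by apply: hasgrad_diff; case: f_C1. Qed.

Lemma C1_map_hasgrad k (phi : 'rV[R]_(d + s) -> 'rV[R]_k) z i : C1_map phi ->
  hasgrad (fun w => phi w 0 i) z (row i (jac phi z)).
Proof. by move=> [D _]; exact: hasgrad_jac. Qed.

Lemma C1_fun_cvg z : f @ z --> f z.
Proof. exact: hasgrad_cvg (C1_hasgrad z). Qed.

Local Notation V x := (fine (Vfun f g h x)).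

Lemma SsetP x y : Sset f g h x y <->
  Yset g h x y /\ forall y', Yset g h x y' -> f (row_mx x y) <= f (row_mx x y').
Proof.
split=> [[Yy fy]|[Yy fy]]; split => //.
  move=> y' Yy'; rewrite -lee_fin fy; apply: ereal_inf_lbound; by exists y'.
apply/eqP; rewrite eq_le; apply/andP; split.
  by apply: le_ereal_inf_tmp => _ [y' Yy' <-]; rewrite lee_fin fy.
by apply: ereal_inf_lbound; exists y.
Qed.

Lemma Sset_val x y : Sset f g h x y -> V x = f (row_mx x y).
Proof. by move=> [_ <-]. Qed.

Lemma Sset_fin x y : Sset f g h x y -> Vfun f g h x = (V x)%:E.
Proof. by move=> [_ <-]. Qed.

(** Inner semicontinuity of the feasible map at [x] for the point [y]. *)
Definition inner_at x y := forall e : R, 0 < e ->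
  \forall x' \near x, exists2 y', Yset g h x' y' & `|y' - y| < e.

(** Optimality of the limit is compared with the single solution [y0], which feasible points at
    nearby parameters approximate; optimality of [y0] does the rest. *)
Lemma S_limit (T : Type) (G : set_system T) x xt y yt y0 : ProperFilter G ->
  Sset f g h x y0 -> inner_at x y0 -> Yset g h x y ->
  xt @ G --> x -> yt @ G --> y ->
  (\forall t \near G, Sset f g h (xt t) (yt t)) -> Sset f g h x y.
Proof.
move=> GP /SsetP[Yy0 min0] inn Yy xx yy St; apply/SsetP; split => // y' /min0.
apply: le_trans; apply/ler_addgt0Pr => e e0.
have /cvgrPdist_le/(_ _ e0)/near_normP[r r0 Hr] := @C1_fun_cvg (row_mx x y0).
have fz : f (row_mx (xt t) (yt t)) @[t --> G] --> f (row_mx x y).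
  by apply: (cvg_comp _ _ (cvg_row_mx xx yy)); exact: C1_fun_cvg.
apply: (cvgr_to_le fz).
apply: filterS3 St (near_cvg xx (inn r r0)) (near_cvg xx (near_dist x r0)) => t.
move=> /SsetP[_ mint] [y1 Yy1 y1y] xtx; apply: le_trans (mint _ Yy1) _.
have := Hr (row_mx (xt t) y1); rewrite opp_row_mx add_row_mx.
have lt : `|row_mx (xt t - x) (y1 - y0)| < r.
  apply: (@le_lt_trans _ _ (Num.max `|xt t - x| `|y1 - y0|)); last by rewrite gt_max xtx.
  by rewrite norm_row_mx !le_max !lexx orbT.
by move=> /(_ lt); rewrite ler_norml => /andP[]; lra.
Qed.

(** * Solution map and value function over an open set of parameters *)

Section ValueFunction.
Variable N : set 'rV[R]_d.
Hypothesis N_open : forall x, N x -> \forall x' \near x, N x'.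
Hypothesis Y_closed : ultra_closed N (Yset g h).
Hypothesis Y_inner : forall x y, N x -> Sset f g h x y -> inner_at x y.
Hypothesis Y_nonempty : forall x, N x -> Yset g h x !=set0.

Lemma S_nonempty x : N x -> exists y, Sset f g h x y.
Proof.
move=> Nx.
have Yc : compact (Yset g h x).
  rewrite compact_ultra => F FU FY.
  have [y Yy Fy] := @Y_closed _ F x (fun=> x) id FU Nx (cvg_cst _) FY.
  by exists y.
have [|y Yy ymin] := @compact_EVT_min _ R (fun y => f (row_mx x y)) _ (Y_nonempty Nx) Yc.
  apply: continuous_in_subspaceT => y _.
  exact: hasgrad_cvg (hasgrad_partial_r (C1_hasgrad _)).
exists y; apply/SsetP; split; first by move: Yy; rewrite inE.
by move=> y' Yy'; apply: ymin; rewrite inE.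
Qed.

Lemma S_closed : ultra_closed N (Sset f g h).
Proof.
move=> T G x xt yt GU Nx xx St.
have [y0 Sy0] := S_nonempty Nx.
have [|y Yy yy] := Y_closed GU Nx xx (wt := yt).
  by apply: filterS St => t /SsetP[].
by exists y => //; exact: (S_limit _ Sy0 (Y_inner Nx Sy0) Yy xx yy St).
Qed.

Lemma Vfun_fin x : N x -> Vfun f g h x = (V x)%:E.
Proof. by move=> /S_nonempty[y]; exact: Sset_fin. Qed.

(** Along any ultrafilter converging to [x], chosen solutions converge to a solution at [x], so the
    values [f (x', y')] converge to the optimal value. *)
Lemma V_cont x : N x -> {for x, continuous (fun x => V x)}.
Proof.
move=> Nx; apply/(cvgrPdist_le (FF := nbhs_filter x)) => e e0.
apply: (@ultra_near _ _ (nbhs_filter x)) => G GU xG.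
have H x' : exists y, N x' -> Sset f g h x' y.
  by have [/S_nonempty[y Sy]|nN] := pselect (N x'); [exists y|exists 0].
have [yt Hyt] := choice H.
have St : \forall x' \near G, Sset f g h x' (yt x').
  by apply: xG; apply: filterS (N_open Nx) => x' /Hyt.
have [y Sy yy] := S_closed GU Nx (xG : id @ G --> x) St.
have fz : f (row_mx x' (yt x')) @[x' --> G] --> f (row_mx x y).
  apply: (cvg_comp _ _ (cvg_row_mx (xG : id @ G --> x) yy)); exact: C1_fun_cvg.
move/cvgrPdist_le: fz => /(_ e e0); apply: filterS2 St => x' Sx'.
by rewrite (Sset_val Sy) (Sset_val Sx').
Qed.

End ValueFunction.

(** The smooth function [f (., y)] lies above [V] and touches it at [x]; a subgradient of [V] at [x]
    is then one of this function, hence its gradient. *)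
Lemma fixed_frechet x y zeta : Sset f g h x y ->
  (\forall x' \near x, Yset g h x' y) -> (forall x' , Yset g h x' y -> V x' <= f (row_mx x' y)) ->
  frechet_subdiff (fun x => V x) x zeta -> zeta = lsubmx (grad f (row_mx x y)).
Proof.
move=> Sy Yy le Fz.
apply: (@frechet_hasgrad_eq _ _ (fun x' => f (row_mx x' y)) x); last first.
  exact: hasgrad_partial_l (C1_hasgrad _).
move=> e e0; apply: filterS2 (Fz e e0) Yy => x' H /le.
by rewrite -(Sset_val Sy); lra.
Qed.

Lemma W_fixed_closed N : ultra_closed N (Sset f g h) -> ultra_closed N (W_fixed f g h).
Proof.
move=> Sc T G x xt wt GU Nx xx Wt.
have H t : exists y, W_fixed f g h (xt t) (wt t) ->
    Sset f g h (xt t) y /\ wt t = lsubmx (grad f (row_mx (xt t) y)).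
  have [[y Sy wy]|nW] := pselect (W_fixed f g h (xt t) (wt t)); first by exists y.
  by exists 0.
have [yt Hyt] := choice H.
have [|y Sy yy] := Sc T G x xt yt GU Nx xx; first by apply: filterS Wt => t /Hyt[].
exists (lsubmx (grad f (row_mx x y))); first by exists y.
have c : lsubmx (grad f (row_mx (xt t) (yt t))) @[t --> G] --> lsubmx (grad f (row_mx x y)).
  apply: cvg_lsubmx; apply: (cvg_comp _ _ (cvg_row_mx xx yy)).
  by case: f_C1 => _; apply.
by apply: cvg_trans c; apply: near_eq_cvg; apply: filterS Wt => t /Hyt[_ ->].
Qed.

(** Complementarity in a form that makes sense at infeasible points, where the multipliers of a
    penalty live, and that passes to limits. *)
Definition sign_ok z u : Prop :=
  (forall i, 0 <= u 0 i) /\ (forall i, g z 0 i < 0 -> u 0 i = 0).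

Definition residual z u v : 'rV[R]_s :=
  u *m rsubmx (jac g z) + v *m rsubmx (jac h z).

(* Robust dual form of MFCQ. *)
Definition regular z : Prop := exists2 c : R, 0 <= c & \forall w \near z,
  forall u v, sign_ok w u -> `|u| + `|v| <= c * `|residual w u v|.

Lemma near_regular z : regular z -> \forall w \near z, regular w.
Proof.
move=> [c c0 /near_nbhs_nbhs H]; apply: filterS H => w Hw.
by exists c.
Qed.

Lemma g_cvg z i : g w 0 i @[w --> z] --> g z 0 i.
Proof. exact: hasgrad_cvg (C1_map_hasgrad z i g_C1). Qed.

Section Limits.
Variables (T : Type) (G : set_system T).
Hypothesis GU : UltraFilter G.
Variables (zt : T -> 'rV[R]_(d + s)) (z : 'rV[R]_(d + s)).
Hypothesis zz : zt @ G --> z.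

Lemma cvg_residual ut vt u v : ut @ G --> u -> vt @ G --> v ->
  residual (zt t) (ut t) (vt t) @[t --> G] --> residual z u v.
Proof.
have GF : Filter G by typeclasses eauto.
move=> uu vv; apply: cvgD; apply: cvg_mulmx_row => // i j.
  exact: (@C1_map_rjac _ _ _ _ _ _ _ GF).
exact: (@C1_map_rjac _ _ _ _ _ _ _ GF).
Qed.

Lemma sign_ok_limit ut u : ut @ G --> u ->
  (\forall t \near G, sign_ok (zt t) (ut t)) -> sign_ok z u.
Proof.
move=> /cvg_rVP uu ok; split => i.
  by apply: (cvgr_to_ge (uu i)); apply: filterS ok => t [].
move=> gi; apply: (lim_near_cst_real (uu i)).
have e0 : 0 < - g z 0 i by lra.
move: (@g_cvg z i) => /cvgrPdist_lt /(_ _ e0) /(near_cvg zz).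
move=> near_g; apply: filterS2 ok near_g => t [_ ok] gt; apply: ok.
by move: gt; rewrite ltr_norml => /andP[A _]; move: A gi; lra.
Qed.

Lemma multipliers_cvg ut vt r : regular z ->
  (\forall t \near G, sign_ok (zt t) (ut t)) ->
  (\forall t \near G, `|residual (zt t) (ut t) (vt t)| <= r) ->
  exists u v, [/\ ut @ G --> u, vt @ G --> v & sign_ok z u].
Proof.
move=> [c c0 /(near_cvg zz) Hc] ok rr.
have bd : \forall t \near G, `|ut t| + `|vt t| <= c * r.
  apply: filterS3 Hc ok rr => t Hct okt rt; apply: le_trans (Hct _ (vt t) okt) _.
  exact: ler_wpM2l.
have [|u uu] := @ultra_cvg_rV R T G GU m ut (c * r).
  by apply: filterS bd => t; apply: le_trans; rewrite lerDl.
have [|v vv] := @ultra_cvg_rV R T G GU n vt (c * r).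
  by apply: filterS bd => t; apply: le_trans; rewrite lerDr.
by exists u, v; split => //; exact: sign_ok_limit uu ok.
Qed.

End Limits.

Lemma sign_okZ z u (t : R) : 0 <= t -> sign_ok z u -> sign_ok z (t *: u).
Proof.
by move=> t0 [A B]; split => i; rewrite mxE ?mulr_ge0 // => /B ->; rewrite mulr0.
Qed.

Lemma residualZ z u v (t : R) : residual z (t *: u) (t *: v) = t *: residual z u v.
Proof. by rewrite /residual -!scalemxAl scalerDr. Qed.

(** Otherwise normalised multipliers at points tending to (x, y) would have a nonzero limit with
    zero residual. Pairing the residual with the MFCQ direction [xi] makes [u] vanish, and
    independence of the gradients of h makes [v] vanish. *)
Lemma MFCQ_regular x y : Yset g h x y -> MFCQ g h x y -> regular (row_mx x y).
Proof.
move=> [gle _] [hfree [xi [hxi gxi]]]; apply: contrapT => nreg.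
set z := row_mx x y in gle hfree hxi gxi nreg.
have H (j : nat) : exists zuv : 'rV[R]_(d + s) * 'rV[R]_m * 'rV[R]_n,
    [/\ `|zuv.1.1 - z| <= j.+1%:R^-1, sign_ok zuv.1.1 zuv.1.2,
        `|zuv.1.2| + `|zuv.2| = 1 & `|residual zuv.1.1 zuv.1.2 zuv.2| <= j.+1%:R^-1].
  have nC : ~ (\forall w \near z, forall u v, sign_ok w u ->
      `|u| + `|v| <= j.+1%:R * `|residual w u v|).
    by move=> nr; apply: nreg; exists j.+1%:R.
  have j0 : 0 < j.+1%:R^-1 :> R by rewrite invr_gt0.
  have [w wz /existsNP[u /existsNP[v /not_implyP[ok /negP]]]] := not_near_seq nC j0.
  rewrite -ltNge => lt; pose t := `|u| + `|v|.
  have t0 : 0 < t by apply: le_lt_trans lt; rewrite mulr_ge0.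
  have ti : 0 <= t^-1 by rewrite invr_ge0 ltW.
  exists (w, t^-1 *: u, t^-1 *: v); split => /=.
  - exact: ltW.
  - exact: sign_okZ.
  - by rewrite !normrZ ger0_norm // -mulrDr -/t mulVf // gt_eqF.
  - rewrite residualZ normrZ ger0_norm // mulrC ler_pdivrMr // mulrC.
    by rewrite ler_pdivlMr // mulrC ltW.
have [F HF] := choice H.
have [G GU FG] := ultra_eventually.
have zz : (F j).1.1 @[j --> G] --> z.
  by apply: cvg_dist_harmonic => // j; case: (HF j).
have [|u uu] := @ultra_cvg_rV R nat G GU m (fun j => (F j).1.2) 1.
  by apply: nearW => j; have [_ _ <- _] := HF j; rewrite lerDl.
have [|v vv] := @ultra_cvg_rV R nat G GU n (fun j => (F j).2) 1.
  by apply: nearW => j; have [_ _ <- _] := HF j; rewrite lerDr.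
have [u0 ug] : sign_ok z u.
  by apply: (sign_ok_limit GU zz uu); apply: nearW => j; case: (HF j).
have nuv : `|u| + `|v| = 1.
  have c : `|(F j).1.2| + `|(F j).2| @[j --> G] --> `|u| + `|v|.
    by apply: cvgD; exact: cvg_norm.
  by apply: (lim_near_cst_real c); apply: nearW => j; case: (HF j).
have res0 : residual z u v = 0.
  have c := cvg_residual GU zz uu vv.
  apply: (@cvg_unique _ _ _ _ _ _ c) => //.
  apply: (@cvg_dist_harmonic R 'rV[R]_s) => // j.
  by rewrite subr0; case: (HF j).
have uz : u = 0.
  have : dotp (residual z u v) xi = 0 by rewrite res0 dot0p.
  rewrite /residual dotpDl !mulmx_dotp.
  have -> : xi *m (rsubmx (jac h z))^T = 0.
    by apply: trmx_inj; rewrite trmx_mul trmxK hxi trmx0.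
  rewrite dotp0 addr0 /dotp => sum0.
  have E i : (xi *m (rsubmx (jac g z))^T) 0 i = dotp (row i (rsubmx (jac g z))) xi.
    by rewrite dotpC !mxE; apply: eq_bigr => k _; rewrite !mxE.
  have le i : u 0 i * (xi *m (rsubmx (jac g z))^T) 0 i <= 0.
    have [gi|gi] := ltP (g z 0 i) 0; first by rewrite ug // mul0r.
    rewrite E mulr_ge0_le0 // ltW // gxi //; apply/eqP.
    by rewrite eq_le gi gle.
  apply/rowP => i; rewrite mxE.
  have : u 0 i * (xi *m (rsubmx (jac g z))^T) 0 i = 0.
    apply/eqP; rewrite -oppr_eq0; move: i isT.
    have : \sum_i - (u 0 i * (xi *m (rsubmx (jac g z))^T) 0 i) == 0.
      by rewrite sumrN sum0 oppr0.
    rewrite psumr_eq0 => [/allP A i _|i _]; last by rewrite oppr_ge0.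
    by apply: (implyP (A i _)) => //; rewrite mem_index_enum.
  have [gi|gi] := ltP (g z 0 i) 0; first by rewrite ug.
  move/eqP; rewrite E mulf_eq0 => /orP[/eqP //|/eqP D].
  have : dotp (row i (rsubmx (jac g z))) xi < 0.
    by apply: gxi; apply/eqP; rewrite eq_le gi gle.
  by rewrite D ltxx.
have vz : v = 0.
  move: res0; rewrite /residual uz mul0mx add0r => v0.
  by apply: (row_free_inj hfree); rewrite v0 mul0mx.
by move: nuv; rewrite uz vz !normr0 addr0 => /eqP; rewrite eq_sym oner_eq0.
Qed.

Definition gplus z : 'rV[R]_m := \row_i Num.max (g z 0 i) 0.

Definition violation z : R :=
  \sum_i Num.max (g z 0 i) 0 ^+ 2 + \sum_j h z 0 j ^+ 2.

Lemma violation_ge0 z : 0 <= violation z.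
Proof. by rewrite addr_ge0 // sumr_ge0 // => i _; rewrite sqr_ge0. Qed.

Lemma violation_eq0 z : violation z = 0 <->
  (forall i, g z 0 i <= 0) /\ h z = 0.
Proof.
split=> [/eqP|[g0 h0]]; last first.
  rewrite /violation h0 !big1 ?addr0 // => i _; rewrite ?mxE ?expr0n //=.
  by rewrite (max_idPr (g0 i)) expr0n.
rewrite paddr_eq0 ?sumr_ge0 // => [|i _|i _]; rewrite ?sqr_ge0 //.
move=> /andP[]; rewrite !psumr_eq0 => [/allP A /allP B|i _|i _]; rewrite ?sqr_ge0 //.
split=> [i|].
  have := A i (mem_index_enum i); rewrite sqrf_eq0 => /eqP <-.
  by rewrite le_max lexx.
apply/rowP => j; have := B j (mem_index_enum j); rewrite sqrf_eq0 mxE => /eqP //.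
Qed.

(** The y-gradient of [violation] is twice the residual of [gplus] and [h]. The present fact makes
    [regular] applicable to it, so that this gradient dominates the size of the violation. *)
Lemma sign_ok_gplus z (t : R) : 0 <= t -> sign_ok z (t *: gplus z).
Proof.
move=> t0; apply: sign_okZ => //; split => i; rewrite mxE.
  by rewrite le_max lexx orbT.
by move=> gi; rewrite (max_idPr (ltW gi)).
Qed.

Lemma hasgrad_violation z :
  hasgrad violation z (2 *: (gplus z *m jac g z + h z *m jac h z)).
Proof.
rewrite scalerDr !mulmx_sum_row !scaler_sumr; apply: hasgradD.
  apply: hasgrad_sum => i _; rewrite scalerA /gplus mxE.
  exact: hasgrad_sqr_max0 (C1_map_hasgrad z i g_C1).
apply: hasgrad_sum => i _; rewrite scalerA.
exact: hasgrad_sqr (C1_map_hasgrad z i h_C1).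
Qed.

Lemma sqrt_violation_le z :
  Num.sqrt (violation z) <= (m + n).+1%:R * (`|gplus z| + `|h z|).
Proof.
have a0 := normr_ge0 (gplus z); have b0 := normr_ge0 (h z).
have N0 : 0 <= (m + n).+1%:R * (`|gplus z| + `|h z|) by rewrite mulr_ge0 // addr_ge0.
rewrite -[leRHS]ger0_norm // -sqrtr_sqr ler_wsqrtr //.
have s2 : violation z <= (m + n)%:R * (`|gplus z| + `|h z|) ^+ 2.
  rewrite natrD mulrDl; apply: lerD.
    rewrite -[X in X%:R]card_ord mulr_natl -sumr_const; apply: ler_sum => i _.
    rewrite ler_sqr ?nnegrE ?addr_ge0 ?le_max ?lexx ?orbT //.
    have := norm_coord (gplus z) i; rewrite mxE => /(le_trans (ler_norm _)) H.
    by apply: le_trans H _; rewrite lerDl.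
  rewrite -[X in X%:R]card_ord mulr_natl -sumr_const; apply: ler_sum => i _.
  rewrite -real_normK ?num_real // ler_sqr ?nnegrE ?addr_ge0 //.
  by apply: le_trans (norm_coord (h z) i) _; rewrite lerDr.
apply: le_trans s2 _; rewrite exprMn ler_wpM2r ?sqr_ge0 //.
by rewrite -natrX ler_nat expnS expn1 mulSn (leq_trans (leqnSn _)) // leq_addr.
Qed.

(** For x' near [x], minimise the root of the violation plus [delta * |y' - y|] on a small ball. A
    minimiser with positive violation would have a gradient too small for the bound in [regular], so
    the minimiser is feasible. *)
Lemma regular_inner x y : Yset g h x y -> regular (row_mx x y) -> inner_at x y.
Proof.
move=> Yy [c c0 /near_normP[rho rho0 Hc]] e e0.
pose e1 := Num.min e rho / 2.
have m0 : 0 < Num.min e rho by rewrite lt_min e0.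
have e10 : 0 < e1 by rewrite divr_gt0.
have me : Num.min e rho <= e by rewrite ge_min lexx.
have mr : Num.min e rho <= rho by rewrite ge_min lexx orbT.
have e1e : e1 < e by rewrite /e1; lra.
have e1r : e1 < rho by rewrite /e1; lra.
pose C := (m + n).+1%:R * c.
have C0 : 0 <= C by rewrite mulr_ge0.
(* This gives [C * delta <= 1/2]. Regularity yields [q <= C * |residual|], while minimality yields
   [2 * |residual| <= 3 * q * delta]; together [q] is at most three quarters of itself. *)
pose delta := (2 * (C + 1))^-1.
have delta0 : 0 < delta by rewrite invr_gt0 mulr_gt0 // ltr_wpDl.
have Cdelta : C * delta <= 2^-1.
  rewrite /delta invfM mulrCA -[leRHS]mulr1 ler_wpM2l ?invr_ge0 //.
  by rewrite ler_pdivrMr ?ltr_wpDl // mul1r lerDl.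
have vz : violation (row_mx x y) = 0 by apply/violation_eq0.
(* Below this threshold the value of [Psi] at [y] is less than [delta * e1], which keeps the
   minimiser off the boundary of the ball. *)
have d2 : 0 < (delta * e1) ^+ 2 by rewrite exprn_gt0 // mulr_gt0.
have := hasgrad_cvg (hasgrad_partial_l (hasgrad_violation (row_mx x y))).
rewrite vz => /cvgrPdist_lt /(_ _ d2).
apply: filterS2 (near_dist x rho0) => x' xx'; rewrite sub0r normrN ger0_norm ?violation_ge0 // => vx'.
have sv : Num.sqrt (violation (row_mx x' y)) < delta * e1.
  rewrite -[ltRHS]ger0_norm ?mulr_ge0 ?ltW // -sqrtr_sqr ltr_sqrt //.
pose Psi y' := Num.sqrt (violation (row_mx x' y')) + delta * `|y' - y|.
have vc y' : {for y', continuous (fun y' => violation (row_mx x' y'))}.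
  exact: hasgrad_cvg (hasgrad_partial_r (hasgrad_violation (row_mx x' y'))).
have [||y1 y1K y1min] := @compact_EVT_min _ R Psi _ _ (@compact_ball_rV R s y e1).
- by exists y => /=; rewrite subrr normr0 ltW.
- apply: continuous_in_subspaceT => y' _.
  apply: (@cvgD _ _ _ (nbhs y') (nbhs_filter y')).
    exact: (cvg_comp _ _ (vc y') (@sqrt_continuous R _)).
  apply: (@cvgM _ _ (nbhs y') (nbhs_filter y')); first exact: cvg_cst.
  exact: (cvg_norm (@cvg_subr _ _ y y')).
have y1lt : `|y1 - y| < e1.
  have := y1min y; rewrite inE /= subrr normr0 => /(_ (ltW e10)).
  rewrite /Psi subrr normr0 mulr0 addr0 => P1.
  rewrite -(ltr_pM2l delta0); apply: le_lt_trans sv; apply: le_trans P1.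
  by rewrite lerDr sqrtr_ge0.
exists y1; last exact: lt_trans y1lt e1e.
apply: contrapT => nY.
pose z1 := row_mx x' y1; pose q := Num.sqrt (violation z1).
have q0 : 0 < q.
  rewrite sqrtr_gt0 lt_neqAle violation_ge0 andbT eq_sym; apply/eqP => v0.
  by apply: nY; exact/violation_eq0.
have q2 : q ^+ 2 = violation z1 by rewrite sqr_sqrtr // violation_ge0.
pose sigma := 2 *: residual z1 (gplus z1) (h z1).
have Hs : hasgrad (fun y' => violation (row_mx x' y')) y1 sigma.
  have := hasgrad_partial_r (hasgrad_violation z1).
  by rewrite linearZ linearD /= -!mulmx_rsub.
have qd : 0 < q * delta by rewrite mulr_gt0.
(* No derivative of the square root is taken: [q^2 - q'^2 <= 2 q (q - q')] turns the slope [delta]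
   of the root into slope [2 q delta] of the violation, and the expansion error adds [q delta]. *)
have sle : `|sigma| <= 3 * (q * delta).
  apply: (@grad_le _ _ _ y1); first by rewrite mulr_ge0 // ltW.
  have gap : 0 < e1 - `|y1 - y| by rewrite subr_gt0.
  apply: filterS2 (Hs _ qd) (near_dist y1 gap) => y' Hy' y'y1.
  have yK : `|y' - y| <= e1.
    by rewrite -(subrKA y1); apply: le_trans (ler_normD _ _) _; lra.
  have := y1min y'; rewrite inE => /(_ yK); rewrite /Psi -/z1 -/q => mn.
  pose q' := Num.sqrt (violation (row_mx x' y')).
  have q'2 : q' ^+ 2 = violation (row_mx x' y') by rewrite sqr_sqrtr // violation_ge0.
  have tri : `|y' - y| <= `|y1 - y| + `|y' - y1|.
    by rewrite -(subrKA y1) addrC; exact: ler_normD.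
  have mn' : q - q' <= delta * `|y' - y1|.
    have : delta * `|y' - y| <= delta * (`|y1 - y| + `|y' - y1|) by rewrite ler_wpM2l // ltW.
    by rewrite mulrDr; move: mn; rewrite -/q'; lra.
  move: Hy'; rewrite -q2 -/z1 -q'2 ler_norml => /andP[_ up].
  have : q * (q - q') <= q * (delta * `|y' - y1|) by rewrite ler_wpM2l // ltW.
  have := sqr_ge0 (q - q'); move: up; rewrite !expr2.
  by move: (dotp _ _) `|y' - y1| => D E; lra.
have ok : sign_ok z1 (gplus z1) by rewrite -[gplus z1]scale1r; exact: sign_ok_gplus.
have z1z : `|z1 - row_mx x y| < rho.
  rewrite opp_row_mx add_row_mx; apply: (@le_lt_trans _ _ (Num.max `|x' - x| `|y1 - y|)).
    by rewrite norm_row_mx !le_max !lexx orbT.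
  by rewrite gt_max xx' /=; exact: lt_trans y1lt e1r.
have res : 2 * `|residual z1 (gplus z1) (h z1)| <= 3 * (q * delta).
  by move: sle; rewrite /sigma normrZ ger0_norm.
have := Hc _ z1z _ (h z1) ok.
have := sqrt_violation_le z1; rewrite -/q => h1 h2.
have h3 : q <= C * `|residual z1 (gplus z1) (h z1)|.
  by apply: le_trans h1 _; rewrite /C -mulrA ler_wpM2l.
have h4 : C * (2 * `|residual z1 (gplus z1) (h z1)|) <= C * (3 * (q * delta)).
  exact: ler_wpM2l.
have h5 : q * (C * delta) <= q * 2^-1 by rewrite ler_wpM2l // ltW.
by lra.
Qed.

Lemma KKT_sign_ok x y u v : Yset g h x y -> KKT_multipliers f g h x y (u, v) ->
  sign_ok (row_mx x y) u.
Proof.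
move=> [g0 _] [/= _ u0 gu]; split => // i gi.
have : \sum_i - (g (row_mx x y) 0 i * u 0 i) == 0.
  by rewrite sumrN -/(dotp _ _) gu oppr0.
rewrite psumr_eq0 => [/allP /(_ i (mem_index_enum i))|j _]; last first.
  by rewrite oppr_ge0 mulr_le0_ge0.
by rewrite oppr_eq0 mulf_eq0 lt_eqF //= => /eqP.
Qed.

Lemma sign_ok_KKT x y u v : Yset g h x y -> sign_ok (row_mx x y) u ->
  gradyL f g h (row_mx x y) u v = 0 -> KKT_multipliers f g h x y (u, v).
Proof.
move=> [g0 _] [u0 gu] L0; split => //=.
rewrite /dotp big1 // => i _; have [/gu ->|gi] := ltP (g (row_mx x y) 0 i) 0.
  by rewrite mulr0.
by have -> : g (row_mx x y) 0 i = 0; [apply/eqP; rewrite eq_le gi g0|rewrite mul0r].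
Qed.

Lemma gradyLE z u v : gradyL f g h z u v = rsubmx (grad f z) + residual z u v.
Proof. by rewrite /gradyL /residual addrA. Qed.

(** On the graph of Y near [x] one has f >= V, so the subgradient inequality makes (x, y) a
    minimiser of f minus the linear form of [zeta] plus [e * |x' - x|]. The squared distance makes
    it the unique one, as [penalty_minimizer] requires, and the penalty gradient provides
    multipliers. *)
Lemma approximate_KKT x y zeta (e : R) : Sset f g h x y ->
  (\forall x' \near x, forall y', Yset g h x' y' -> V x' <= f (row_mx x' y')) ->
  frechet_subdiff (fun x => V x) x zeta -> 0 < e ->
  exists z u v, [/\ `|z - row_mx x y| <= e, sign_ok z u &
    `|grad f z - row_mx zeta 0 + (u *m jac g z + v *m jac h z)| <= 4 * e].
Proof.
move=> Sy Vle Fz e0; set zb := row_mx x y.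
have [r r0 Hr] := (near_normP _ _).1 (filterI Vle (Fz e e0)).
pose dist z := dotp (z - zb) (z - zb).
pose psi z := f z - dotp (row_mx zeta 0) (z - zb) + dist z.
pose Phi z := psi z + e * `|lsubmx (z - zb)|.
have [Yy _] := (SsetP x y).1 Sy.
have psi_grad z : hasgrad psi z (grad f z - row_mx zeta 0 + 2 *: (z - zb)).
  apply: hasgradD; last exact: hasgrad_dist2.
  by apply: hasgradB; [exact: C1_hasgrad|exact: hasgrad_dotp].
have r20 : 0 < r / 2 by rewrite divr_gt0.
have me : 0 < Num.min (r / 2) e by rewrite lt_min r20.
have PhiE : Phi zb = f zb.
  have l0 : `|lsubmx (0 : 'rV[R]_(d + s))| = 0.
    have -> : lsubmx (0 : 'rV[R]_(d + s)) = 0 by apply/rowP => i; rewrite !mxE.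
    exact: normr0.
  by rewrite /Phi /psi /dist subrr !dotp0 l0 mulr0 !addr0 subr0.
have [|||||||M M0 [z1 [z1K z1A z1min]]] := @penalty_minimizer R _
    [set z | `|z - zb| <= r / 2] Phi violation zb [set z | `|z - zb| < Num.min (r / 2) e]
    (@compact_ball_rV _ _ zb (r / 2)).
- by rewrite /= subrr normr0 ltW.
- move=> z _; apply: (@cvgD _ _ _ (nbhs z) (nbhs_filter z)).
    exact: hasgrad_cvg (psi_grad z).
  apply: (@cvgM _ _ (nbhs z) (nbhs_filter z)); first exact: cvg_cst.
  apply: (@cvg_norm _ _ _ (nbhs z) (nbhs_filter z)).
  apply: (@cvg_lsubmx R d s _ (nbhs z) (nbhs_filter z)).
  exact: cvg_subr.
- by move=> z _; exact: hasgrad_cvg (hasgrad_violation z).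
- exact: violation_ge0.
- exact/violation_eq0.
- move=> z zK vz; rewrite PhiE /Phi /psi /dist => le; apply/eqP; rewrite -subr_eq0 -dotp_eq0 eq_le dotp_ge0 andbT.
  have lx : lsubmx (z - zb) = lsubmx z - x by rewrite linearB /= row_mxKl.
  have zx : `|lsubmx z - x| < r.
    rewrite -lx; apply: le_lt_trans (norm_lsubmx _) _; apply: le_lt_trans zK _; lra.
  have [Hv Hf] := Hr _ zx.
  have Yz : Yset g h (lsubmx z) (rsubmx z).
    by rewrite /Yset /= hsubmxK; exact/violation_eq0.
  move: (Hv _ Yz); rewrite hsubmxK => Vz.
  move: le Hf; rewrite lx -(Sset_val Sy) -lx dotp_lsubmx.
  by lra.
- exact: (near_dist zb me).
exists z1, ((2 * M) *: gplus z1), ((2 * M) *: h z1).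
move: z1A; rewrite /= lt_min => /andP[z1r z1e]; split; first exact: ltW.
  by apply: sign_ok_gplus; rewrite mulr_ge0 // ltW.
(* In the final bound, one [e] is the slope of [e * |x' - x|], one the expansion error, and two come
   from the gradient of the squared distance. *)
pose sigma := grad f z1 - row_mx zeta 0 + 2 *: (z1 - zb)
  + M *: (2 *: (gplus z1 *m jac g z1 + h z1 *m jac h z1)).
have Hs : hasgrad (fun z => psi z + M * violation z) z1 sigma.
  by apply: hasgradD; [exact: psi_grad|apply: hasgradZ; exact: hasgrad_violation].
have sle : `|sigma| <= 2 * e.
  apply: (@grad_le _ _ _ z1); first by rewrite mulr_ge0 // ltW.
  have gap : 0 < r / 2 - `|z1 - zb| by rewrite subr_gt0.
  apply: filterS2 (Hs e e0) (near_dist z1 gap) => z Hz zz1.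
  have zK : `|z - zb| <= r / 2.
    by rewrite -(subrKA z1); apply: le_trans (ler_normD _ _) _; lra.
  have := z1min z zK; rewrite /Phi => mn.
  have tri : `|lsubmx (z - zb)| <= `|lsubmx (z1 - zb)| + `|z - z1|.
    rewrite -(subrKA z1) addrC linearD /=; apply: le_trans (ler_normD _ _) _.
    by rewrite lerD2l norm_lsubmx.
  have : e * `|lsubmx (z - zb)| <= e * (`|lsubmx (z1 - zb)| + `|z - z1|).
    by rewrite ler_wpM2l // ltW.
  rewrite mulrDr; move: Hz; rewrite ler_norml => /andP[_]; lra.
have -> : grad f z1 - row_mx zeta 0 + ((2 * M) *: gplus z1 *m jac g z1
    + (2 * M) *: h z1 *m jac h z1) = sigma - 2 *: (z1 - zb).
  rewrite /sigma -!scalemxAl -scalerDr scalerA [M * 2]mulrC.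
  by rewrite [X in _ = X - _]addrAC addrK.
apply: le_trans (ler_normD _ _) _; rewrite normrN normrZ ger0_norm //; lra.
Qed.

(** Regularity bounds the multipliers of [approximate_KKT] as [e] tends to 0. In the limit equation
    the y-block is the multiplier condition and the x-block is the formula defining [W_moving]. *)
Lemma moving_frechet x y zeta : Sset f g h x y -> regular (row_mx x y) ->
  (\forall x' \near x, forall y', Yset g h x' y' -> V x' <= f (row_mx x' y')) ->
  frechet_subdiff (fun x => V x) x zeta -> W_moving f g h x zeta.
Proof.
move=> Sy reg Vle Fz; set zb := row_mx x y in reg *.
have H (j : nat) : exists zuv : 'rV[R]_(d + s) * 'rV[R]_m * 'rV[R]_n,
    [/\ `|zuv.1.1 - zb| <= j.+1%:R^-1, sign_ok zuv.1.1 zuv.1.2 &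
     `|grad f zuv.1.1 - row_mx zeta 0 + (zuv.1.2 *m jac g zuv.1.1 + zuv.2 *m jac h zuv.1.1)|
        <= 4 * j.+1%:R^-1].
  have j0 : 0 < j.+1%:R^-1 :> R by rewrite invr_gt0.
  by have [z [u [v ?]]] := approximate_KKT Sy Vle Fz j0; exists (z, u, v).
have [F HF] := choice H.
have [G GU FG] := ultra_eventually.
have GF : Filter G by typeclasses eauto.
pose zt j := (F j).1.1; pose ut j := (F j).1.2; pose vt j := (F j).2.
pose rt j := grad f (zt j) - row_mx zeta 0 + (ut j *m jac g (zt j) + vt j *m jac h (zt j)).
have zz : zt @ G --> zb by apply: cvg_dist_harmonic => // j; case: (HF j).
have gz : grad f (zt j) @[j --> G] --> grad f zb.
  by apply: (cvg_comp _ _ zz); case: f_C1 => _; apply.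
have c1 : grad f (zt j) - row_mx zeta 0 @[j --> G] --> grad f zb - row_mx zeta 0.
  exact: (cvgB gz (cvg_cst (row_mx zeta 0 : 'rV[R]_(d + s)))).
have r0 : rt @ G --> (0 : 'rV[R]_(d + s)).
  apply: sub_filter_cvg FG _.
  have c4 : (fun j : nat => 4 * j.+1%:R^-1 : R) @ \oo --> (4 * 0 : R).
    by apply: cvgM; [exact: cvg_cst|exact: harmonic_cvg0].
  rewrite mulr0 in c4.
  apply/cvgrPdist_le => e e0; move/cvgrPdist_le: c4 => /(_ e e0); apply: filterS => j.
  rewrite !sub0r !normrN => K; have [_ _ A] := HF j; apply: le_trans A _.
  exact: le_trans (ler_norm _) K.
have resE j : residual (zt j) (ut j) (vt j) = rsubmx (rt j - (grad f (zt j) - row_mx zeta 0)).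
  by rewrite /rt [X in rsubmx X]addrAC subrr add0r linearD /= -!mulmx_rsub.
have rescvg : residual (zt j) (ut j) (vt j) @[j --> G] -->
    rsubmx (0 - (grad f zb - row_mx zeta 0)).
  by rewrite (funext resE); apply: cvg_rsubmx; exact: (cvgB r0 c1).
have [||u [v [uu vv ok]]] := @multipliers_cvg nat G GU zt zb zz ut vt
    (`|rsubmx (0 - (grad f zb - row_mx zeta 0))| + 1) reg.
- by apply: nearW => j; case: (HF j).
- move/cvgrPdist_le: rescvg => /(_ 1 ltr01); apply: filterS => j; rewrite distrC => K.
  rewrite -[X in `|X| <= _](subrK (rsubmx (0 - (grad f zb - row_mx zeta 0)))) addrC.
  by apply: le_trans (ler_normD _ _) _; rewrite lerD2l.
have rlim : rt @ G --> grad f zb - row_mx zeta 0 + (u *m jac g zb + v *m jac h zb).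
  have c2 : ut j *m jac g (zt j) @[j --> G] --> u *m jac g zb.
    by apply: cvg_mulmx_row => // i j; exact: (@C1_map_jac _ _ _ _ _ _ _ GF).
  have c3 : vt j *m jac h (zt j) @[j --> G] --> v *m jac h zb.
    by apply: cvg_mulmx_row => // i j; exact: (@C1_map_jac _ _ _ _ _ _ _ GF).
  exact: (cvgD c1 (cvgD c2 c3)).
have E : grad f zb + (u *m jac g zb + v *m jac h zb) = row_mx zeta 0.
  apply/eqP; rewrite -subr_eq0 addrAC; apply/eqP.
  exact: (@cvg_unique _ (@norm_hausdorff _ _) _ _ _ _ rlim r0).
have [Yy _] := (SsetP x y).1 Sy.
exists y => //; exists (u, v).
  apply: sign_ok_KKT => //; rewrite gradyLE /residual !mulmx_rsub -!linearD /=.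
  by rewrite E row_mxKr.
by rewrite /= !mulmx_lsub -!linearD /= -addrA E row_mxKl.
Qed.

Lemma W_moving_closed N : ultra_closed N (Sset f g h) ->
  (forall x y, N x -> Sset f g h x y -> regular (row_mx x y)) ->
  ultra_closed N (W_moving f g h).
Proof.
move=> Sc reg T G x xt wt GU Nx xx Wt.
have GF : Filter G by typeclasses eauto.
have H t : exists yuv : 'rV[R]_s * 'rV[R]_m * 'rV[R]_n, W_moving f g h (xt t) (wt t) ->
    [/\ Sset f g h (xt t) yuv.1.1, KKT_multipliers f g h (xt t) yuv.1.1 (yuv.1.2, yuv.2) &
      wt t = lsubmx (grad f (row_mx (xt t) yuv.1.1)) + yuv.1.2 *m lsubmx (jac g (row_mx (xt t) yuv.1.1))
         + yuv.2 *m lsubmx (jac h (row_mx (xt t) yuv.1.1))].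
  have [[y Sy [[u v] K wE]]|nW] := pselect (W_moving f g h (xt t) (wt t)).
    by exists (y, u, v) => _; split.
  by exists (0, 0, 0).
have [F HF] := choice H.
pose yt t := (F t).1.1; pose ut t := (F t).1.2; pose vt t := (F t).2.
have [|y Sy yy] := Sc T G x xt yt GU Nx xx; first by apply: filterS Wt => t /HF[].
set zb := row_mx x y; pose zt t := row_mx (xt t) (yt t).
have zz : zt @ G --> zb by exact: cvg_row_mx.
have gz : grad f (zt j) @[j --> G] --> grad f zb.
  by apply: (cvg_comp _ _ zz); case: f_C1 => _; apply.
have resE : \forall t \near G, residual (zt t) (ut t) (vt t) = - rsubmx (grad f (zt t)).
  apply: filterS Wt => t /HF[_ [/= L _ _] _]; apply/eqP; rewrite -addr_eq0 addrC.
  by rewrite -gradyLE -L.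
have ngz : `|rsubmx (grad f (zt t))| @[t --> G] --> `|rsubmx (grad f zb)|.
  by apply: cvg_norm; exact: cvg_rsubmx.
have [||u [v [uu vv ok]]] := @multipliers_cvg T G GU zt zb zz ut vt
    (`|rsubmx (grad f zb)| + 1) (reg _ _ Nx Sy).
- by apply: filterS Wt => t /HF[/SsetP[Yy _] K _]; exact: KKT_sign_ok K.
- move/cvgrPdist_le: ngz => /(_ 1 ltr01); apply: filterS2 resE => t ->.
  by rewrite ler_norml normrN => /andP[A _]; move: A; lra.
have [Yy _] := (SsetP x y).1 Sy.
exists (lsubmx (grad f zb) + u *m lsubmx (jac g zb) + v *m lsubmx (jac h zb)).
  exists y => //; exists (u, v) => //; apply: sign_ok_KKT => //; rewrite gradyLE.
  have c := cvg_residual GU zz uu vv.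
  have c' : residual (zt t) (ut t) (vt t) @[t --> G] --> - rsubmx (grad f zb).
    have c2 : - rsubmx (grad f (zt t)) @[t --> G] --> - rsubmx (grad f zb).
      by apply: cvgN; exact: cvg_rsubmx.
    by apply: cvg_trans c2; apply: near_eq_cvg; apply: filterS resE => t ->.
  by rewrite (@cvg_unique _ (@norm_hausdorff _ _) _ _ _ _ c c') subrr.
have c : lsubmx (grad f (zt t)) + ut t *m lsubmx (jac g (zt t)) + vt t *m lsubmx (jac h (zt t)) @[t --> G] -->
   lsubmx (grad f zb) + u *m lsubmx (jac g zb) + v *m lsubmx (jac h zb).
  apply: cvgD; first (apply: cvgD; first exact: cvg_lsubmx).
    apply: cvg_mulmx_row => // i j; exact: (@C1_map_ljac _ _ _ _ _ _ _ GF).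
  apply: cvg_mulmx_row => // i j; exact: (@C1_map_ljac _ _ _ _ _ _ _ GF).
by apply: cvg_trans c; apply: near_eq_cvg; apply: filterS Wt => t /HF[_ _ ->].
Qed.

(* What the two alternatives on the lower level have in common near xs. *)
Definition value_function_regular (N : set 'rV[R]_d) (W : 'rV[R]_d -> set 'rV[R]_d) :=
  [/\ forall x, N x -> \forall x' \near x, N x',
      forall x, N x -> {for x, continuous (fun x => V x)},
      forall x w, N x -> frechet_subdiff (fun x => V x) x w -> W x w,
      ultra_closed N W &
      forall x, N x -> Vfun f g h x = (V x)%:E].

Lemma fixed_regular xs ys : Sset f g h xs ys -> Y_constant_compact g h ->
  value_function_regular setT (W_fixed f g h).
Proof.
move=> /SsetP[Yys _] [Y0 [Y0c YE]].
have N_open (x : 'rV[R]_d) : setT x -> \forall x' \near x, setT x'.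
  by move=> _; apply/near_normP; exists 1.
have Yc : ultra_closed setT (Yset g h).
  move=> T G x xt yt GU _ xx Yt; rewrite YE; apply: (ultra_cvg_compact GU Y0c).
  by apply: filterS Yt => t; rewrite YE.
have inn x y : setT x -> Sset f g h x y -> inner_at x y.
  move=> _ /SsetP[Yy _] e e0; apply/near_normP; exists 1 => // x' _; exists y.
    by rewrite YE -(YE x).
  by rewrite subrr normr0.
have ne (x : 'rV[R]_d) : setT x -> Yset g h x !=set0.
  by move=> _; exists ys; rewrite YE -(YE xs).
have fin := Vfun_fin Yc ne.
split => //.
- exact: V_cont.
- move=> x w _ Fw; have [y Sy] := S_nonempty Yc ne (I : setT x).
  exists y => //; apply/esym; apply: (fixed_frechet Sy _ _ Fw).
    apply/near_normP; exists 1 => // x' _; rewrite YE -(YE x).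
    by have [] := (SsetP x y).1 Sy.
  move=> x' Yy; rewrite -lee_fin -fin //; apply: ereal_inf_lbound; by exists y.
- by apply: W_fixed_closed => //; exact: S_closed.
Qed.

Lemma moving_Y_limit (U : set 'rV[R]_d) (T : Type) (G : set_system T) x xt
    (yt : T -> 'rV[R]_s) : UltraFilter G ->
  bounded_set (\bigcup_(x' in U) Yset g h x') -> (\forall x' \near x, U x') ->
  xt @ G --> x -> (\forall t \near G, Yset g h (xt t) (yt t)) ->
  exists2 y, Yset g h x y & yt @ G --> y.
Proof.
move=> GU [M0 [_ HM]] Ux xx Yt.
have [|y yy] := @ultra_cvg_rV R T G GU s yt (M0 + 1).
  apply: filterS2 Yt (near_cvg xx Ux) => t Yyt Uxt.
  by apply: (HM (M0 + 1)); rewrite ?ltrDl //; exists (xt t).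
have zz : row_mx (xt t) (yt t) @[t --> G] --> row_mx x y by exact: cvg_row_mx.
exists y => //; split.
  move=> i; have c := cvg_comp _ _ zz (hasgrad_cvg (C1_map_hasgrad (row_mx x y) i g_C1)).
  by apply: (cvgr_to_le c); apply: filterS Yt => t [/(_ i)].
apply/rowP => i; rewrite mxE.
have c := cvg_comp _ _ zz (hasgrad_cvg (C1_map_hasgrad (row_mx x y) i h_C1)).
by apply: (lim_near_cst_real c); apply: filterS Yt => t [_ /= ->]; rewrite mxE.
Qed.

Lemma moving_regular xs ys : Sset f g h xs ys -> Y_uniformly_bounded g h xs ->
  (forall y, Sset f g h xs y -> MFCQ g h xs y) ->
  exists2 N, N xs & value_function_regular N (W_moving f g h).
Proof.
move=> Sys [U [nU Ub]] mfcq.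
have reg_xs y : Sset f g h xs y -> regular (row_mx xs y).
  move=> Sy; have [Yy _] := (SsetP xs y).1 Sy.
  by apply: MFCQ_regular => //; exact: mfcq.
have [Yys _] := (SsetP xs ys).1 Sys.
have inn_xs : inner_at xs ys by apply: regular_inner => //; exact: reg_xs.
pose Q x := [/\ U x, Yset g h x !=set0 &
  forall y, Sset f g h x y -> regular (row_mx x y)].
have nQ : \forall x \near xs, Q x.
  have ne : \forall x \near xs, Yset g h x !=set0.
    by apply: filterS (inn_xs 1 ltr01) => x [y Yy _]; exists y.
  (* Solutions at which regularity fails, for parameters tending to [xs], would converge to a
     solution at [xs]; regularity there persists in a neighbourhood, a contradiction. *)
  suff nreg : \forall x \near xs, forall y, Sset f g h x y -> regular (row_mx x y).
    by apply: filterS3 nU ne nreg => x; split.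
  apply: (@ultra_near _ _ (nbhs_filter xs)) => G GU xsG.
  apply: contrapT => /(ultra_not GU) bad.
  have GF : Filter G by typeclasses eauto.
  have H x : exists y, ~ (forall y, Sset f g h x y -> regular (row_mx x y)) ->
      Sset f g h x y /\ ~ regular (row_mx x y).
    have [?|/existsNP[y /not_implyP[? ?]]] := pselect (forall y, Sset f g h x y -> regular (row_mx x y)).
      by exists 0.
    by exists y.
  have [yt Hyt] := choice H.
  have St : \forall x \near G, Sset f g h x (yt x).
    by apply: filterS bad => x /Hyt[].
  have idc : id @ G --> xs by exact: xsG.
  have [|y Yy yy] := @moving_Y_limit U _ G xs id yt GU Ub nU idc.
    by apply: filterS St => x /SsetP[].
  have Sy : Sset f g h xs y.
    by apply: (S_limit _ Sys inn_xs Yy idc yy St); typeclasses eauto.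
  have zz : row_mx (id x) (yt x) @[x --> G] --> row_mx xs y by exact: cvg_row_mx.
  have [x [/Hyt[_ nr] r]] := near_ex2 bad (near_cvg zz (near_regular (reg_xs _ Sy))).
  exact: nr.
(* Taking the interior of [Q] gives an open set of parameters. *)
pose N x := \forall x' \near x, Q x'.
have NQ x : N x -> Q x by exact: nbhs_singleton.
have N_open x : N x -> \forall x' \near x, N x' by exact: near_nbhs_nbhs.
exists N => //.
have Yc : ultra_closed N (Yset g h).
  move=> T G x xt yt GU Nx xx Yt; apply: (moving_Y_limit GU Ub _ xx Yt).
  by apply: filterS Nx => x' [].
have reg x y : N x -> Sset f g h x y -> regular (row_mx x y).
  by move=> /NQ[_ _]; apply.
have inn x y : N x -> Sset f g h x y -> inner_at x y.
  move=> Nx Sy; have [Yy _] := (SsetP x y).1 Sy.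
  by apply: regular_inner => //; exact: reg.
have ne x : N x -> Yset g h x !=set0 by move=> /NQ[].
have fin := Vfun_fin Yc ne.
have Sc := S_closed Yc inn ne.
split => //.
- exact: (V_cont N_open Yc inn ne).
- move=> x w Nx Fw; have [y Sy] := S_nonempty Yc ne Nx.
  apply: (moving_frechet Sy (reg _ _ Nx Sy) _ Fw).
  apply: filterS (N_open _ Nx) => x' Nx' y' Yy'.
  by rewrite -lee_fin -fin //; apply: ereal_inf_lbound; exists y'.
- exact: W_moving_closed.
Qed.

Lemma lower_level_regular xs ys W : Sset f g h xs ys ->
  (Y_constant_compact g h /\ W = W_fixed f g h)
     \/ ((Y_uniformly_bounded g h xs /\
          (forall y, Sset f g h xs y -> MFCQ g h xs y))
         /\ W = W_moving f g h) ->
  exists2 N, N xs & value_function_regular N W.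
Proof.
move=> Sys [[Yc ->]|[[Yb M] ->]]; last exact: moving_regular Sys Yb M.
by exists setT => //; exact: fixed_regular Sys Yc.
Qed.

End LowerLevel.

(** * Penalization of complementarity constraints *)

(** The squared positive part is bounded above by its tangent of slope [l] plus a quadratic term,
    which calmness of [th] makes negligible. Minimality then passes to the linearised term
    [l * th]. *)
Lemma frechet_sqr_max0 (R : realType) k (th psi : 'rV[R]_k -> R) z sigma (M C : R) :
  0 < M -> 0 <= C ->
  (\forall w \near z, `|th w - th z| <= C * `|w - z|) -> hasgrad psi z sigma ->
  (\forall w \near z, psi z + M * Num.max (th z) 0 ^+ 2 <=
     psi w + M * Num.max (th w) 0 ^+ 2) ->
  let l := 2 * M * Num.max (th z) 0 in
  exists zeta, sigma + l *: zeta = 0 /\ (l != 0 -> frechet_subdiff th z zeta).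
Proof.
move=> M0 C0 HC Hs Hmin; set l := 2 * M * _.
have l0 : 0 <= l by rewrite !mulr_ge0 ?(ltW M0) // le_max lexx orbT.
have key : frechet_subdiff (fun w => l * th w) z (- sigma).
  move=> e e0; have e20 : 0 < e / 2 by rewrite divr_gt0.
  have d0 : 0 < e / 2 / (M * C ^+ 2 + 1).
    by rewrite divr_gt0 // ltr_wpDl // mulr_ge0 ?sqr_ge0 // ltW.
  apply: filterS2 (filterI HC (Hs _ e20)) (filterI Hmin (near_dist z d0)) => w [A B] [D N].
  have /andP[_ up] := sqr_max0_bounds (th z) (th w).
  have up' : M * (Num.max (th w) 0 ^+ 2 - Num.max (th z) 0 ^+ 2) <=
      l * (th w - th z) + M * (th w - th z) ^+ 2.
    rewrite /l -(mulrC M 2) -!mulrA -mulrDr ler_pM2l //.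
    by move: up; move: (Num.max _ _) (Num.max _ _) => a b; lra.
  have A2 : M * (th w - th z) ^+ 2 <= e / 2 * `|w - z|.
    have A3 : (th w - th z) ^+ 2 <= C ^+ 2 * `|w - z| ^+ 2.
      by rewrite -exprMn -real_normK ?num_real // ler_sqr ?nnegrE // mulr_ge0.
    apply: (@le_trans _ _ ((M * C ^+ 2) * `|w - z| ^+ 2)).
      by rewrite -mulrA ler_pM2l.
    rewrite [`|w - z| ^+ 2]expr2 mulrA ler_wpM2r //; move: (ltW N).
    rewrite ler_pdivlMr ?ltr_wpDl ?mulr_ge0 ?sqr_ge0 ?(ltW M0) // => /(le_trans _); apply.
    by rewrite mulrC ler_wpM2l // lerDl ler01.
  move: B D up' A2; rewrite ler_norml dotpNl => /andP[_ B].
  move: (Num.max (th w) 0) (Num.max (th z) 0) (dotp _ _) B => a b c.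
  by rewrite -mulrBr mulrBr; lra.
(* If [l] is 0 then [l * th] is constant, which forces [sigma = 0] and leaves [zeta] arbitrary;
   otherwise one divides by [l]. *)
rewrite /=; have [l_eq0|l_neq0] := eqVneq l 0.
  exists 0; split => //; rewrite scaler0 addr0.
  have c0 := hasgrad_cst 0 z; apply: oppr_inj; rewrite oppr0.
  apply: frechet_hasgrad_eq c0; apply: frechet_ext key => w.
  by rewrite l_eq0 mul0r.
have lp : 0 < l by rewrite lt_neqAle eq_sym l_neq0.
exists (- (l^-1 *: sigma)); split.
  by rewrite scalerN scalerA divff // scale1r subrr.
move=> _ e e0; apply: filterS (key (l * e) (mulr_gt0 lp e0)) => w.
rewrite !dotpNl dotpZl -mulrBr -mulrA -mulrN => K.
rewrite -(ler_pM2l lp); apply: le_trans K _.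
by rewrite !opprK [leRHS]mulrDr mulrA divff // mul1r.
Qed.

Section Complementarity.
Variable R : realType.
Implicit Types a b : R.

(* Squared distance of (a, b) to the half-axis {a >= 0, b = 0} if t, and to
   {a = 0, b >= 0} otherwise. *)
Definition branch (t : bool) a b :=
  if t then Num.max (- a) 0 ^+ 2 + b ^+ 2 else a ^+ 2 + Num.max (- b) 0 ^+ 2.

(** Squared Euclidean distance to the complementarity set. As a minimum of two differentiable
    functions it can be replaced at a minimiser by an active branch. *)
Definition complementarity a b := Num.min (branch true a b) (branch false a b).

Lemma complementarity_le t a b : complementarity a b <= branch t a b.
Proof. by case: t; rewrite /complementarity ge_min lexx ?orbT. Qed.

Lemma complementarity_branch a b : exists t, complementarity a b = branch t a b.
Proof.
rewrite /complementarity; case: (leP (branch true a b)) => _; first by exists true.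
by exists false.
Qed.

Lemma branch_ge0 t a b : 0 <= branch t a b.
Proof. by case: t; rewrite addr_ge0 ?sqr_ge0. Qed.

Lemma complementarity_ge0 a b : 0 <= complementarity a b.
Proof. by rewrite /complementarity le_min !branch_ge0. Qed.

Lemma complementarity_eq0 a b : complementarity a b = 0 ->
  [/\ 0 <= a, 0 <= b & a * b = 0].
Proof.
have sq0 (x y : R) : x ^+ 2 + y ^+ 2 = 0 -> x = 0 /\ y = 0.
  move=> /eqP; rewrite paddr_eq0 ?sqr_ge0 // !sqrf_eq0 => /andP[/eqP -> /eqP ->].
  by [].
have m0 (x : R) : Num.max (- x) 0 = 0 -> 0 <= x.
  by move=> E; rewrite -oppr_le0 -E le_max lexx.
have [t ->] := complementarity_branch a b; case: t => /sq0[A B].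
  by rewrite B mulr0 lexx m0.
by rewrite A mul0r lexx m0.
Qed.

Lemma complementarity0 a b : 0 <= a -> 0 <= b -> a * b = 0 -> complementarity a b = 0.
Proof.
move=> a0 b0 /eqP; rewrite mulf_eq0 => ab; apply/eqP.
rewrite eq_le complementarity_ge0 andbT.
by case/orP: ab => /eqP E; [have := complementarity_le false a b|have := complementarity_le true a b];
  rewrite /branch E expr0n max_r ?oppr_le0 // expr0n addr0.
Qed.

(** Half the partial derivatives of [branch t], in a here and in b below: the displacement from the
    nearest point of the half-axis. *)
Definition branch_slope_l (t : bool) a := if t then - Num.max (- a) 0 else a.
Definition branch_slope_r (t : bool) b := if t then b else - Num.max (- b) 0.

(** Origin of the M-sign pattern: the displacement from a nearest point of the complementarity set
    is normal to one half-axis or lies in the nonpositive quadrant. The strict inequalities say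
    which slope vanishes away from the biactive case. *)
Lemma branch_slopes t a b : complementarity a b = branch t a b ->
  [/\ branch_slope_l t a = 0 \/ branch_slope_r t b = 0 \/
        (branch_slope_l t a <= 0 /\ branch_slope_r t b <= 0),
      `|b| < a -> branch_slope_l t a = 0 & `|a| < b -> branch_slope_r t b = 0].
Proof.
have key (x y : R) : branch true x y <= branch false x y ->
    [/\ 0 <= x \/ x <= 0 /\ y <= 0, `|y| < x -> 0 <= x & ~ `|x| < y].
  rewrite /branch => le; split; last 2 first.
  - by move=> yx; rewrite (le_trans (normr_ge0 y)) // ltW.
  - move=> xy; move: le; rewrite leNgt => /negP; apply.
    have y0 : 0 < y by apply: le_lt_trans xy.
    rewrite [Num.max (- y) 0]max_r ?oppr_le0 ?(ltW y0) // expr0n addr0.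
    apply: (@lt_le_trans _ _ (y ^+ 2)); last by rewrite lerDr sqr_ge0.
    by rewrite -(real_normK (num_real x)) ltr_sqr ?nnegrE // ltW.
  have [x0|x0] := leP 0 x; [by left|right; split; first exact: ltW].
  rewrite leNgt; apply/negP => y0; move: le; rewrite max_l ?oppr_ge0 ?(ltW x0) //.
  rewrite [Num.max (- y) 0]max_r ?oppr_le0 ?(ltW y0) // sqrrN expr0n addr0.
  by rewrite gerDl leNgt exprn_gt0.
have slope0 (x : R) : 0 <= x -> - Num.max (- x) 0 = 0 by move=> x0; rewrite max_r ?oppr0 ?oppr_le0.
have slope (x : R) : x <= 0 -> - Num.max (- x) 0 = x by move=> x0; rewrite max_l ?opprK ?oppr_ge0.
move=> E; have := complementarity_le true a b; have := complementarity_le false a b.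
rewrite E {E} /branch_slope_l /branch_slope_r; case: t => [/key + _|_].
  move=> [P Q N]; split; [|by move=> /Q /slope0|by move=> /N].
  by case: P => [/slope0 ->|[a0 b0]]; [left|right; right; rewrite slope].
have -> : branch false a b = branch true b a by rewrite /branch addrC.
have -> : branch true a b = branch false b a by rewrite /branch addrC.
move=> /key[P Q N]; split; [|by move=> /N|by move=> /Q /slope0].
by case: P => [/slope0 ->|[b0 a0]]; [right; left|right; right; rewrite slope].
Qed.

Lemma hasgrad_branch k (fa fb : 'rV[R]_k -> R) z ga gb t :
  hasgrad fa z ga -> hasgrad fb z gb ->
  hasgrad (fun w => branch t (fa w) (fb w)) z
    (2 *: (branch_slope_l t (fa z) *: ga + branch_slope_r t (fb z) *: gb)).
Proof.
move=> Ha Hb; rewrite scalerDr !scalerA; case: t; apply: hasgradD.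
- have := hasgrad_sqr_max0 (hasgradN Ha); rewrite /= scalerN -scaleNr -mulrN.
  exact.
- exact: hasgrad_sqr.
- exact: hasgrad_sqr.
- have := hasgrad_sqr_max0 (hasgradN Hb); rewrite /= scalerN -scaleNr -mulrN.
  exact.
Qed.

Lemma complementarity_continuous k (fa fb ga' gb' : _) :
  (forall z : 'rV[R]_k, hasgrad fa z (ga' z)) -> (forall z, hasgrad fb z (gb' z)) ->
  continuous (fun z => complementarity (fa z) (fb z)).
Proof.
move=> Ha Hb; apply: (@min_fun_continuous _ _ _ (fun z => branch true (fa z) (fb z))).
  by move=> z; exact: hasgrad_cvg (hasgrad_branch true (Ha z) (Hb z)).
by move=> z; exact: hasgrad_cvg (hasgrad_branch false (Ha z) (Hb z)).
Qed.

End Complementarity.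

(** * Approximate multipliers of a program with complementarity constraints *)

Section PenalizedProgram.
Variables (R : realType) (k : nat) (I J K : finType).
Variables (F th : 'rV[R]_k -> R) (cG : I -> 'rV[R]_k -> R) (ce : J -> 'rV[R]_k -> R)
  (ca cb : K -> 'rV[R]_k -> R).
Variables (gG : I -> 'rV[R]_k -> 'rV[R]_k) (ge : J -> 'rV[R]_k -> 'rV[R]_k)
  (ga gb : K -> 'rV[R]_k -> 'rV[R]_k).
Hypotheses (HG : forall i z, hasgrad (cG i) z (gG i z))
  (He : forall j z, hasgrad (ce j) z (ge j z))
  (Ha : forall i z, hasgrad (ca i) z (ga i z))
  (Hb : forall i z, hasgrad (cb i) z (gb i z)).
Variable z0 : 'rV[R]_k.

Definition program_feasible z :=
  [/\ th z <= 0, forall i, cG i z <= 0, forall j, ce j z = 0 &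
      forall i, [/\ 0 <= ca i z, 0 <= cb i z & ca i z * cb i z = 0]].

Let smooth (t : K -> bool) z := \sum_i Num.max (cG i z) 0 ^+ 2 + \sum_j ce j z ^+ 2
  + \sum_i branch (t i) (ca i z) (cb i z).

Let smooth_grad (t : K -> bool) z := \sum_i (2 * Num.max (cG i z) 0) *: gG i z
  + \sum_j (2 * ce j z) *: ge j z
  + \sum_i 2 *: (branch_slope_l (t i) (ca i z) *: ga i z + branch_slope_r (t i) (cb i z) *: gb i z).

Let smoothP t z : hasgrad (smooth t) z (smooth_grad t z).
Proof.
apply: hasgradD; first apply: hasgradD.
- by apply: hasgrad_sum => i _; exact: hasgrad_sqr_max0.
- by apply: hasgrad_sum => i _; exact: hasgrad_sqr.
- by apply: hasgrad_sum => i _; exact: hasgrad_branch.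
Qed.

Let infeasibility z := Num.max (th z) 0 ^+ 2 + (\sum_i Num.max (cG i z) 0 ^+ 2
  + \sum_j ce j z ^+ 2 + \sum_i complementarity (ca i z) (cb i z)).

Let infeasibility_ge0 z : 0 <= infeasibility z.
Proof.
rewrite !addr_ge0 ?sqr_ge0 // sumr_ge0 // => i _; rewrite ?sqr_ge0 //.
exact: complementarity_ge0.
Qed.

Let infeasibility0 z : program_feasible z <-> infeasibility z = 0.
Proof.
split=> [[t0 G0 e0 ab0]|].
  rewrite /infeasibility max_r // expr0n add0r !big1 ?addr0 // => i _.
  - by have [A B C] := ab0 i; exact: complementarity0.
  - by rewrite e0 expr0n.
  - by rewrite max_r ?expr0n.
have sG : 0 <= \sum_i Num.max (cG i z) 0 ^+ 2 by apply: sumr_ge0 => i _; rewrite sqr_ge0.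
have se : 0 <= \sum_j ce j z ^+ 2 by apply: sumr_ge0 => i _; rewrite sqr_ge0.
have sc : 0 <= \sum_i complementarity (ca i z) (cb i z).
  by apply: sumr_ge0 => i _; exact: complementarity_ge0.
have mx (x : R) : Num.max x 0 ^+ 2 == 0 -> x <= 0.
  by rewrite sqrf_eq0 => /eqP <-; rewrite le_max lexx.
move/eqP; rewrite /infeasibility paddr_eq0 ?addr_ge0 ?sqr_ge0 // => /andP[/mx t0].
rewrite paddr_eq0 ?addr_ge0 // => /andP[].
rewrite paddr_eq0 // => /andP[]; rewrite !psumr_eq0 => [/allP A|i _|i _|i _]; rewrite ?sqr_ge0 //; last exact: complementarity_ge0.
move=> /allP B /allP C; split => // i.
- by apply: mx; exact: (A i (mem_index_enum i)).
- by have := B i (mem_index_enum i); rewrite /= sqrf_eq0 => /eqP.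
- by apply: complementarity_eq0; apply/eqP; exact: (C i (mem_index_enum i)).
Qed.

Let infeasibility_cvg z : th @ z --> th z -> infeasibility @ z --> infeasibility z.
Proof.
move=> ct; pose t0 (i : K) := true.
have cm : (fun z => Num.max (th z) 0 ^+ 2) @ z --> Num.max (th z) 0 ^+ 2.
  (* As [th] is merely continuous at z, the squared positive part is composed with it through a
     one-entry row, where the gradient calculus gives continuity. *)
  have h := hasgrad_coord (\row_(j < 1) th z) 0.
  have := hasgrad_cvg (hasgrad_sqr_max0 h); rewrite mxE => c.
  have c2 : (fun w => \row_(j < 1) th w) @ z --> (\row_(j < 1) th z : 'rV[R]_1).
    apply/(@cvg_rVP _ _ _ (nbhs z) (nbhs_filter z)) => i; rewrite mxE.
    by under eq_fun do rewrite mxE.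
  have := cvg_comp _ _ c2 c.
  by rewrite (_ : _ \o _ = (fun z => Num.max (th z) 0 ^+ 2)) //; apply/funext => w /=; rewrite mxE.
apply: (@cvgD _ _ _ (nbhs z) (nbhs_filter z)) => //.
apply: (@cvgD _ _ _ (nbhs z) (nbhs_filter z)).
  apply: (@hasgrad_cvg _ _ _ z).
  apply: hasgradD; first by apply: hasgrad_sum => i _; exact: hasgrad_sqr_max0.
  by apply: hasgrad_sum => i _; exact: hasgrad_sqr.
apply: cvg_big => [|i _]; first exact: add_continuous.
exact: (complementarity_continuous (Ha i) (Hb i)).
Qed.

(* Penalize the constraints together with the splitting w = z, which separates
   the nonsmooth objective F(w) from the nonsmooth constraint th(z) <= 0. *)
Lemma fuzzy_multipliers (eta CF : R) : 0 < eta -> program_feasible z0 ->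
  (\forall z \near z0, program_feasible z -> F z0 <= F z) ->
  (\forall z \near z0, \forall w \near z, `|F w - F z| <= CF * `|w - z|) ->
  (\forall z \near z0, exists2 C : R, 0 <= C &
     \forall w \near z, `|th w - th z| <= C * `|w - z|) ->
  exists w z xi l zeta (lG : I -> R) (lE : J -> R) (mu nu : K -> R),
  [/\ `|w - z0| <= eta /\ `|z - z0| <= eta,
      [/\ frechet_subdiff F w xi, 0 <= l & l != 0 -> frechet_subdiff th z zeta],
      xi + l *: zeta + \sum_i lG i *: gG i z + \sum_j lE j *: ge j z
        + \sum_i (mu i *: ga i z + nu i *: gb i z) = - (2 *: (z - z0)),
      forall i, 0 <= lG i /\ (cG i z <= 0 -> lG i = 0) &
      forall i, [/\ mu i = 0 \/ nu i = 0 \/ (mu i <= 0 /\ nu i <= 0),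
        `|cb i z| < ca i z -> mu i = 0 & `|ca i z| < cb i z -> nu i = 0]].
Proof.
move=> eta0 feas0 lmin calmF calmth.
have [r r0 Hr] := (near_normP _ _).1 (filterI lmin (filterI calmF calmth)).
pose zz0 : 'rV[R]_(k + k) := row_mx z0 z0.
pose Phi (wz : 'rV[R]_(k + k)) := F (lsubmx wz) + dotp (rsubmx wz - z0) (rsubmx wz - z0).
pose P (wz : 'rV[R]_(k + k)) := dotp (rsubmx wz - lsubmx wz) (rsubmx wz - lsubmx wz)
  + infeasibility (rsubmx wz).
pose Kb := [set wz : 'rV[R]_(k + k) | `|wz - zz0| <= r / 2].
have r20 : r / 2 < r by lra.
have Kl wz : Kb wz -> `|lsubmx wz - z0| < r.
  move=> K1; apply: le_lt_trans r20; apply: le_trans K1.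
  have -> : lsubmx wz - z0 = lsubmx (wz - zz0) by rewrite linearB /= row_mxKl.
  exact: norm_lsubmx.
have Kr wz : Kb wz -> `|rsubmx wz - z0| < r.
  move=> K1; apply: le_lt_trans r20; apply: le_trans K1.
  have -> : rsubmx wz - z0 = rsubmx (wz - zz0) by rewrite linearB /= row_mxKr.
  exact: norm_rsubmx.
have cl (z : 'rV[R]_(k + k)) : (fun w => lsubmx w) @ z --> (lsubmx z : 'rV[R]_k).
  exact: (@cvg_lsubmx _ _ _ _ (nbhs z) (nbhs_filter z)).
have cr (z : 'rV[R]_(k + k)) : (fun w => rsubmx w) @ z --> (rsubmx z : 'rV[R]_k).
  exact: (@cvg_rsubmx _ _ _ _ (nbhs z) (nbhs_filter z)).
have me : 0 < Num.min (r / 2) eta by rewrite lt_min divr_gt0.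
have PhiE : Phi zz0 = F z0 by rewrite /Phi row_mxKl row_mxKr subrr dotp0 addr0.
have [|||||||M M0 [wz [wzK wzA wzmin]]] := @penalty_minimizer R _ Kb Phi P zz0
    [set wz | `|wz - zz0| < Num.min (r / 2) eta] (@compact_ball_rV _ _ zz0 (r / 2)).
- by rewrite /Kb /= subrr normr0 divr_ge0 // ltW.
- move=> z /Kl /Hr[_ [cF _]]; apply: (@cvgD _ _ _ (nbhs z) (nbhs_filter z)).
    exact: (cvg_comp _ _ (cl z) (calm_cvg cF)).
  apply: (@cvg_dotp _ _ _ (nbhs z) (nbhs_filter z)).
    by apply: (@cvgB _ _ _ (nbhs z) (nbhs_filter z)); [exact: cr|exact: cvg_cst].
  by apply: (@cvgB _ _ _ (nbhs z) (nbhs_filter z)); [exact: cr|exact: cvg_cst].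
- move=> z /Kr /Hr[_ [_ [C _ ct]]]; apply: (@cvgD _ _ _ (nbhs z) (nbhs_filter z)).
    by apply: (@cvg_dotp _ _ _ (nbhs z) (nbhs_filter z));
      apply: (@cvgB _ _ _ (nbhs z) (nbhs_filter z)); [exact: cr|exact: cl|exact: cr|exact: cl].
  exact: (cvg_comp _ _ (cr z) (infeasibility_cvg (calm_cvg ct))).
- by move=> z; rewrite addr_ge0 ?dotp_ge0.
- rewrite /P row_mxKl row_mxKr subrr dotp0 add0r; exact/infeasibility0.
- move=> z zK /eqP; rewrite paddr_eq0 ?dotp_ge0 // dotp_eq0 subr_eq0 => /andP[/eqP E /eqP].
  move=> /infeasibility0 fz; have [/(_ fz) Fz _] := Hr _ (Kr _ zK).
  rewrite PhiE /Phi -E => le; have : dotp (rsubmx z - z0) (rsubmx z - z0) == 0.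
    by rewrite eq_le dotp_ge0 andbT; lra.
  by rewrite dotp_eq0 subr_eq0 => /eqP e1; rewrite -[z]hsubmxK -E e1.
- exact: (near_dist zz0 me).
have {Kl Kr} [Hw Hz] := (Hr _ (Kl _ wzK), Hr _ (Kr _ wzK)).
pose w := lsubmx wz; pose z := rsubmx wz.
have wzE : wz = row_mx w z by rewrite hsubmxK.
have [wA zA] : `|w - z0| < Num.min (r / 2) eta /\ `|z - z0| < Num.min (r / 2) eta.
  move: wzA; rewrite /= wzE => A; split; apply: le_lt_trans A.
    have -> : w - z0 = lsubmx (row_mx w z - zz0) by rewrite linearB /= !row_mxKl.
    exact: norm_lsubmx.
  have -> : z - z0 = rsubmx (row_mx w z - zz0) by rewrite linearB /= !row_mxKr.
  exact: norm_rsubmx.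
move: (wA) (zA); rewrite !lt_min => /andP[wr we] /andP[zr ze].
have inK w' z' : `|w' - z0| <= r / 2 -> `|z' - z0| <= r / 2 -> Kb (row_mx w' z').
  by move=> A B; rewrite /Kb /= opp_row_mx add_row_mx norm_row_mx A.
have nearK (x : 'rV[R]_k) : `|x - z0| < r / 2 -> \forall x' \near x, `|x' - z0| <= r / 2.
  move=> xr; have gap : 0 < r / 2 - `|x - z0| by rewrite subr_gt0.
  apply: filterS (near_dist x gap) => x' xx'; rewrite -(subrKA x).
  by apply: le_trans (ler_normD _ _) _; lra.
pose xi := - (M *: (2 *: (w - z))).
have Fxi : frechet_subdiff F w xi.
  apply: frechet_min; first exact: hasgradZ (hasgrad_dist2 z w).
  apply: filterS (nearK _ wr) => w' w'r.
  have := wzmin _ (inK _ _ w'r (ltW zr)); rewrite wzE /Phi /P !row_mxKl !row_mxKr.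
  rewrite -[z - w]opprB -[z - w']opprB !dotpNl !(dotpC _ (- _)) !dotpNl !opprK.
  by move: (dotp _ _) (dotp _ _) (dotp _ _) => a b c; lra.
(* The branches active at z are frozen. The resulting smooth penalty majorises the true one and
   agrees with it at z, so z is still a minimiser. *)
have [t Ht] := choice (fun i => complementarity_branch (ca i z) (cb i z)).
pose psi z' := dotp (z' - z0) (z' - z0) + M * (dotp (z' - w) (z' - w) + smooth t z').
have psiP : hasgrad psi z (2 *: (z - z0) + M *: (2 *: (z - w) + smooth_grad t z)).
  apply: hasgradD; first exact: hasgrad_dist2.
  by apply: hasgradZ; apply: hasgradD; [exact: hasgrad_dist2|exact: smoothP].
have [C C0 HC] := Hz.2.2.
have [|zeta [E Fzeta]] := frechet_sqr_max0 M0 C0 HC psiP.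
  apply: filterS (nearK _ zr) => z' z'r.
  have := wzmin _ (inK _ _ (ltW wr) z'r); rewrite wzE /Phi /P !row_mxKl !row_mxKr.
  rewrite /psi /infeasibility /smooth.
  have -> : \sum_i complementarity (ca i z) (cb i z) = \sum_i branch (t i) (ca i z) (cb i z).
    by apply: eq_bigr.
  have : \sum_i complementarity (ca i z') (cb i z') <= \sum_i branch (t i) (ca i z') (cb i z').
    by apply: ler_sum => i _; exact: complementarity_le.
  rewrite -(ler_pM2l M0) !mulrDr.
  move: (dotp (z - w) _) (dotp (z' - w) _) (dotp (z - z0) _) (dotp (z' - z0) _) => a8 a9 a12 a13.
  move: (Num.max (th z) 0 ^+ 2) (Num.max (th z') 0 ^+ 2) (F w) => a10 a11 a14.
  move: (M * \sum_i _) (M * \sum_i _) (M * \sum_i _) (M * \sum_i _) => a1 a2 a3 a4.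
  by move: (M * \sum_i _) (M * \sum_i _) (M * \sum_i _) => a5 a6 a7; lra.
exists w, z, xi, (2 * M * Num.max (th z) 0), zeta, (fun i => M * (2 * Num.max (cG i z) 0)),
  (fun j => M * (2 * ce j z)), (fun i => M * (2 * branch_slope_l (t i) (ca i z))),
  (fun i => M * (2 * branch_slope_r (t i) (cb i z))); split.
- by split; exact: ltW.
- by split => //; rewrite !mulr_ge0 ?(ltW M0) // le_max lexx orbT.
- have S1 : \sum_i (M * (2 * Num.max (cG i z) 0)) *: gG i z =
      M *: \sum_i (2 * Num.max (cG i z) 0) *: gG i z.
    by rewrite scaler_sumr; apply: eq_bigr => i _; rewrite scalerA.
  have S2 : \sum_j (M * (2 * ce j z)) *: ge j z = M *: \sum_j (2 * ce j z) *: ge j z.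
    by rewrite scaler_sumr; apply: eq_bigr => i _; rewrite scalerA.
  have S3 : \sum_i ((M * (2 * branch_slope_l (t i) (ca i z))) *: ga i z +
        (M * (2 * branch_slope_r (t i) (cb i z))) *: gb i z) =
      M *: \sum_i 2 *: (branch_slope_l (t i) (ca i z) *: ga i z +
        branch_slope_r (t i) (cb i z) *: gb i z).
    by rewrite scaler_sumr; apply: eq_bigr => i _; rewrite !scalerDr !scalerA !mulrA.
  rewrite S1 S2 S3; apply/eqP; rewrite -addr_eq0; apply/eqP; rewrite -[RHS]E.
  rewrite /xi /smooth_grad.
  move: (\sum_i _) (\sum_i _) (\sum_i _) => s1 s2 s3.
  by apply/rowP => i; rewrite !mxE; ring.
- move=> i; split; first by rewrite !mulr_ge0 ?(ltW M0) // le_max lexx orbT.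
  by move=> G0; rewrite max_r // !mulr0.
- move=> i; have [A B D] := branch_slopes (Ht i); split.
  + case: A => [->|[->|[A1 A2]]]; [by left; rewrite !mulr0|by right; left; rewrite !mulr0|].
    by right; right; rewrite !pmulr_rle0.
  + by move=> /B ->; rewrite !mulr0.
  + by move=> /D ->; rewrite !mulr0.
Qed.

End PenalizedProgram.

(** * Rank of the constraint gradients *)

(** The rank hypothesis speaks of sequences; as a neighbourhood statement it can be used along any
    filter. *)
Lemma near_seqP (R : realType) (V : normedModType R) (x : V) (Q P : V -> Prop) :
  (forall u : nat -> V, u @ \oo --> x -> (forall k, Q (u k)) ->
     \forall k \near \oo, P (u k)) ->
  \forall y \near x, Q y -> P y.
Proof.
move=> H; apply: contrapT => nr.
have C (j : nat) : exists y, [/\ `|y - x| <= j.+1%:R^-1, Q y & ~ P y].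
  have j0 : 0 < j.+1%:R^-1 :> R by rewrite invr_gt0.
  have [y yx /not_implyP[Qy nPy]] := not_near_seq nr j0.
  by exists y; split => //; exact: ltW.
have [u Hu] := choice C.
have ux : u @ \oo --> x by apply: cvg_squeeze_harmonic => j; case: (Hu j).
have [|k Pk] := @filter_ex _ _ _ _ (H u ux _); first by move=> k; case: (Hu k).
by case: (Hu k).
Qed.

Section SpanRank.
Variables (R : realType) (D : nat).

Lemma dim_rank (U : {vspace 'rV[R]_D}) N (M : 'M[R]_(N, D)) :
  (forall v, (v \in U) = (v <= M)%MS) -> \dim U = \rank M.
Proof.
move=> UM; apply/eqP; rewrite eqn_leq; apply/andP; split.
  pose X := vbasis U; pose Mx := \matrix_i tnth X i : 'M[R]_(\dim U, D).
  have Mxf : row_free Mx.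
    apply: inj_row_free => c c0; apply/rowP => i; rewrite mxE.
    have /freeP/(_ (c 0)) := basis_free (vbasisP U).
    apply; rewrite -[RHS]c0 mulmx_sum_row.
    by apply: eq_bigr => j _; rewrite rowK (tnth_nth 0).
  rewrite -(eqP Mxf); apply: mxrankS; apply/row_subP => i; rewrite rowK -UM.
  by apply: vbasis_mem; exact: mem_tnth.
pose X := [tuple row i (row_base M) | i < \rank M].
have Xf : free X.
  apply/freeP => c c0 i.
  have : (\row_j c j) *m row_base M = 0.
    rewrite mulmx_sum_row -[RHS]c0; apply: eq_bigr => j _.
    by rewrite mxE -tnth_nth tnth_mktuple.
  rewrite -(mul0mx _ (row_base M)) => /(row_free_inj (row_base_free M)) /rowP /(_ i).
  by rewrite !mxE.
rewrite -[leqLHS](size_tuple X) -(eqP (Xf : \dim <<X>> == size X)); apply: dimvS.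
apply/span_subvP => v /tnthP[i ->]; rewrite tnth_mktuple UM.
by apply: submx_trans (row_sub i _) _; rewrite eq_row_base.
Qed.

Lemma span_rank (X : seq 'rV[R]_D) N (M : 'M[R]_(N, D)) :
  (forall v, v \in X -> (v <= M)%MS) -> (forall i, row i M \in <<X>>%VS) ->
  \dim <<X>> = \rank M.
Proof.
move=> sM Ms; apply: dim_rank => v; apply/idP/idP => [|/submxP[c ->]].
  elim: X sM v {Ms} => [|a X IH] sM v; rewrite ?span_nil ?memv0.
    by move/eqP ->; exact: sub0mx.
  rewrite span_cons => /memv_addP[x /vlineP[k ->] [y ys ->]].
  apply: addmx_sub; first by apply: scalemx_sub; apply: sM; rewrite mem_head.
  by apply: IH => // w ws; apply: sM; rewrite inE ws orbT.
by rewrite mulmx_sum_row; apply: memv_suml => i _; apply: memvZ.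
Qed.

Lemma fam_rank (I : finType) (S : {set I}) (rho : I -> 'rV[R]_D) N (M : 'M[R]_(N, D)) :
  (forall i, i \in S -> (rho i <= M)%MS) ->
  (forall j, row j M \in <<fam S rho>>%VS) ->
  \dim <<fam S rho>> = \rank M.
Proof.
move=> H1; apply: span_rank => v /mapP[i]; rewrite mem_enum => iS ->.
exact: H1.
Qed.

Lemma eq_fam (I : finType) (S : {set I}) (rho rho' : I -> 'rV[R]_D) :
  {in S, rho =1 rho'} -> fam S rho = fam S rho'.
Proof. by move=> E; apply/eq_in_map => i; rewrite mem_enum; exact: E. Qed.

End SpanRank.

(** By polarisation, the product is half of the square of the sum minus the two squares. *)
Lemma hasgradM (R : realType) k (phi psi : 'rV[R]_k -> R) z zeta eta :
  hasgrad phi z zeta -> hasgrad psi z eta ->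
  hasgrad (fun w => phi w * psi w) z (phi z *: eta + psi z *: zeta).
Proof.
move=> H1 H2.
have := hasgradZ 2^-1 (hasgradB (hasgradB (hasgrad_sqr (hasgradD H1 H2)) (hasgrad_sqr H1)) (hasgrad_sqr H2)).
have -> : 2^-1 *: ((2 * (phi z + psi z)) *: (zeta + eta) - (2 * phi z) *: zeta -
   (2 * psi z) *: eta) = phi z *: eta + psi z *: zeta.
  by apply/rowP => i; rewrite !mxE; field.
by apply: hasgrad_ext => w; field.
Qed.

Lemma sum_row_mx (R : realType) k l (I : finType) (a : I -> 'rV[R]_k) (b : I -> 'rV[R]_l) :
  \sum_i row_mx (a i) (b i) = row_mx (\sum_i a i) (\sum_i b i).
Proof.
rewrite -[LHS]hsubmxK !linear_sum /=; congr row_mx; apply: eq_bigr => i _.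
  by rewrite row_mxKl.
by rewrite row_mxKr.
Qed.

(** * The constraint gradients of (CP) as rows *)

Section CombinedProgramMultipliers.
Variables (R : realType) (d s p q m n : nat).
Variables (F : 'rV[R]_(d + s) -> R).
Variables (G : 'rV[R]_(d + s) -> 'rV[R]_p) (H : 'rV[R]_(d + s) -> 'rV[R]_q).
Variables (f : 'rV[R]_(d + s) -> R) (g : 'rV[R]_(d + s) -> 'rV[R]_m)
          (h : 'rV[R]_(d + s) -> 'rV[R]_n).
Hypothesis F_loclip : locally_lipschitz F.
Hypotheses (G_C1 : C1_map G) (H_C1 : C1_map H).
Hypotheses (f_C1 : C1_fun f) (g_C1 : C1_map g) (h_C1 : C1_map h).
Hypotheses (fy_C1 : C1_map (fun z => rsubmx (grad f z)))
  (gy_C1 : forall i, C1_map (fun z => rsubmx (row i (jac g z))))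
  (hy_C1 : forall j, C1_map (fun z => rsubmx (row j (jac h z)))).

Local Notation D := ((d + s) + (m + n))%N.
Implicit Types (z : 'rV[R]_D) (xy : 'rV[R]_(d + s)) (u : 'rV[R]_m) (v : 'rV[R]_n).

Local Notation L := (gradyL f g h).
Local Notation fy := (fun w : 'rV[R]_(d + s) => rsubmx (grad f w)).
Local Notation gy i := (fun w : 'rV[R]_(d + s) => rsubmx (row i (jac g w))).
Local Notation hy j := (fun w : 'rV[R]_(d + s) => rsubmx (row j (jac h w))).

Lemma gradyL_sum xy u v : L xy u v =
  fy xy + \sum_i u 0 i *: gy i xy + \sum_j v 0 j *: hy j xy.
Proof.
rewrite /gradyL !mulmx_sum_row; congr (_ + _ + _); apply: eq_bigr => i _.
  by congr (_ *: _); apply/rowP => j; rewrite !mxE.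
by congr (_ *: _); apply/rowP => j; rewrite !mxE.
Qed.

(** Closed formula for the (x, y)-derivative of the y-gradient of the Lagrangian with u and v fixed;
    its continuity jointly in (x, y, u, v) can be read off term by term. *)
Definition jacL xy u v : 'M[R]_(s, d + s) :=
  jac (fy) xy + \sum_i u 0 i *: jac (gy i) xy + \sum_j v 0 j *: jac (hy j) xy.

Lemma hasgrad_gradyL xy u v j :
  hasgrad (fun w => L w u v 0 j) xy (row j (jacL xy u v)).
Proof.
rewrite /jacL !linearD !linear_sum /=.
have E : (fun w => L w u v 0 j) =1 (fun w => fy w 0 j
    + \sum_i u 0 i * gy i w 0 j + \sum_i v 0 i * hy i w 0 j).
  move=> w; rewrite gradyL_sum !mxE !summxE; congr (_ + _ + _); apply: eq_bigr => i _.
    by rewrite mxE.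
  by rewrite mxE.
rewrite (funext E); apply: hasgradD; first apply: hasgradD.
- exact: (C1_map_hasgrad xy j fy_C1).
- apply: hasgrad_sum => i _; rewrite linearZ.
  exact: hasgradZ (C1_map_hasgrad xy j (gy_C1 i)).
- apply: hasgrad_sum => i _; rewrite linearZ.
  exact: hasgradZ (C1_map_hasgrad xy j (hy_C1 i)).
Qed.

Lemma differentiable_gradyL xy u v : differentiable (fun w => L w u v) xy.
Proof.
have E : (fun w => L w u v) = fy + (\sum_i u 0 i *: gy i) + (\sum_j v 0 j *: hy j).
  apply/funext => w; rewrite gradyL_sum /= !fctE; congr (_ + _ + _).
    by rewrite fct_sumE.
  by rewrite fct_sumE.
rewrite E; apply: differentiableD; first apply: differentiableD.
- by case: fy_C1 => + _; apply.
- by apply: differentiable_sum => i; apply: differentiableZ; case: (gy_C1 i) => + _; apply.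
- by apply: differentiable_sum => i; apply: differentiableZ; case: (hy_C1 i) => + _; apply.
Qed.

Lemma jac_gradyL xy u v : jac (fun w => L w u v) xy = jacL xy u v.
Proof.
apply/row_matrixP => j.
exact: hasgrad_uniq (hasgrad_jac j (differentiable_gradyL xy u v)) (hasgrad_gradyL xy u v j).
Qed.

Definition eqs_row z (j : 'I_(q + n + s)) : 'rV[R]_D :=
  match fintype.split j with
  | inl j => match fintype.split j with
    | inl j => row_mx (row j (jac H (zxy z))) 0
    | inr j => row_mx (row j (jac h (zxy z))) 0
    end
  | inr j => row_mx (row j (jacL (zxy z) (zu z) (zv z)))
      (row_mx (row j (rsubmx (jac g (zxy z)))^T) (row j (rsubmx (jac h (zxy z)))^T))
  end.

Lemma eqs_row_H z j : eqs_row z (lshift s (lshift n j)) =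
  row_mx (row j (jac H (zxy z))) 0.
Proof.
rewrite /eqs_row (unsplitK (inl _ : 'I_(q + n) + 'I_s)).
by rewrite (unsplitK (inl _ : 'I_q + 'I_n)).
Qed.

Lemma eqs_row_h z j : eqs_row z (lshift s (rshift q j)) =
  row_mx (row j (jac h (zxy z))) 0.
Proof.
rewrite /eqs_row (unsplitK (inl _ : 'I_(q + n) + 'I_s)).
by rewrite (unsplitK (inr _ : 'I_q + 'I_n)).
Qed.

Lemma eqs_row_L z j : eqs_row z (rshift (q + n) j) =
  row_mx (row j (jacL (zxy z) (zu z) (zv z)))
      (row_mx (row j (rsubmx (jac g (zxy z)))^T) (row j (rsubmx (jac h (zxy z)))^T)).
Proof. by rewrite /eqs_row (unsplitK (inr _ : 'I_(q + n) + 'I_s)). Qed.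

Lemma hasgrad_zxy (phi : 'rV[R]_(d + s) -> R) z zeta :
  hasgrad phi (zxy z) zeta ->
  hasgrad (fun z' : 'rV[R]_D => phi (zxy z')) z (row_mx zeta 0).
Proof. exact: hasgrad_lsubmx. Qed.

Lemma hasgrad_zu z i :
  hasgrad (fun z' : 'rV[R]_D => zu z' 0 i) z (row_mx 0 (row_mx (delta_mx 0 i) 0)).
Proof.
apply: (@hasgrad_rsubmx R (d + s) (m + n) (fun w => lsubmx w 0 i)).
exact: (@hasgrad_lsubmx R m n (fun w => w 0 i) _ _ (hasgrad_coord _ i)).
Qed.

Lemma hasgrad_zv z i :
  hasgrad (fun z' : 'rV[R]_D => zv z' 0 i) z (row_mx 0 (row_mx 0 (delta_mx 0 i))).
Proof.
apply: (@hasgrad_rsubmx R (d + s) (m + n) (fun w => rsubmx w 0 i)).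
exact: (@hasgrad_rsubmx R m n (fun w => w 0 i) _ _ (hasgrad_coord _ i)).
Qed.

Lemma hasgrad_eqs z j : hasgrad (fun z' => eqs H f g h z' 0 j) z (eqs_row z j).
Proof.
rewrite -[j]splitK; case: (fintype.split j) => {}j /=; last first.
  rewrite eqs_row_L.
  have E : (fun z' : 'rV[R]_D => eqs H f g h z' 0 (rshift (q + n) j)) =1 (fun z' => fy (zxy z') 0 j
      + \sum_i zu z' 0 i * gy i (zxy z') 0 j + \sum_i zv z' 0 i * hy i (zxy z') 0 j).
    move=> z'; rewrite /eqs row_mxEr gradyL_sum !mxE !summxE; congr (_ + _ + _); apply: eq_bigr => i _.
      by rewrite mxE.
    by rewrite mxE.
  rewrite (funext E).
  have -> : row_mx (row j (jacL (zxy z) (zu z) (zv z)))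
      (row_mx (row j (rsubmx (jac g (zxy z)))^T) (row j (rsubmx (jac h (zxy z)))^T)) =
    row_mx (row j (jac fy (zxy z))) 0
    + \sum_i (zu z 0 i *: row_mx (row j (jac (gy i) (zxy z))) 0
        + gy i (zxy z) 0 j *: row_mx 0 (row_mx (delta_mx 0 i) 0))
    + \sum_i (zv z 0 i *: row_mx (row j (jac (hy i) (zxy z))) 0
        + hy i (zxy z) 0 j *: row_mx 0 (row_mx 0 (delta_mx 0 i))).
    under eq_bigr do rewrite !scale_row_mx !scaler0 add_row_mx add0r addr0.
    under [X in _ = _ + X]eq_bigr do rewrite !scale_row_mx !scaler0 add_row_mx add0r addr0.
    rewrite !sum_row_mx !add_row_mx !big1_eq ?addr0 ?add0r ?addr0 ?add0r.
    rewrite /jacL !linearD !linear_sum /=; congr row_mx.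
      by congr (_ + _ + _); apply: eq_bigr => i _; rewrite linearZ.
    rewrite add_row_mx addr0 add0r; congr row_mx.
      rewrite [LHS]row_sum_delta; apply: eq_bigr => i _; congr (_ *: _).
      by rewrite !mxE.
    rewrite [LHS]row_sum_delta; apply: eq_bigr => i _; congr (_ *: _).
    by rewrite !mxE.
  apply: hasgradD; first apply: hasgradD.
  - exact: (hasgrad_zxy (phi := fun w => fy w 0 j)) (C1_map_hasgrad (zxy z) j fy_C1).
  - apply: hasgrad_sum => i _; apply: hasgradM; first exact: hasgrad_zu.
    exact: (hasgrad_zxy (phi := fun w => gy i w 0 j)) (C1_map_hasgrad (zxy z) j (gy_C1 i)).
  - apply: hasgrad_sum => i _; apply: hasgradM; first exact: hasgrad_zv.
    exact: (hasgrad_zxy (phi := fun w => hy i w 0 j)) (C1_map_hasgrad (zxy z) j (hy_C1 i)).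
rewrite -[j]splitK; case: (fintype.split j) => {}j /=.
  rewrite eqs_row_H; apply: (@hasgrad_ext _ _ (fun z' => H (zxy z') 0 j)).
    by move=> z'; rewrite /eqs !row_mxEl.
  exact: (hasgrad_zxy (phi := fun w => H w 0 j)) (C1_map_hasgrad (zxy z) j H_C1).
rewrite eqs_row_h; apply: (@hasgrad_ext _ _ (fun z' => h (zxy z') 0 j)).
  by move=> z'; rewrite /eqs row_mxEl row_mxEr.
exact: (hasgrad_zxy (phi := fun w => h w 0 j)) (C1_map_hasgrad (zxy z) j h_C1).
Qed.

Lemma hasgrad_neg_g z i :
  hasgrad (fun z' : 'rV[R]_D => - g (zxy z') 0 i) z (row_mx (- row i (jac g (zxy z))) 0).
Proof.
apply: (hasgrad_zxy (phi := fun w => - g w 0 i)).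
exact: hasgradN (C1_map_hasgrad (zxy z) i g_C1).
Qed.

(* Indices of the constraints of (CP): the equations, theta, - g and u. *)
Definition cidx := ('I_(q + n + s) + option 'I_p + 'I_m + 'I_m)%type.

Definition idx_set (A : {set option 'I_p}) (B E : {set 'I_m}) : {set cidx} :=
  [set i : cidx | match i with
    | inl (inl (inl _)) => true
    | inl (inl (inr i)) => i \in A
    | inl (inr i) => i \in B
    | inr i => i \in E end]%SET.

Definition crow z (w : option 'I_p -> 'rV[R]_D) (i : cidx) : 'rV[R]_D :=
  match i with
  | inl (inl (inl j)) => eqs_row z j
  | inl (inl (inr i)) => w i
  | inl (inr i) => row_mx (- row i (jac g (zxy z))) 0
  | inr i => row_mx 0 (row_mx (delta_mx 0 i) 0)
  end.

Definition theta_row z w (i : option 'I_p) : 'rV[R]_D :=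
  if i is Some i then row_mx (row i (jac G (zxy z))) 0
  else row_mx (grad f (zxy z) - row_mx w 0) 0.

Lemma family_rankE (A : {set option 'I_p}) (B E : {set 'I_m})
    (w : option 'I_p -> 'rV[R]_D) z :
  family_rank (RCRCQ_family H f g h A B E w z) =
  \dim <<fam (idx_set A B E) (crow z w)>>.
Proof.
rewrite /family_rank; congr (\dim _).
have gE (i : 'I_m) : grad (fun z' => - g (zxy z') 0 i) z = row_mx (- row i (jac g (zxy z))) 0.
  exact: hasgrad_grad (hasgrad_neg_g z i).
have uE (i : 'I_m) : grad (fun z' => zu z' 0 i) z = row_mx 0 (row_mx (delta_mx 0 i) 0).
  exact: hasgrad_grad (hasgrad_zu z i).
have eE j : grad (fun z' => eqs H f g h z' 0 j) z = eqs_row z j.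
  exact: hasgrad_grad (hasgrad_eqs z j).
apply/eqP; rewrite eqEsubv; apply/andP; split.
  apply/span_subvP => v; rewrite !mem_cat => /or4P[] /mapP[i]; rewrite mem_enum => iA ->.
  - by apply: (fam_mem (crow z w) (i := inl (inl (inr i)))); rewrite inE.
  - by rewrite eE; apply: (fam_mem (crow z w) (i := inl (inl (inl i)))); rewrite inE.
  - by rewrite gE; apply: (fam_mem (crow z w) (i := inl (inr i))); rewrite inE.
  - by rewrite uE; apply: (fam_mem (crow z w) (i := inr i)); rewrite inE.
apply: fam_subvP => -[[[j|i]|i]|i]; rewrite inE => iA; apply: memv_span; rewrite !mem_cat.
- by apply/or4P; apply: Or42; apply/mapP; exists j; rewrite ?mem_enum //= eE.
- by apply/or4P; apply: Or41; apply/mapP; exists i; rewrite ?mem_enum.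
- by apply/or4P; apply: Or43; apply/mapP; exists i; rewrite ?mem_enum //= gE.
- by apply/or4P; apply: Or44; apply/mapP; exists i; rewrite ?mem_enum //= uE.
Qed.

Definition swap_cols : 'M[R]_((d + s) + (n + m), D) :=
  block_mx 1%:M 0 0 (block_mx 0 1%:M 1%:M 0).

Lemma mul_swap_cols N (a : 'M[R]_(N, d + s)) (b : 'M[R]_(N, n)) (c : 'M[R]_(N, m)) :
  row_mx a (row_mx b c) *m swap_cols = row_mx a (row_mx c b).
Proof. by rewrite /swap_cols !mul_row_block !mulmx1 !mulmx0 !addr0 !add0r. Qed.

Lemma swap_cols_free : row_free swap_cols.
Proof.
apply: inj_row_free => v.
rewrite -[v]hsubmxK -[rsubmx v]hsubmxK mul_swap_cols.
move=> E; have {E} : row_mx (lsubmx v) (row_mx (rsubmx (rsubmx v)) (lsubmx (rsubmx v))) =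
  row_mx 0 (row_mx 0 0) by rewrite !row_mx0.
by move=> /eq_row_mx[-> /eq_row_mx[-> ->]]; rewrite !row_mx0.
Qed.

Lemma sub_col_mxl N1 N2 k (v : 'rV[R]_k) (A : 'M[R]_(N1, k)) (B : 'M[R]_(N2, k)) :
  (v <= A)%MS -> (v <= col_mx A B)%MS.
Proof. by move=> vA; rewrite -addsmxE; exact: submx_trans vA (addsmxSl _ _). Qed.

Lemma sub_col_mxr N1 N2 k (v : 'rV[R]_k) (A : 'M[R]_(N1, k)) (B : 'M[R]_(N2, k)) :
  (v <= B)%MS -> (v <= col_mx A B)%MS.
Proof. by move=> vB; rewrite -addsmxE; exact: submx_trans vB (addsmxSr _ _). Qed.

Lemma rows_col_mx N1 N2 k (U : {vspace 'rV[R]_k}) (A : 'M[R]_(N1, k)) (B : 'M[R]_(N2, k)) :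
  (forall i, row i A \in U) -> (forall i, row i B \in U) ->
  forall i, row i (col_mx A B) \in U.
Proof.
move=> HA HB i; case: (splitP i) => j ij.
  by have -> : i = lshift N2 j; [exact: val_inj|rewrite rowKu].
by have -> : i = rshift N1 j; [exact: val_inj|rewrite rowKd].
Qed.

Lemma row_subrows k l (A : {set 'I_k}) (M : 'M[R]_(k, l)) i :
  row i (subrows A M) = row (enum_val i) M.
Proof. by rewrite /subrows row_rowsub. Qed.

Lemma sub_subrows k l (A : {set 'I_k}) (M : 'M[R]_(k, l)) i : i \in A ->
  exists j, row j (subrows A M) = row i M.
Proof.
by move=> iA; exists (enum_rank_in iA i); rewrite row_subrows enum_rankK_in.
Qed.

(** The set [A] encodes the index set of G and [alpha] together: [alpha] is 1 exactly when [None]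
    belongs to [A], and otherwise the last row of J' is zero. *)
Lemma rank_Jprime (A : {set option 'I_p}) (B E : {set 'I_m}) x y u v w :
  \rank (Jprime G H f g h [set i | Some i \in A]%SET B E x y u v (None \in A)%:R w) =
  \dim <<fam (idx_set A B E) (crow (zpt x y u v) (theta_row (zpt x y u v) w))>>.
Proof.
rewrite -(mxrankMfree _ swap_cols_free); apply/esym.
have zxyE : zxy (zpt x y u v) = row_mx x y by rewrite /zxy /zpt row_mxKl.
have zuE : zu (zpt x y u v) = u by rewrite /zu /zpt row_mxKr row_mxKl.
have zvE : zv (zpt x y u v) = v by rewrite /zv /zpt row_mxKr row_mxKr.
set I2 := [set i | Some i \in A]%SET.
rewrite /Jprime !mul_col_mx !mul_swap_cols !row_mx0.
rewrite jac_gradyL.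
set M := col_mx _ _.
have key i : i \in idx_set A B E ->
    (crow (zpt x y u v) (theta_row (zpt x y u v) w) i <= M)%MS.
  rewrite /M; case: i => [[[j|[i|]]|i]|i]; rewrite inE /= /theta_row ?zxyE => iA.
  - rewrite -[j]splitK; case: (fintype.split j) => [j1|j1] /=; last first.
      by rewrite eqs_row_L zxyE zuE zvE; apply: sub_col_mxl; apply: (eq_row_sub j1); rewrite !row_row_mx.
    rewrite -[j1]splitK; case: (fintype.split j1) => [j2|j2] /=.
      rewrite eqs_row_H zxyE.
      by do 2!apply: sub_col_mxr; apply: sub_col_mxl; apply: (eq_row_sub j2); rewrite row_row_mx row0.
    rewrite eqs_row_h zxyE.
    by apply: sub_col_mxr; apply: sub_col_mxl; apply: (eq_row_sub j2); rewrite row_row_mx row0.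
  - have iI2 : i \in I2 by rewrite inE.
    have [j jE] := sub_subrows (jac G (row_mx x y)) iI2.
    do 3!apply: sub_col_mxr; apply: sub_col_mxl; apply: (eq_row_sub j).
    by rewrite row_row_mx row0 jE.
  - do 6!apply: sub_col_mxr; apply: (eq_row_sub 0).
    by rewrite iA scale1r row_id.
  - have [j jE] := sub_subrows (jac g (row_mx x y)) iA.
    do 4!apply: sub_col_mxr; apply: sub_col_mxl.
    rewrite -[row_mx _ _]opprK opp_row_mx opprK oppr0 eqmx_opp; apply: (eq_row_sub j).
    by rewrite row_row_mx row0 jE.
  - have [j jE] := sub_subrows (1%:M : 'M[R]_m) iA.
    do 5!apply: sub_col_mxr; apply: sub_col_mxl; apply: (eq_row_sub j).
    by rewrite !row_row_mx !row0 jE row1.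
apply: fam_rank => //; set U := (<<_>>)%VS.
have inU i : i \in idx_set A B E ->
    crow (zpt x y u v) (theta_row (zpt x y u v) w) i \in U by exact: fam_mem.
have inE4 j : eqs_row (zpt x y u v) j \in U.
  by apply: (inU (inl (inl (inl j)))); rewrite inE.
rewrite /M; apply: rows_col_mx; last apply: rows_col_mx; last apply: rows_col_mx;
  last apply: rows_col_mx; last apply: rows_col_mx; last apply: rows_col_mx.
- by move=> j; have := inE4 (rshift (q + n) j); rewrite eqs_row_L zxyE zuE zvE !row_row_mx.
- by move=> j; have := inE4 (lshift s (rshift q j)); rewrite eqs_row_h zxyE row_row_mx row0.
- by move=> j; have := inE4 (lshift s (lshift n j)); rewrite eqs_row_H zxyE row_row_mx row0.
- move=> j; rewrite row_row_mx row0 row_subrows.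
  have := enum_valP j; rewrite inE => jA.
  by have := inU (inl (inl (inr (Some (enum_val j))))); rewrite inE /= zxyE; apply.
- move=> j; rewrite row_row_mx row0 row_subrows.
  have := inU (inl (inr (enum_val j))); rewrite inE /= zxyE enum_valP => /(_ isT).
  by rewrite -memvN opp_row_mx opprK oppr0.
- move=> j; rewrite !row_row_mx !row0 row_subrows row1.
  by have := inU (inr (enum_val j)); rewrite inE /= enum_valP; apply.
- move=> j; rewrite row_id; case: (boolP (None \in A)) => iA.
    rewrite scale1r.
    by have := inU (inl (inl (inr None))); rewrite inE /= zxyE; apply.
  by rewrite scale0r row_mx0 mem0v.
Qed.

Local Notation eq_idx j := (inl (inl (inl j)) : cidx).
Local Notation th_idx i := (inl (inl (inr i)) : cidx).
Local Notation g_idx i := (inl (inr i) : cidx).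
Local Notation u_idx i := (inr i : cidx).

Lemma sum_cidx (V : zmodType) (E : cidx -> V) : \sum_i E i =
  \sum_j E (eq_idx j) + (E (th_idx None) + \sum_i E (th_idx (Some i)))
  + \sum_i E (g_idx i) + \sum_i E (u_idx i).
Proof.
rewrite !big_sumType /=; congr (_ + _ + _ + _).
rewrite (bigD1 None) //=; congr (_ + _).
rewrite (reindex_omap Some id) => [|[i|] //].
by apply: eq_bigl => i /=; rewrite eqxx.
Qed.

Lemma sum_eqs_row z (c : 'rV[R]_q) (c' : 'rV[R]_n) (c'' : 'rV[R]_s) :
  \sum_j row_mx (row_mx c c') c'' 0 j *: eqs_row z j =
  row_mx (c *m jac H (zxy z) + c' *m jac h (zxy z)
          + c'' *m jacL (zxy z) (zu z) (zv z))
    (row_mx (c'' *m (rsubmx (jac g (zxy z)))^T) (c'' *m (rsubmx (jac h (zxy z)))^T)).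
Proof.
rewrite !big_split_ord /=.
under eq_bigr do rewrite !row_mxEl eqs_row_H scale_row_mx scaler0.
under [X in _ + X + _]eq_bigr do rewrite row_mxEl row_mxEr eqs_row_h scale_row_mx scaler0.
under [X in _ + _ + X]eq_bigr do rewrite row_mxEr eqs_row_L !scale_row_mx.
rewrite !sum_row_mx !add_row_mx !big1_eq !add0r -!mulmx_sum_row.
by rewrite !mulmx_sum_row.
Qed.

Lemma cvg_rV_entries k (T : Type) (A : set_system T) (u : T -> 'rV[R]_k) (v : 'rV[R]_k)
    (e : T -> 'I_k -> R) (e0 : 'I_k -> R) : Filter A ->
  (forall t b, u t 0 b = e t b) -> (forall b, v 0 b = e0 b) ->
  (forall b, e t b @[t --> A] --> e0 b) -> u @ A --> v.
Proof.
move=> AF ue ve c; apply/cvg_rVP => b; rewrite ve.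
by rewrite (_ : (fun t => _) = e ^~ b); [exact: c|apply/funext => t; exact: ue].
Qed.

Lemma crow_cvg (T : Type) (A : set_system T) (zt : T -> 'rV[R]_D) (wt : T -> 'rV[R]_d)
    z w i : Filter A -> zt @ A --> z -> wt @ A --> w ->
  crow (zt t) (theta_row (zt t) (wt t)) i @[t --> A] --> crow z (theta_row z w) i.
Proof.
move=> AF zz ww.
have xyc : zxy (zt t) @[t --> A] --> zxy z by exact: cvg_lsubmx.
have uc : zu (zt t) @[t --> A] --> zu z by apply: cvg_lsubmx; exact: cvg_rsubmx.
have vc : zv (zt t) @[t --> A] --> zv z by apply: cvg_rsubmx; exact: cvg_rsubmx.
have jc k (phi : 'rV[R]_(d + s) -> 'rV[R]_k) a b : C1_map phi ->
    jac phi (zxy (zt t)) a b @[t --> A] --> jac phi (zxy z) a b.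
  by move=> C; exact: (@C1_map_jac _ _ _ _ _ _ _ AF).
have jLc : jacL (zxy (zt t)) (zu (zt t)) (zv (zt t)) @[t --> A] -->
    jacL (zxy z) (zu z) (zv z).
  have Jc k (phi : 'rV[R]_(d + s) -> 'rV[R]_k) : C1_map phi ->
      jac phi (zxy (zt t)) @[t --> A] --> jac phi (zxy z).
    by move=> C; exact: (cvg_comp _ _ xyc (C.2 (zxy z))).
  apply: cvgD; first apply: cvgD; first exact: Jc fy_C1.
    apply: cvg_big => [|k _]; first exact: add_continuous.
    by apply: cvgZ; [apply: cvg_mx_coord uc|exact: Jc (gy_C1 k)].
  apply: cvg_big => [|k _]; first exact: add_continuous.
  by apply: cvgZ; [apply: cvg_mx_coord vc|exact: Jc (hy_C1 k)].
have rc k (phi : 'rV[R]_(d + s) -> 'rV[R]_k) a : C1_map phi ->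
    row a (jac phi (zxy (zt t))) @[t --> A] --> row a (jac phi (zxy z)).
  move=> C; apply: (cvg_rV_entries AF (e := fun t => jac phi (zxy (zt t)) a)) => [t|b|b]; last exact: jc.
    by move=> b; rewrite mxE.
  by rewrite mxE.
have rT k (phi : 'rV[R]_(d + s) -> 'rV[R]_k) a : C1_map phi ->
    row a (rsubmx (jac phi (zxy (zt t))))^T @[t --> A] --> row a (rsubmx (jac phi (zxy z)))^T.
  move=> C; apply: (cvg_rV_entries AF (e := fun t b => jac phi (zxy (zt t)) b (rshift d a))) => [t|b|b];
    last exact: jc.
    by move=> b; rewrite !mxE.
  by rewrite !mxE.
have r0 k (u : T -> 'rV[R]_(d + s)) a : u @ A --> a ->
    row_mx (u t) 0 @[t --> A] --> (row_mx a 0 : 'rV[R]_(d + s + k)).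
  by move=> ua; apply: cvg_row_mx => //; exact: cvg_cst.
case: i => [[[j|[i|]]|i]|i] /=.
- rewrite /eqs_row; case: (fintype.split j) => [j1|j1]; first case: (fintype.split j1) => [j2|j2].
  + by apply: r0; exact: rc.
  + by apply: r0; exact: rc.
  apply: cvg_row_mx; last apply: cvg_row_mx.
  + apply: (cvg_rV_entries AF (e := fun t => jacL (zxy (zt t)) (zu (zt t)) (zv (zt t)) j1)) => [t b|b|b].
    - by rewrite mxE.
    - by rewrite mxE.
    - exact: cvg_mx_coord jLc.
  + exact: rT.
  + exact: rT.
- by apply: r0; exact: rc.
- apply: r0; apply: cvgB; first exact: (cvg_comp _ _ xyc (f_C1.2 (zxy z))).
  by apply: cvg_row_mx => //; exact: cvg_cst.
- by apply: r0; apply: cvgN; exact: rc.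
- exact: cvg_cst.
Qed.

Lemma Sset_CP_feasible z : CP_feasible G H f g h z ->
  Sset f g h (zx z) (rsubmx (zxy z)).
Proof.
move=> [fV _ h0 _ [ng0 _ _]]; have E : row_mx (zx z) (rsubmx (zxy z)) = zxy z by rewrite hsubmxK.
have Yz : Yset g h (zx z) (rsubmx (zxy z)).
  by rewrite /Yset /= E; split => // i; have := ng0 i; rewrite mxE oppr_ge0.
split => //; rewrite E.
have up : (Vfun f g h (zx z) <= (f (zxy z))%:E)%E.
  by apply: ereal_inf_lbound; exists (rsubmx (zxy z)); rewrite ?E.
case: (Vfun f g h (zx z)) fV up => [v| |] //=.
by rewrite -EFinB !lee_fin subr_le0 => A B; congr (_%:E); apply/eqP; rewrite eq_le A.
Qed.

(** * Subgradients of f - V and feasibility *)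

Variables (N : set 'rV[R]_d) (W : 'rV[R]_d -> set 'rV[R]_d).
Hypothesis N_reg : value_function_regular f g h N W.

(** Adding the smooth function [- f] leaves [- V], which depends on x only; hence the y-block
    vanishes and [limiting_opp_co] applies to the x-block. *)
Lemma f_minus_V_subdiff xy zeta : N (lsubmx xy) ->
  limiting_subdiff (f_minus_V f g h) xy zeta ->
  zeta = grad f xy - row_mx (lsubmx (grad f xy) - lsubmx zeta) 0 /\
  co (W (lsubmx xy)) (lsubmx (grad f xy) - lsubmx zeta).
Proof.
move=> Nx Hz; have [No Vc Vs Wc _] := N_reg.
have cgrad : (fun w => - grad f w) @ xy --> - grad f xy.
  by apply: (cvgN (f_C1.2 xy)).
have := limitingD (fun w => hasgradN (C1_hasgrad f_C1 w)) cgrad Hz.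
have -> : (fun w => f_minus_V f g h w + - f w) =
    (fun w : 'rV[R]_(d + s) => (fun x => - fine (Vfun f g h x)) (lsubmx w)).
  by apply/funext => w; rewrite /f_minus_V addrAC subrr add0r.
move=> /(@limiting_lsubmx R d s (fun x => - fine (Vfun f g h x)))[E].
move=> /(limiting_opp_co No Vc Vs Wc Nx); rewrite linearB /= opprB => Hco.
split => //; rewrite linearB /= in E.
move/eqP: E; rewrite subr_eq => /eqP E; rewrite {1}E.
by rewrite -[row_mx _ 0]opprK opp_row_mx oppr0 opprB addrC.
Qed.

Lemma f_minus_V_subdiff_nonempty xy : N (lsubmx xy) ->
  exists zeta, limiting_subdiff (f_minus_V f g h) xy zeta.
Proof.
move=> Nx; have [No Vc Vs Wc _] := N_reg.
have [xi Hxi] := limiting_opp_nonempty No Vc Vs Wc Nx.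
have := limitingD (C1_hasgrad f_C1) (f_C1.2 xy) (limiting_lsubmx_lift (l := s) (z := xy) Hxi).
have -> : (fun w : 'rV[R]_(d + s) => - fine (Vfun f g h (lsubmx w)) + f w) = f_minus_V f g h.
  by apply/funext => w; rewrite /f_minus_V addrC.
by move=> ?; exists (row_mx xi 0 + grad f xy).
Qed.

Lemma theta_None_subdiff (z zeta : 'rV[R]_D) : N (zx z) ->
  limiting_subdiff (theta G f g h None) z zeta ->
  let w := lsubmx (grad f (zxy z)) - lsubmx (lsubmx zeta) in
  zeta = theta_row z w None /\ co (W (zx z)) w.
Proof.
move=> Nx /(@limiting_lsubmx R (d + s) (m + n) (f_minus_V f g h))[E].
move=> /(f_minus_V_subdiff Nx)[E2 Hco] /=; split => //.
by rewrite {1}E {1}E2.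
Qed.

Lemma theta_Some_subdiff (z zeta : 'rV[R]_D) i :
  limiting_subdiff (theta G f g h (Some i)) z zeta ->
  zeta = row_mx (row i (jac G (zxy z))) 0.
Proof.
have Hg (w : 'rV[R]_D) : hasgrad (theta G f g h (Some i)) w (row_mx (row i (jac G (zxy w))) 0).
  apply: (hasgrad_zxy (phi := fun xy => G xy 0 i)).
  exact: C1_map_hasgrad.
have c : (fun w : 'rV[R]_D => row_mx (row i (jac G (zxy w))) 0) @ z -->
    (row_mx (row i (jac G (zxy z))) 0 : 'rV[R]_D).
  apply: (@cvg_row_mx _ _ _ _ (nbhs z) (nbhs_filter z)); last exact: cvg_cst.
  apply/(@cvg_rVP _ _ _ (nbhs z) (nbhs_filter z)) => j.
  have E (w : 'rV[R]_D) : row i (jac G (zxy w)) 0 j = jac G (zxy w) i j by rewrite mxE.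
  rewrite (funext E) E.
  apply: (@C1_map_jac _ _ _ _ _ _ (nbhs z) (nbhs_filter z) (fun w : 'rV[R]_D => zxy w)) => //.
  by apply: (@cvg_lsubmx _ _ _ _ (nbhs z) (nbhs_filter z)); move=> X.
by move/(limiting_hasgrad _ Hg c).
Qed.

Local Notation feasible := (program_feasible (theta G f g h None)
  (fun (i : 'I_p) (z : 'rV[R]_D) => G (zxy z) 0 i)
  (fun (j : 'I_(q + n + s)) z => eqs H f g h z 0 j)
  (fun (i : 'I_m) z => - g (zxy z) 0 i) (fun (i : 'I_m) z => zu z 0 i)).

Lemma feasibleP (z : 'rV[R]_D) : N (zx z) -> CP_feasible G H f g h z <-> feasible z.
Proof.
move=> Nz; have [_ _ _ _ VE] := N_reg.
have tE : ((f (zxy z))%:E - Vfun f g h (zx z) <= 0)%E = (theta G f g h None z <= 0).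
  by rewrite VE // -EFinB lee_fin.
split=> [[tz [Gz Hz] hz Lz [ng u0 gu]]|[tz Gz ez gz]].
  split => //; first by rewrite -tE.
    move=> j; rewrite /eqs Hz hz Lz !mxE.
    by case: (fintype.split j) => [j1|j1]; rewrite !mxE //; case: (fintype.split j1) => j2; rewrite mxE.
  move=> i; have := ng i; rewrite mxE => ngi; split => //.
  move/eqP: gu; rewrite /dotp psumr_eq0 => [/allP /(_ i (mem_index_enum i))|j _].
    by rewrite mxE => /eqP.
  by apply: mulr_ge0; [exact: ng|exact: u0].
have ez0 : eqs H f g h z = row_mx (row_mx 0 0) 0.
  by apply/rowP => j; rewrite ez !row_mx0 mxE.
move: ez0; rewrite /eqs => /eq_row_mx[/eq_row_mx[Hz hz] Lz]; split => //.
- by rewrite tE.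
- split => [i|i|]; first by rewrite mxE; case: (gz i).
    by case: (gz i).
  by rewrite /dotp big1 // => i _; rewrite mxE; case: (gz i).
Qed.

(** * RCRCQ and multipliers at the local solution *)

Section AtPoint.
Variables (xs : 'rV[R]_d) (ys : 'rV[R]_s) (us : 'rV[R]_m) (vs : 'rV[R]_n).
Hypothesis J_rank : Jprime_constant_rank G H f g h W xs ys us vs.
Hypothesis N_xs : N xs.
Hypothesis zs_local : CP_local_solution F G H f g h (zpt xs ys us vs).

Local Notation zs := (zpt xs ys us vs : 'rV[R]_D).
Local Notation Is := (Iset g (row_mx xs ys) us).
Local Notation Js := (Jset g (row_mx xs ys) us).
Local Notation Ks := (Kset g (row_mx xs ys) us).

Local Notation dim_rows A B E z w := (\dim <<fam (idx_set A (Is :|: B) (Ks :|: E)) (crow z w)>>).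

Lemma zptK (z : 'rV[R]_D) : zpt (zx z) (rsubmx (zxy z)) (zu z) (zv z) = z.
Proof. by rewrite /zpt /zx /zu /zv !hsubmxK. Qed.

Lemma zxy_zs : zxy zs = row_mx xs ys. Proof. by rewrite /zxy /zpt row_mxKl. Qed.
Lemma zx_zs : zx zs = xs. Proof. by rewrite /zx zxy_zs row_mxKl. Qed.
Lemma zu_zs : zu zs = us. Proof. by rewrite /zu /zpt row_mxKr row_mxKl. Qed.
Lemma zv_zs : zv zs = vs. Proof. by rewrite /zv /zpt !row_mxKr. Qed.

Lemma rank_near (A : {set option 'I_p}) (B E : {set 'I_m}) w0 :
  A \subset Itheta G zs -> B \subset Js -> E \subset Js -> co (W xs) w0 ->
  \forall zw \near (zs, w0), co (W (zx zw.1)) zw.2 ->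
    dim_rows A B E zw.1 (theta_row zw.1 zw.2)
    = dim_rows A B E zs (theta_row zs w0).
Proof.
move=> AI BJ EJ Hw0; apply: near_seqP => zw zwc Hco.
have zc : (zw k).1 @[k --> \oo] --> zs by exact: (cvg_comp _ _ zwc cvg_fst).
have wc : (zw k).2 @[k --> \oo] --> w0 by exact: (cvg_comp _ _ zwc cvg_snd).
have rJ := rank_Jprime A (Is :|: B) (Ks :|: E).
have rE (z : 'rV[R]_D) w :
    \rank (Jprime G H f g h [set i | Some i \in A]%SET (Is :|: B) (Ks :|: E)
       (zx z) (rsubmx (zxy z)) (zu z) (zv z) (None \in A)%:R w) =
    dim_rows A B E z (theta_row z w).
  by rewrite rJ zptK.
have rEs := rJ xs ys us vs w0.
have I2G : [set i | Some i \in A]%SET \subset IG G (row_mx xs ys).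
  apply/fintype.subsetP => i; rewrite inE => /(fintype.subsetP AI).
  by rewrite /Itheta zxy_zs in_setU1 /= => /imsetP[j jG [->]].
have alpha01 : (None \in A)%:R = 0 :> R \/ (None \in A)%:R = 1 :> R.
  by case: (None \in A); [right|left].
have xyc : zxy (zw k).1 @[k --> \oo] --> row_mx xs ys.
  by rewrite -zxy_zs; exact: cvg_lsubmx.
have uvc : rsubmx (zw k).1 @[k --> \oo] --> row_mx us vs.
  by rewrite -[row_mx us vs](row_mxKr (row_mx xs ys)); exact: cvg_rsubmx.
have := @J_rank [set i | Some i \in A]%SET B E (None \in A)%:R I2G BJ EJ alpha01 w0 Hw0
  (fun k => zx (zw k).1) (fun k => rsubmx (zxy (zw k).1)) (fun k => zu (zw k).1)
  (fun k => zv (zw k).1) (fun k => (zw k).2).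
case.
- by rewrite -[X in _ --> X](row_mxKl xs ys); exact: cvg_lsubmx.
- by rewrite -[X in _ --> X](row_mxKr xs ys); exact: cvg_rsubmx.
- by rewrite -[X in _ --> X](row_mxKl us vs); exact: cvg_lsubmx.
- by rewrite -[X in _ --> X](row_mxKr us vs); exact: cvg_rsubmx.
- exact: wc.
- exact: Hco.
move=> k0 _ Hk0; exists k0; first by []. move=> k kk.
apply: (eq_trans (esym (rE (zw k).1 (zw k).2))).
exact: (eq_trans (Hk0 k kk) rEs).
Qed.

Lemma near_N (T : Type) (K : set_system T) (zt : T -> 'rV[R]_D) : Filter K ->
  zt @ K --> zs -> \forall t \near K, N (zx (zt t)).
Proof.
move=> FF zz; have [No _ _ _ _] := N_reg.
have xc : zx (zt t) @[t --> K] --> xs.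
  rewrite -[X in _ --> X]zx_zs.
  by apply: cvg_lsubmx; exact: cvg_lsubmx.
exact: near_cvg xc (No _ N_xs).
Qed.

Lemma near_rank (A : {set option 'I_p}) (B E : {set 'I_m}) w0
    (T : Type) (K : set_system T) (zt : T -> 'rV[R]_D) (wt : T -> 'rV[R]_d) : Filter K ->
  A \subset Itheta G zs -> B \subset Js -> E \subset Js -> co (W xs) w0 ->
  zt @ K --> zs -> wt @ K --> w0 -> (\forall t \near K, co (W (zx (zt t))) (wt t)) ->
  \forall t \near K,
    dim_rows A B E (zt t) (theta_row (zt t) (wt t))
    = dim_rows A B E zs (theta_row zs w0).
Proof.
move=> FF AI BJ EJ Hw0 zz ww Hco.
have zw : (zt t, wt t) @[t --> K] --> (zs, w0).
  move=> P; exact: (@cvg_pair _ _ _ K (nbhs zs) (nbhs w0) FF (nbhs_filter zs) (nbhs_filter w0) _ _ zz ww P).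
by apply: filterS2 Hco (near_cvg zw (rank_near AI BJ EJ Hw0)) => t C; apply.
Qed.

Lemma dim_fam_crow (A : {set option 'I_p}) B E (z : 'rV[R]_D) w w' :
  (forall i, i \in A -> w i = w' i) ->
  \dim <<fam (idx_set A B E) (crow z w)>> = \dim <<fam (idx_set A B E) (crow z w')>>.
Proof.
by move=> ww; congr (\dim <<_>>); apply: eq_fam => -[[[j|i]|i]|i] //=; rewrite inE => /ww.
Qed.

(** Without the row of f - V the rank is independent of w, but the hypothesis on J' still asks for a
    convergent choice of w in [co W]. Elements of the nonempty sets [W] converge along any
    ultrafilter and serve as this choice. *)
Lemma near_rank_any (A : {set option 'I_p}) (B E : {set 'I_m}) w0
    (T : Type) (K : set_system T) (zt : T -> 'rV[R]_D) (wt : T -> 'rV[R]_d) : Filter K ->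
  None \notin A ->
  A \subset Itheta G zs -> B \subset Js -> E \subset Js -> zt @ K --> zs ->
  \forall t \near K,
    dim_rows A B E (zt t) (theta_row (zt t) (wt t))
    = dim_rows A B E zs (theta_row zs w0).
Proof.
move=> FF nA AI BJ EJ zz; apply: ultra_near => F' F'U sub.
have F'K : Filter F' by typeclasses eauto.
have zz' := sub_filter_cvg sub zz.
have [No Vc Vs Wc _] := N_reg.
have C t : exists w, N (zx (zt t)) -> W (zx (zt t)) w.
  by have [/(W_nonempty No Vc Vs Wc)[w Ww]|nN] := pselect (N (zx (zt t))); [exists w|exists 0].
have [w' Hw'] := choice C.
have Ww' : \forall t \near F', W (zx (zt t)) (w' t).
  by apply: filterS (near_N F'K zz') => t /Hw'.
have xc : zx (zt t) @[t --> F'] --> xs.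
  rewrite -[X in _ --> X]zx_zs.
  by apply: cvg_lsubmx; exact: cvg_lsubmx.
have [w1 Ww1 w1c] := Wc T F' xs (fun t => zx (zt t)) w' F'U N_xs xc Ww'.
have Ww'' : \forall t \near F', co (W (zx (zt t))) (w' t).
  by apply: filterS Ww' => t; exact: sub_co.
have := near_rank F'K AI BJ EJ (sub_co Ww1) zz' w1c Ww''.
have E1 (z : 'rV[R]_D) (w w2 : 'rV[R]_d) :
    dim_rows A B E z (theta_row z w) =
    dim_rows A B E z (theta_row z w2).
  by apply: dim_fam_crow => -[i|] //; rewrite (negbTE nA).
apply: filterS => t E2; apply: (eq_trans (E1 (zt t) (wt t) (w' t))).
exact: (eq_trans E2 (E1 zs w1 w0)).
Qed.

Lemma RCRCQ_zs : RCRCQ G H f g h zs.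
Proof.
rewrite /RCRCQ zxy_zs zu_zs => A B E AI BJ EJ w Hw zk wk zz _ Hwk wc.
have rE k z w' := family_rankE (k : {set option 'I_p}) (Is :|: B) (Ks :|: E) w' z.
(* Reads w back from a subgradient [nabla f - (w, 0)], so that convergence of subgradients gives
   convergence of w. *)
pose wz (z : 'rV[R]_D) (w : option 'I_p -> 'rV[R]_D) :=
  lsubmx (grad f (zxy z)) - lsubmx (lsubmx (w None)).
have wE (z : 'rV[R]_D) w' : N (zx z) ->
    (forall i, i \in A -> limiting_subdiff (theta G f g h i) z (w' i)) ->
    forall i, i \in A -> w' i = theta_row z (wz z w') i.
  move=> Nz Hl [i|] iA; first exact: theta_Some_subdiff (Hl _ iA).
  by have [] := theta_None_subdiff Nz (Hl _ iA).
have Nzs : N (zx zs) by rewrite zx_zs.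
suff rk : \forall k \near \oo,
    dim_rows A B E (zk k) (theta_row (zk k) (wz (zk k) (wk k)))
    = dim_rows A B E zs (theta_row zs (wz zs w)).
  have NN := near_N _ zz.
  apply: filterS2 rk (NN _) => k rk Nk; rewrite !rE.
  apply: (eq_trans (dim_fam_crow _ _ _ (wE _ _ Nk (Hwk k)))).
  by apply: (eq_trans rk); exact: esym (dim_fam_crow _ _ _ (wE _ _ Nzs Hw)).
have [nA|nA] := boolP (None \in A); last exact: near_rank_any.
apply: near_rank => //.
- by have [_ +] := theta_None_subdiff Nzs (Hw _ nA); rewrite zx_zs.
- apply: cvgB; last by apply: cvg_lsubmx; apply: cvg_lsubmx; exact: wc.
  apply: cvg_lsubmx; apply: (cvg_comp (fun k => zxy (zk k)) (grad f) _ (f_C1.2 (zxy zs))).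
  exact: cvg_lsubmx.
- have NN := near_N _ zz.
  apply: filterS (NN _) => k Nk.
  by have [] := theta_None_subdiff Nk (Hwk k _ nA).
Qed.

Lemma near_zs_N : \forall z \near zs, N (zx z).
Proof.
have idc : id @ zs --> zs by move=> A.
exact: (near_N (nbhs_filter zs) idc).
Qed.

Lemma objective_calm : exists2 C : R, 0 <= C &
  \forall z \near zs, \forall w \near z, `|F (zxy w) - F (zxy z)| <= C * `|w - z|.
Proof.
have [U nU [C0 [_ HC]]] := F_loclip (zxy zs).
(* The Lipschitz bound holds for every constant beyond [C0], which may be negative. *)
pose C := `|C0| + 1; exists C; first by rewrite addr_ge0.
have C0C : C0 < C by rewrite (le_lt_trans (ler_norm _)) // ltrDl.
have nz : \forall z \near zs, U (zxy z).
  have idc : id @ zs --> zs by move=> A.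
  apply: (@near_cvg _ (nbhs zs) _ (fun z : 'rV[R]_D => zxy z) _ _ _ nU).
  exact: (@cvg_lsubmx _ _ _ _ (nbhs zs) (nbhs_filter zs)).
apply: filterS (near_nbhs_nbhs nz) => z nz'; apply: filterS (nz') => w Uw.
have := HC C C0C (zxy w, zxy z); rewrite /= => /(_ (conj Uw (nbhs_singleton nz'))) => K.
apply: le_trans K _; rewrite ler_wpM2l ?addr_ge0 //.
by rewrite -linearB; exact: norm_lsubmx.
Qed.

Lemma theta_calm : \forall z \near zs, exists2 C : R, 0 <= C &
  \forall w \near z, `|theta G f g h None w - theta G f g h None z| <= C * `|w - z|.
Proof.
apply: filterS near_zs_N => z Nz; have [No Vc Vs Wc _] := N_reg.
have [C1 C10 HC1] := V_calm No Vc Vs Wc Nz.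
have [C2 C20 HC2] := hasgrad_calm (hasgrad_zxy (z := z) (C1_hasgrad f_C1 (zxy z))).
have xc : (fun w : 'rV[R]_D => zx w) @ z --> zx z.
  apply: (@cvg_lsubmx _ _ _ _ (nbhs z) (nbhs_filter z)).
  exact: (@cvg_lsubmx _ _ _ _ (nbhs z) (nbhs_filter z)).
exists (C2 + C1); first exact: addr_ge0.
apply: filterS2 HC2 (near_cvg xc HC1) => w A B; rewrite /theta /f_minus_V.
have -> : f (zxy w) - fine (Vfun f g h (lsubmx (zxy w))) - (f (zxy z) - fine (Vfun f g h (lsubmx (zxy z))))
  = (f (zxy w) - f (zxy z)) - (fine (Vfun f g h (zx w)) - fine (Vfun f g h (zx z))).
  by rewrite /zx; ring.
apply: le_trans (ler_normB _ _) _; rewrite mulrDl; apply: lerD => //.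
apply: le_trans B _; rewrite ler_wpM2l //.
have -> : zx w - zx z = lsubmx (lsubmx (w - z)) by rewrite /zx /zxy !linearB.
exact: le_trans (norm_lsubmx _) (norm_lsubmx _).
Qed.

Definition approximate_multiplier (C eta : R)
    (t : 'rV[R]_D * 'rV[R]_D * 'rV[R]_D * 'rV[R]_d * (cidx -> R)) : Prop :=
  let: (w, z, xi, om, c) := t in
  [/\ [/\ `|w - zs| <= eta, `|z - zs| <= eta & N (zx z)],
      frechet_subdiff (fun z => F (zxy z)) w xi /\ `|xi| <= C,
      limiting_subdiff (f_minus_V f g h) (zxy z) (grad f (zxy z) - row_mx om 0) /\
        co (W (zx z)) om,
      \sum_i c i *: crow z (theta_row z om) i = - xi - 2 *: (z - zs) &
      [/\ 0 <= c (th_idx None),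
          forall i, 0 <= c (th_idx (Some i)) /\ (G (zxy z) 0 i <= 0 -> c (th_idx (Some i)) = 0) &
          forall i, [/\ c (g_idx i) = 0 \/ c (u_idx i) = 0 \/ (c (g_idx i) <= 0 /\ c (u_idx i) <= 0),
            `|zu z 0 i| < - g (zxy z) 0 i -> c (g_idx i) = 0 &
            `|g (zxy z) 0 i| < zu z 0 i -> c (u_idx i) = 0]]].

Lemma approximate_multipliers : exists2 C : R, 0 <= C &
  forall eta, 0 < eta -> exists t, approximate_multiplier C eta t.
Proof.
have [C C0 HC] := objective_calm; exists (C + 1); first by rewrite addr_ge0.
move=> eta eta0.
have [r r0 Hr] := (near_normP _ _).1 (filterI near_zs_N HC).
pose e := Num.min eta (r / 2).
have e0 : 0 < e by rewrite lt_min eta0 divr_gt0.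
have e_eta : e <= eta by rewrite ge_min lexx.
have e_r : e < r by rewrite gt_min; apply/orP; right; lra.
have feas0 : feasible zs by apply/feasibleP; [exact: nbhs_singleton near_zs_N|case: zs_local].
have lmin : \forall z \near zs, feasible z -> F (zxy zs) <= F (zxy z).
  apply: filterS2 near_zs_N zs_local.2 => z Nz Hz fz; apply: Hz.
  exact/(feasibleP Nz).
have [w [z [xi [l [zeta [lG [lE [mu [nu [[wz zz] [Fxi l0 Fz] E HG HK]]]]]]]]]] :=
  @fuzzy_multipliers R D 'I_p 'I_(q + n + s) 'I_m (fun z => F (zxy z)) (theta G f g h None)
    _ _ _ _ _ _ _ _
    (fun i z => hasgrad_zxy (phi := fun w => G w 0 i) (C1_map_hasgrad (zxy z) i G_C1))
    (fun j z => hasgrad_eqs z j)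
    (fun i z => hasgrad_neg_g z i) (fun i z => hasgrad_zu z i) zs e C e0 feas0 lmin HC theta_calm.
have [Nz _] := Hr _ (le_lt_trans zz e_r).
have [_ Cw] := Hr _ (le_lt_trans wz e_r).
have [om [lom com Ezeta]] : exists om : 'rV[R]_d,
    [/\ limiting_subdiff (f_minus_V f g h) (zxy z) (grad f (zxy z) - row_mx om 0),
      co (W (zx z)) om & l *: zeta = l *: theta_row z om None].
  (* When [l] is 0 the minimisation provides no subgradient of f - V; any limiting one takes its
     place, since it enters the sum with coefficient 0. *)
  have [l_eq0|l_neq0] := eqVneq l 0.
    have [zeta' Hz'] := f_minus_V_subdiff_nonempty Nz.
    have [E1 co1] := f_minus_V_subdiff Nz Hz'.
    exists (lsubmx (grad f (zxy z)) - lsubmx zeta'); split => //; first by rewrite -E1.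
    by rewrite l_eq0 !scale0r.
  have Lz := frechet_limiting (Fz l_neq0).
  have [E1 co1] := theta_None_subdiff Nz Lz.
  exists (lsubmx (grad f (zxy z)) - lsubmx (lsubmx zeta)); split => //; last by rewrite {1}E1.
  have [_ L2] := @limiting_lsubmx R (d + s) (m + n) (f_minus_V f g h) z zeta Lz.
  have [E2 _] := f_minus_V_subdiff Nz L2.
  by rewrite -E2.
pose c (i : cidx) : R := match i with
  | inl (inl (inl j)) => lE j
  | inl (inl (inr None)) => l
  | inl (inl (inr (Some i))) => lG i
  | inl (inr i) => mu i
  | inr i => nu i end.
exists (w, z, xi, om, c); split => //.
- by split => //; apply: le_trans e_eta.
- by split => //; exact: frechet_bound Fxi.
- rewrite sum_cidx /c -Ezeta.
  have -> : - xi - 2 *: (z - zs) = - xi + (- (2 *: (z - zs))) by [].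
  rewrite -E big_split /=.
  move: (\sum_i _) (\sum_i _) (\sum_i _) (\sum_i _) => s1 s2 s3 s4.
  by apply/rowP => i; rewrite !mxE; ring.
- by split => // i; have := HK i; rewrite normrN.
Qed.

(** Shows that the sets between the free rows and all active rows, over which [multipliers_limit]
    asks for constant rank, are the families of the hypothesis on J'. *)
Lemma idx_setP (S : {set cidx}) :
  idx_set finset.set0 Is Ks \subset S ->
  S \subset idx_set (Itheta G zs) (Is :|: Js) (Ks :|: Js) ->
  exists (A : {set option 'I_p}) (B E : {set 'I_m}), [/\ A \subset Itheta G zs, B \subset Js, E \subset Js &
    S = idx_set A (Is :|: B) (Ks :|: E)].
Proof.
move=> /fintype.subsetP lo /fintype.subsetP up.
exists [set i | th_idx i \in S]%SET, [set i in Js | g_idx i \in S]%SET, [set i in Js | u_idx i \in S]%SET.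
split.
- by apply/fintype.subsetP => i; rewrite inE => /up; rewrite inE.
- by apply/fintype.subsetP => i; rewrite inE => /andP[].
- by apply/fintype.subsetP => i; rewrite inE => /andP[].
apply/finset.setP => -[[[j|i]|i]|i]; rewrite [RHS]inE.
- by apply: lo; rewrite inE.
- by rewrite inE.
- apply/idP/idP => [iS|].
    have := up _ iS; rewrite inE finset.in_setU => /orP[A|A]; rewrite finset.in_setU ?A //.
    by apply/orP; right; rewrite inE A.
  rewrite finset.in_setU => /orP[A|]; last by rewrite inE => /andP[].
  by apply: lo; rewrite inE.
- apply/idP/idP => [iS|].
    have := up _ iS; rewrite inE finset.in_setU => /orP[A|A]; rewrite finset.in_setU ?A //.
    by apply/orP; right; rewrite inE A.
  rewrite finset.in_setU => /orP[A|]; last by rewrite inE => /andP[].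
  by apply: lo; rewrite inE.
Qed.

Lemma limit_multipliers : exists (xi : 'rV[R]_(d + s)) (om : 'rV[R]_d) (c : cidx -> R),
  [/\ limiting_subdiff F (zxy zs) xi /\
        limiting_subdiff (f_minus_V f g h) (zxy zs) (grad f (zxy zs) - row_mx om 0),
      \sum_i c i *: crow zs (theta_row zs om) i = - row_mx xi 0,
      0 <= c (th_idx None) /\ (forall i, 0 <= c (th_idx (Some i))),
      forall i, i \notin idx_set (Itheta G zs) (Is :|: Js) (Ks :|: Js) -> c i = 0 &
      forall i, i \in Js -> c (g_idx i) = 0 \/ c (u_idx i) = 0 \/
        (c (g_idx i) <= 0 /\ c (u_idx i) <= 0)].
Proof.
have [No Vc Vs Wc _] := N_reg.
have [C C0 HC] := approximate_multipliers.
have HQ (j : nat) : exists t, approximate_multiplier C j.+1%:R^-1 t.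
  by apply: HC; rewrite invr_gt0.
have [tup Htup] := choice HQ.
pose wt j := (tup j).1.1.1.1; pose zt j := (tup j).1.1.1.2; pose xt j := (tup j).1.1.2.
pose ot j := (tup j).1.2; pose ct j := (tup j).2.
have HT j : approximate_multiplier C j.+1%:R^-1 (wt j, zt j, xt j, ot j, ct j).
  by move: (Htup j); rewrite /wt /zt /xt /ot /ct; case: (tup j) => [[[[w z] xi] om] c].
move: wt zt xt ot ct HT => {HQ tup Htup} wt zt xt ot ct HT.
have [U UU FU] := ultra_eventually.
have UF : Filter U by typeclasses eauto.
have UP : ProperFilter U by typeclasses eauto.
have wc : wt @ U --> zs by apply: cvg_dist_harmonic => // j; have [[]] := HT j.
have zc : zt @ U --> zs by apply: cvg_dist_harmonic => // j; have [[]] := HT j.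
have xyc : zxy (zt j) @[j --> U] --> zxy zs by exact: cvg_lsubmx.
have xc : zx (zt j) @[j --> U] --> xs.
  by rewrite -[X in _ --> X]zx_zs; apply: cvg_lsubmx.
have uc : zu (zt j) @[j --> U] --> zu zs by apply: cvg_lsubmx; exact: cvg_rsubmx.
have [xi0 xic] : exists xi0 : 'rV[R]_D, xt @ U --> xi0.
  by apply: (ultra_cvg_rV UU (M := C)); apply: nearW => j; have [_ []] := HT j.
have [CW CW0 HCW] := W_bounded Wc N_xs.
have [om0 omc] : exists om0 : 'rV[R]_d, ot @ U --> om0.
  apply: (ultra_cvg_rV UU (M := CW)); apply: filterS (near_cvg xc HCW) => j A.
  by have [_ _ [_ cj] _ _] := HT j; exact: norm_co A _ cj.
have Lxi : limiting_subdiff (fun z : 'rV[R]_D => F (zxy z)) zs xi0.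
  apply: (limiting_closed UP wc xic); apply: nearW => j.
  by have [_ [Fj _] _ _ _] := HT j; exact: frechet_limiting.
have [Exi Lxi'] := @limiting_lsubmx R (d + s) (m + n) F zs xi0 Lxi.
have Lze : limiting_subdiff (f_minus_V f g h) (zxy zs) (grad f (zxy zs) - row_mx om0 0).
  have c1 : grad f (zxy (zt j)) - row_mx (ot j) 0 @[j --> U] --> grad f (zxy zs) - row_mx om0 0.
    apply: cvgB; first exact: (cvg_comp _ _ xyc (f_C1.2 (zxy zs))).
    by apply: cvg_row_mx => //; exact: cvg_cst.
  by apply: (limiting_closed UP xyc c1); apply: nearW => j; have [_ _ []] := HT j.
have Nzs : N (zx zs) by rewrite zx_zs.
have Wom0 : co (W xs) om0.
  have [_] := f_minus_V_subdiff Nzs Lze.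
  by rewrite linearB /= row_mxKl opprB addrCA subrr addr0 -/(zx zs) zx_zs.
have feas0 : feasible zs by apply/feasibleP => //; case: zs_local.
have [th0 G0 e0 gu0] := feas0.
have near_neg (u : nat -> R) (l : R) : u @ U --> l -> l < 0 -> \forall j \near U, u j < 0.
  by move=> ul l0; exact: cvgr_lt l0.
(* Off the active indices a strict inequality holds at the solution, hence nearby: G < 0, or
   [|u| < - g], or [|g| < u]. Each one annihilates the corresponding coefficient. *)
have c_supp : \forall j \near U, forall i,
    i \notin idx_set (Itheta G zs) (Is :|: Js) (Ks :|: Js) -> ct j i = 0.
  apply: filter_forall => i; have [iA|iA] := boolP (i \in _).
    by apply: nearW.
  have gc k : g (zxy (zt j)) 0 k @[j --> U] --> g (row_mx xs ys) 0 k.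
    rewrite -zxy_zs.
    exact: (cvg_comp _ _ xyc (hasgrad_cvg (C1_map_hasgrad (zxy zs) k g_C1))).
  have uck k : zu (zt j) 0 k @[j --> U] --> us 0 k.
    by rewrite -[us]zu_zs; exact: cvg_mx_coord.
  have {}gu0 k : [/\ 0 <= - g (row_mx xs ys) 0 k, 0 <= us 0 k & - g (row_mx xs ys) 0 k * us 0 k = 0].
    by have := gu0 k; rewrite zxy_zs zu_zs.
  case: i iA => [[[j|[i|]]|i]|i]; rewrite inE //.
  - move=> iG; have Gi : G (zxy zs) 0 i < 0.
      rewrite lt_neqAle G0 andbT; apply: contra iG => Gi.
      by rewrite /Itheta in_setU1 /=; apply/imsetP; exists i => //; rewrite inE.
    have c := cvg_comp _ _ xyc (hasgrad_cvg (C1_map_hasgrad (zxy zs) i G_C1)).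
    have := near_neg _ _ c Gi; apply: filterS => j Gj _.
    have [_ _ _ _ [_ /(_ i)[_ K] _]] := HT j.
    by apply: K; exact: ltW.
  - by rewrite /Itheta in_setU1.
  - rewrite finset.in_setU !inE => iIJ; have [A B E] := gu0 i.
    have gi : g (row_mx xs ys) 0 i < 0.
      rewrite lt_neqAle -oppr_ge0 A andbT; apply: contra iIJ => ->.
      by rewrite /= orbC eq_sym -le_eqVlt.
    have ui : us 0 i = 0.
      by move/eqP: E; rewrite mulf_eq0 oppr_eq0 lt_eqF //= => /eqP.
    have c : `|zu (zt j) 0 i| + g (zxy (zt j)) 0 i @[j --> U] --> `|us 0 i| + g (row_mx xs ys) 0 i.
      by apply: cvgD => //; apply: cvg_norm.
    rewrite ui normr0 add0r in c; have := near_neg _ _ c gi; apply: filterS => j Gj _.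
    have [_ _ _ _ [_ _ /(_ i)[_ K _]]] := HT j; apply: K.
    by rewrite ltrNr -subr_lt0 opprK addrC; lra.
  - rewrite finset.in_setU !inE => iKJ; have [A B E] := gu0 i.
    have ui : 0 < us 0 i.
      rewrite lt_neqAle B andbT eq_sym; apply: contra iKJ => ->.
      by rewrite !andbT orbC -le_eqVlt -oppr_ge0.
    have gi : g (row_mx xs ys) 0 i = 0.
      by move/eqP: E; rewrite mulf_eq0 oppr_eq0 [us 0 i == 0]gt_eqF // orbF => /eqP.
    have c : `|g (zxy (zt j)) 0 i| - zu (zt j) 0 i @[j --> U] --> `|g (row_mx xs ys) 0 i| - us 0 i.
      by apply: cvgB => //; apply: cvg_norm.
    rewrite gi normr0 sub0r in c; have ui' : - us 0 i < 0 by rewrite oppr_lt0.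
    have := near_neg _ _ c ui'; apply: filterS => j Gj _.
    have [_ _ _ _ [_ _ /(_ i)[_ _ K]]] := HT j; apply: K.
    by rewrite -subr_lt0.
have sc : \sum_i ct j i *: crow (zt j) (theta_row (zt j) (ot j)) i @[j --> U] --> - xi0.
  have c1 : - xt j - 2 *: (zt j - zs) @[j --> U] --> - xi0 - 2 *: (zs - zs).
    apply: cvgB; first exact: cvgN.
    by apply: cvgZ; [exact: cvg_cst|apply: cvgB => //; exact: cvg_cst].
  rewrite subrr scaler0 subr0 in c1; apply: cvg_trans c1; apply: near_eq_cvg.
  by apply: nearW => j; have [_ _ _ -> _] := HT j.
have rk (S : {set cidx}) : idx_set finset.set0 Is Ks \subset S ->
    S \subset idx_set (Itheta G zs) (Is :|: Js) (Ks :|: Js) ->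
    \forall j \near U, \dim <<fam S (crow (zt j) (theta_row (zt j) (ot j)))>> =
      \dim <<fam S (crow zs (theta_row zs om0))>>.
  move=> lo up; have [A [B [E [AI BJ EJ ->]]]] := idx_setP lo up.
  have [nA|nA] := boolP (None \in A).
    apply: (near_rank UF AI BJ EJ Wom0 zc omc).
    by apply: nearW => j; have [_ _ []] := HT j.
  exact: (near_rank_any om0 ot UF nA AI BJ EJ zc).
have lohi : idx_set finset.set0 Is Ks \subset idx_set (Itheta G zs) (Is :|: Js) (Ks :|: Js).
  apply/fintype.subsetP => -[[[j|i]|i]|i]; rewrite !inE //.
    by move=> ->.
  by move=> ->.
have rc i : crow (zt j) (theta_row (zt j) (ot j)) i @[j --> U] --> crow zs (theta_row zs om0) i.
  exact: crow_cvg.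
have [c0 [S0 supp0 sgn0]] := multipliers_limit UU rc lohi c_supp sc rk.
(* A single [j] suffices: the sign relations hold for all indices at once, and the pattern of the
   approximate multipliers at [j] passes to [c0]. *)
have [j Hj] := filter_ex sgn0.
exists (lsubmx xi0), om0, c0; split => //.
- by rewrite S0 -Exi.
- have [_ _ _ _ [a b _]] := HT j; split.
    by have [|_ K _] := Hj (th_idx None); [rewrite !inE|exact: K].
  by move=> i; have [|_ K _] := Hj (th_idx (Some i)); [rewrite !inE|apply: K; case: (b i)].
- move=> i; rewrite inE => /andP[gi ui].
  have [_ _ _ _ [_ _ /(_ i)[pat _ _]]] := HT j.
  have [|A1 _ A3] := Hj (g_idx i); first by rewrite !inE (eqP ui) ltxx andbF.
  have [|B1 _ B3] := Hj (u_idx i); first by rewrite !inE (eqP gi) ltxx.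
  case: pat => [/A1|[/B1|[/A3 ? /B3 ?]]]; [by left|by right; left|by right; right].
Qed.

Lemma M_stationary_zs : M_stationary F G H f g h zs.
Proof.
have [xi [om [c [[Lxi Lze] S [cV cG] supp sgn]]]] := limit_multipliers.
rewrite /M_stationary zu_zs zv_zs; move: Lxi Lze; rewrite zxy_zs => Lxi Lze.
split; first by case: zs_local.
pose lH : 'rV[R]_q := \row_j c (eq_idx (lshift s (lshift n j))).
pose lh : 'rV[R]_n := \row_j c (eq_idx (lshift s (rshift q j))).
pose lL : 'rV[R]_s := \row_j c (eq_idx (rshift (q + n) j)).
pose lG : 'rV[R]_p := \row_i c (th_idx (Some i)).
(* The rows are [- nabla g] and the unit vectors of u, while M-stationarity uses [+ nabla g] and
   [- b]; both changes of sign turn the nonpositive pairs into nonnegative ones. *)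
pose a : 'rV[R]_m := \row_i - c (g_idx i).
pose b : 'rV[R]_m := \row_i - c (u_idx i).
set xy := row_mx xs ys.
have Ec : (fun j => c (eq_idx j)) =1 (fun j => row_mx (row_mx lH lh) lL 0 j).
  move=> j; rewrite -[j]splitK; case: (fintype.split j) => [j1|j1] /=.
    rewrite row_mxEl -[j1]splitK; case: (fintype.split j1) => [j2|j2] /=.
      by rewrite row_mxEl mxE.
    by rewrite row_mxEr mxE.
  by rewrite row_mxEr mxE.
have S1 : \sum_j c (eq_idx j) *: eqs_row zs j =
  row_mx (lH *m jac H xy + lh *m jac h xy + lL *m jacL xy us vs)
    (row_mx (lL *m (rsubmx (jac g xy))^T) (lL *m (rsubmx (jac h xy))^T)).
  have := sum_eqs_row zs lH lh lL; rewrite zxy_zs zu_zs zv_zs => <-.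
  by apply: eq_bigr => j _; rewrite Ec.
have S2 : \sum_i c (th_idx (Some i)) *: theta_row zs om (Some i) =
    row_mx (\sum_(i in IG G xy) lG 0 i *: row i (jac G xy)) 0.
  rewrite /theta_row zxy_zs; under eq_bigr do rewrite scale_row_mx scaler0.
  rewrite sum_row_mx big1_eq; congr row_mx; rewrite [RHS]big_mkcond; apply: eq_bigr => i _.
  rewrite mxE; case: ifPn => // iG; rewrite supp ?scale0r //.
  rewrite inE /Itheta zxy_zs in_setU1 /=; apply: contra iG => /imsetP[k kG [->]].
  exact: kG.
have S3 : \sum_i c (g_idx i) *: crow zs (theta_row zs om) (g_idx i) =
    row_mx (\sum_(i in Is :|: Js) a 0 i *: row i (jac g xy)) 0.
  rewrite /= zxy_zs; under eq_bigr do rewrite scale_row_mx scaler0.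
  rewrite sum_row_mx big1_eq; congr row_mx; rewrite [RHS]big_mkcond; apply: eq_bigr => i _.
  rewrite mxE scaleNr scalerN; case: ifPn => // iG; rewrite supp ?scale0r ?oppr0 //.
  by rewrite inE.
have S4 : \sum_i c (u_idx i) *: crow zs (theta_row zs om) (u_idx i) =
    row_mx 0 (row_mx (- b) 0).
  rewrite /=; under eq_bigr do rewrite !scale_row_mx !scaler0.
  rewrite !sum_row_mx !big1_eq; congr (row_mx _ (row_mx _ _)).
  rewrite [RHS]row_sum_delta; apply: eq_bigr => i _; by rewrite !mxE opprK.
move: S; rewrite sum_cidx S1 S2 S3 S4 /= zxy_zs -/xy.
set zeta := grad f xy - row_mx om 0.
have z0 : (0 : 'rV[R]_(m + n)) = row_mx 0 0 by rewrite row_mx0.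
rewrite z0 !scale_row_mx !scaler0 !opp_row_mx !oppr0 !add_row_mx !addr0.
move=> /eq_row_mx[Exy /eq_row_mx[Eu Ev]].
exists xi, zeta, (c (th_idx None)), lG, lH, lh, lL, a, b; split.
- by [].
- by split => // i _; rewrite mxE.
- rewrite jac_gradyL -/xy.
  move/eqP: Exy; rewrite -addr_eq0 => /eqP Exy; apply: (eq_trans (esym Exy)) => {Exy}.
  have ac (t1 t2 t3 t4 t5 t6 t7 : 'rV[R]_(d + s)) :
      t6 + t5 + t4 + (t3 + t2) + t1 + t7 = t7 + t3 + t2 + t6 + t5 + t4 + t1.
    by apply/rowP => i; rewrite !mxE; ring.
  exact: ac.
- split; apply: trmx_inj; rewrite trmx0.
    by rewrite linearB /= trmx_mul !trmxK -Eu.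
  by rewrite trmx_mul trmxK.
- split => i iI; rewrite ?mxE.
  + rewrite supp ?oppr0 // inE finset.in_setU; move: iI; rewrite !inE => /andP[/eqP -> u0].
    by rewrite ltxx (gt_eqF u0) !andbF.
  + rewrite supp ?oppr0 // inE finset.in_setU; move: iI; rewrite !inE => /andP[g0 /eqP ->].
    by rewrite ltxx (lt_eqF g0).
  + have [->|[->|[ca cb]]] := sgn i iI; rewrite ?oppr0 ?mul0r ?mulr0; [by right|by right|].
    have [->|ca0] := eqVneq (c (g_idx i)) 0; first by rewrite oppr0 mul0r; right.
    have [->|cb0] := eqVneq (c (u_idx i)) 0; first by rewrite oppr0 mulr0; right.
    by left; rewrite !oppr_gt0 !lt_neqAle ca0 cb0.
Qed.

End AtPoint.
End CombinedProgramMultipliers.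

Theorem theorem5p3 (R : realType) (d s p q m n : nat)
  (F : 'rV[R]_(d + s) -> R)
  (G : 'rV[R]_(d + s) -> 'rV[R]_p) (H : 'rV[R]_(d + s) -> 'rV[R]_q)
  (f : 'rV[R]_(d + s) -> R)
  (g : 'rV[R]_(d + s) -> 'rV[R]_m) (h : 'rV[R]_(d + s) -> 'rV[R]_n)
  (F_loclip : locally_lipschitz F)
  (G_C1 : C1_map G) (H_C1 : C1_map H)
  (f_C1 : C1_fun f) (g_C1 : C1_map g) (h_C1 : C1_map h)
  (fy_C1 : C1_map (fun z => rsubmx (grad f z)))
  (gy_C1 : forall i, C1_map (fun z => rsubmx (row i (jac g z))))
  (hy_C1 : forall j, C1_map (fun z => rsubmx (row j (jac h z))))
  (xs : 'rV[R]_d) (ys : 'rV[R]_s) (us : 'rV[R]_m) (vs : 'rV[R]_n)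
  (zs_local : CP_local_solution F G H f g h (zpt xs ys us vs))
  (W : 'rV[R]_d -> set 'rV[R]_d)
  (lower_level :
     (Y_constant_compact g h /\ W = W_fixed f g h)
     \/ ((Y_uniformly_bounded g h xs /\
          (forall y, Sset f g h xs y -> MFCQ g h xs y))
         /\ W = W_moving f g h))
  (J_rank : Jprime_constant_rank G H f g h W xs ys us vs) :
  RCRCQ G H f g h (zpt xs ys us vs) /\
  M_stationary F G H f g h (zpt xs ys us vs).
Proof.
have Sys : Sset f g h xs ys.
  by have := Sset_CP_feasible zs_local.1; rewrite zx_zs zxy_zs row_mxKr.
have [N N_xs N_reg] := lower_level_regular f_C1 g_C1 h_C1 Sys lower_level.
split.
  exact: (RCRCQ_zs G_C1 H_C1 f_C1 g_C1 h_C1 fy_C1 gy_C1 hy_C1 N_reg J_rank N_xs).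
exact: (M_stationary_zs F_loclip G_C1 H_C1 f_C1 g_C1 h_C1 fy_C1 gy_C1 hy_C1 N_reg J_rank N_xs zs_local).
Qed.
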